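(* Let $s=\sigma+it$ with $0<\sigma<1$ fixed, $t>0$, and $N=\sqrt{t/2\pi}$. Then, as $t\to\infty$, $$\begin{aligned}\zeta(s)={}&\int_0^1 B_N(\alpha)\,\zeta_1(s,\alpha)\,d\alpha+\chi(s)\int_0^1 B_N(-\alpha)\,\zeta_1(1-s,\alpha)\,d\alpha\\&-\int_0^1 B_N(\alpha)\sum_{1\le n\le N}(n+\alpha)^{-s}\,d\alpha-\chi(s)\int_0^1 B_N(-\alpha)\sum_{1\le n\le N}(n+\alpha)^{s-1}\,d\alpha+\mathcal O\left(t^{-\sigma/2}\log t\right).\end{aligned}$$ Furthermore, as $t\to\infty$, $$\zeta(s)=\int_0^1 B_N(\alpha)\,\zeta_1(s,\alpha)\,d\alpha+\chi(s)\int_0^1 B_N(-\alpha)\,\zeta_1(1-s,\alpha)\,d\alpha+\mathcal O\left(t^{-\sigma/2}\log t\right).$$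
   Context: $\zeta$ is the Riemann zeta function. The modified Hurwitz zeta function is $\zeta_1(s,\alpha)=\sum_{n=1}^\infty (n+\alpha)^{-s}$ for $\Re s>1$ (here $\alpha\ge 0$), and by analytic continuation for $s\in\mathbf C$, $s\ne1$. For real $\alpha$, $B_N(\alpha)=\sum_{1\le n\le N}e^{2\pi i n\alpha}$ (sum over integers $n$). The function $\chi$ is $\chi(s)=2^{s}\pi^{s-1}\sin(\pi s/2)\,\Gamma(1-s)$, where $\Gamma$ is the Gamma function, so that $\zeta(s)=\chi(s)\zeta(1-s)$. *)

(* Defs.v *)
From Stdlib Require Import Reals.
From Coquelicot Require Import Coquelicot.

Set Implicit Arguments.

Open Scope R_scope.

Definition Cexp (z : C) : C := (exp (Re z) * cos (Im z), exp (Re z) * sin (Im z)).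

Definition Csin (z : C) : C := ((Cexp (Ci * z) - Cexp (- (Ci * z))) / (2 * Ci))%C.

(* [x ^ s] for a real base; meaningful only for [0 < x], since the Stdlib
   [ln] is [0] on nonpositive reals. *)
Definition Rcpow (x : R) (s : C) : C := Cexp (s * ln x)%C.

(* Analyticity in the power-series sense: [is_pseries a h l] says that
   [\sum_k a_k h^k] converges to [l]. *)
Definition analytic_at (f : C -> C) (z0 : C) : Prop :=
  exists a : nat -> C,
    @locally C_UniformSpace z0 (fun z : C =>
      @is_pseries C_AbsRing C_NormedModule a (z - z0)%C (f z)).

(* [f] is the analytic continuation to [C \ {1}] of [\sum_(k >= 0) a_k(s)],
   a series convergent for [Re s > 1].  By the identity theorem this determines
   [f] away from [1]; the value [f 1] is irrelevant. *)
Definition is_continuation_of_series (a : nat -> C -> C) (f : C -> C) : Prop :=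
  (forall s : C, 1 < Re s ->
     @is_series C_AbsRing C_NormedModule (fun k => a k s) (f s)) /\
  (forall s : C, s <> RtoC 1 -> analytic_at f s).

Definition is_riemann_zeta (zeta : C -> C) : Prop :=
  is_continuation_of_series (fun k s => Rcpow (INR (S k)) (- s)) zeta.

Definition is_hurwitz_zeta1 (zeta1 : C -> R -> C) : Prop :=
  forall alpha : R, 0 <= alpha ->
    is_continuation_of_series
      (fun k s => Rcpow (INR (S k) + alpha) (- s)) (fun s => zeta1 s alpha).

(* Euler's integral, convergent for [Re z > 0]. *)
Definition Gamma_integral (z : C) : C :=
  @RInt_gen C_R_CompleteNormedModule
    (fun x : R => (Rcpow x (z - 1) * exp (- x))%C)
    (at_right 0) (Rbar_locally p_infty).

Fixpoint rising (z : C) (m : nat) : C :=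
  match m with
  | O => RtoC 1
  | S k => (rising z k * (z + INR k))%C
  end.

(* [Gamma z = Gamma (z + m) / (z (z + 1) ... (z + m - 1))] with [m] the least
   natural number such that [Re (z + m) > 0]; thus [m = 0] if [Re z > 0]. *)
Definition Gamma (z : C) : C :=
  let m := Z.to_nat (up (- Re z)) in
  (Gamma_integral (z + INR m) / rising z m)%C.

Definition chi (s : C) : C :=
  (Rcpow 2 s * Rcpow PI (s - 1) * Csin (PI * s / 2) * Gamma (1 - s))%C.

(* [\sum_(1 <= n <= x) a n] for a real bound [x]; [Int_part] is the floor. *)
Definition Csum_upto (x : R) (a : nat -> C) : C :=
  @sum_n_m C_AbelianMonoid a 1 (Z.to_nat (Int_part x)).

Definition Bsum (N alpha : R) : C :=
  Csum_upto N (fun n => Cexp (2 * PI * Ci * INR n * alpha)%C).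

Definition CInt01 (f : R -> C) : C := @RInt C_R_CompleteNormedModule f 0 1.

Definition is_bigO_infty (f : R -> C) (g : R -> R) : Prop :=
  exists K : R,
    Rbar_locally p_infty (fun t : R => Cmod (f t) <= K * Rabs (g t)).

(* Main.v *)
Require Import Defs.
From Stdlib Require Import Reals Lra Lia Factorial ZArith.
From Coquelicot Require Import Coquelicot.

(** Integrating [B_N zeta1] termwise turns the first two integrals into the sums over [k <= N] of
  [A_k = int_1^oo x^(-s) e^(2 pi i k x) dx] and of the conjugates of its analogue at [1 - sigma + i t].
  Poisson summation beyond [N] compares [zeta(s) - sum_(n <= N) n^(-s)] with the sum of the [A_k]:
  the frequencies [k > N] have no stationary point there, while for [k <= N] the initial piece of
  [A_k] up to about [N] ends before the stationary point [t / (2 pi k)], with a gap of about [N - k];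
  first derivative estimates bound both contributions by [O(N^(-sigma) log N)].
  On [(0, 1)] no integral with [k <= N] has a stationary point, so the analogues of the [A_k] may be
  extended to [(0, oo)], where rotating the contour evaluates them by [Gamma]; by the reflection
  formula [chi(s)] times the sum of their conjugates is [sum_(n <= N) n^(-s)] up to
  [O(t^(-sigma/2))].  The two integrals subtracted in the first formula reduce to the initial
  pieces up to [N + 1] alone, and are therefore absorbed by the error term. *)

Open Scope R_scope.

(** What is given about [zeta] and [zeta1] is a series for Re s > 1 and analyticity, and about
    [Gamma] an integral; everything else is produced by integration over real intervals. In the
    strip both zeta functions are reached as limits of [hsum] minus (m + 1 + alpha)^(1 - s) / (1 -
    s), uniformly in alpha; the limit is identified with the continuation by power series along a
    horizontal line, which misses the pole when t is nonzero. The reflection formula results from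
    comparing Euler's limit for Gamma with moments of powers of the cosine. The bound |chi(s)| =
    O(t^(1/2 - sigma)) is read off an oscillatory integral, cut at distance sqrt t from its
    stationary point, instead of Stirling's formula. The delicate point is uniformity in the number
    of frequencies. For k > N a first derivative bound alone is of size N^(-sigma) / (k - N), which
    is not summable. Starting at the half-integer floor(N) + 5/2 and pairing k with -k removes the
    boundary terms and gains a factor N / k; the extra 5/2 keeps the stationary point of the first
    frequency beyond N at a safe distance. *)

Notation is_CInt := (@is_RInt C_R_NormedModule).
Definition CInt (f : R -> C) (a b : R) : C := @RInt C_R_CompleteNormedModule f a b.
Notation Cder := (@is_derive R_AbsRing C_R_NormedModule).
Notation Ccont := (@continuous R_UniformSpace C_UniformSpace).

(** * Limits of complex-valued functions along a filter *)

Definition Clim {T : Type} (F : (T -> Prop) -> Prop) (f : T -> C) (l : C) : Prop :=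
  forall eps : R, 0 < eps -> F (fun x => Cmod (f x - l)%C < eps).

Lemma exp_le_compat (x y : R) : x <= y -> exp x <= exp y.
Proof. intros [H|<-]; [left; apply exp_increasing, H|apply Rle_refl]. Qed.

Lemma ln_le_compat (x y : R) : 0 < x -> x <= y -> ln x <= ln y.
Proof. intros Hx [H|<-]; [left; apply ln_increasing; assumption|apply Rle_refl]. Qed.

Lemma Rpower_opp_le (x y a : R) : 0 <= a -> 0 < x <= y -> Rpower y (- a) <= Rpower x (- a).
Proof.
intros Ha Hxy. unfold Rpower. apply exp_le_compat.
assert (ln x <= ln y) by (apply ln_le_compat; lra). nra.
Qed.

Lemma Rmult_div_succ_lt (K eps : R) : 0 <= K -> 0 < eps -> K * (eps / (K + 1)) < eps.
Proof.
intros HK He. apply Rmult_lt_reg_r with (K + 1). lra.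
replace (K * (eps / (K + 1)) * (K + 1)) with (eps * K) by (field; lra). nra.
Qed.

Lemma Ceq (z w : C) : Re z = Re w -> Im z = Im w -> z = w.
Proof. destruct z, w; simpl; intros -> ->; reflexivity. Qed.

(** The epsilon form keeps estimates in terms of [Cmod]; through this equivalence the results on
    continuity, series and integrals that are stated with filters become usable. *)
Lemma Clim_filterlim {T : Type} (F : (T -> Prop) -> Prop) {FF : Filter F}
  (f : T -> C) (l : C) :
  Clim F f l <-> filterlim f F (@locally C_UniformSpace l).
Proof.
split; intros H.
- apply (@filterlim_locally_ball_norm R_AbsRing T C_R_NormedModule F FF).
  intros eps. generalize (H eps (cond_pos eps)). apply filter_imp.
  intros x Hx. unfold ball_norm. rewrite <- Cmod_norm. exact Hx.
- intros eps Heps.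
  generalize (proj1 (@filterlim_locally_ball_norm R_AbsRing T C_R_NormedModule F FF f l) H
    (mkposreal eps Heps)). apply filter_imp.
  intros x Hx. unfold ball_norm in Hx. rewrite <- Cmod_norm in Hx. exact Hx.
Qed.

Lemma Cminus_0_r (x : C) : (x - 0)%C = x.
Proof. ring. Qed.

Lemma Cmod_sym (z w : C) : Cmod (z - w)%C = Cmod (w - z)%C.
Proof. rewrite <- Cmod_opp. f_equal. ring. Qed.

Lemma Cmod_sub_triangle (x y z : C) :
  Cmod (x - z)%C <= Cmod (x - y)%C + Cmod (y - z)%C.
Proof. replace (x - z)%C with ((x - y) + (y - z))%C by ring. apply Cmod_triangle. Qed.

Lemma Cmod_minus_le (x y : C) : Cmod (x - y)%C <= Cmod x + Cmod y.
Proof. rewrite <- (Cmod_opp y). apply Cmod_triangle. Qed.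

Lemma Cmod_le_sub (x y : C) : Cmod x <= Cmod y + Cmod (x - y)%C.
Proof. replace x with (y + (x - y))%C at 1 by ring. apply Cmod_triangle. Qed.

Lemma Clim_unique {T : Type} (F : (T -> Prop) -> Prop) {FF : ProperFilter F}
  (f : T -> C) (l l' : C) : Clim F f l -> Clim F f l' -> l = l'.
Proof.
intros H H'.
destruct (Ceq_dec l l') as [E|E]; [exact E|exfalso].
assert (Hp : 0 < Cmod (l - l')%C).
{ apply Cmod_gt_0. apply Cminus_eq_contra, E. }
assert (He : 0 < Cmod (l - l')%C / 2) by lra.
destruct (filter_ex _ (filter_and _ _ (H _ He) (H' _ He))) as [x [H1 H2]].
generalize (Cmod_sub_triangle l (f x) l'). rewrite (Cmod_sym l (f x)). lra.
Qed.

Lemma Clim_plus {T : Type} (F : (T -> Prop) -> Prop) {FF : Filter F}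
  (f g : T -> C) (l m : C) :
  Clim F f l -> Clim F g m -> Clim F (fun x => f x + g x)%C (l + m)%C.
Proof.
intros Hf Hg eps Heps.
assert (He : 0 < eps / 2) by lra.
generalize (filter_and _ _ (Hf _ He) (Hg _ He)). apply filter_imp.
intros x [H1 H2].
replace (f x + g x - (l + m))%C with ((f x - l) + (g x - m))%C by ring.
generalize (Cmod_triangle (f x - l)%C (g x - m)%C). lra.
Qed.

Lemma Clim_ext {T : Type} (F : (T -> Prop) -> Prop) {FF : Filter F}
  (f g : T -> C) (l : C) : F (fun x => f x = g x) -> Clim F f l -> Clim F g l.
Proof.
intros E H eps Heps. generalize (filter_and _ _ E (H _ Heps)). apply filter_imp.
intros x [<- H1]. exact H1.
Qed.

Lemma Clim_const {T : Type} (F : (T -> Prop) -> Prop) {FF : Filter F} (l : C) :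
  Clim F (fun _ : T => l) l.
Proof.
intros eps Heps. apply filter_forall. intros _.
replace (l - l)%C with (RtoC 0) by ring. rewrite Cmod_0. exact Heps.
Qed.

Lemma Clim_scal {T : Type} (F : (T -> Prop) -> Prop) {FF : Filter F}
  (c : C) (f : T -> C) (l : C) : Clim F f l -> Clim F (fun x => c * f x)%C (c * l)%C.
Proof.
intros H eps Heps.
assert (Hc : 0 < Cmod c + 1) by (generalize (Cmod_ge_0 c); lra).
assert (He : 0 < eps / (Cmod c + 1)) by (apply Rdiv_lt_0_compat; lra).
generalize (H _ He). apply filter_imp. intros x Hx.
replace (c * f x - c * l)%C with (c * (f x - l))%C by ring.
rewrite Cmod_mult.
apply Rle_lt_trans with ((Cmod c + 1) * Cmod (f x - l)%C).
- generalize (Cmod_ge_0 (f x - l)%C). nra.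
- apply Rmult_lt_reg_r with (/ (Cmod c + 1)). apply Rinv_0_lt_compat, Hc.
  replace ((Cmod c + 1) * Cmod (f x - l)%C * / (Cmod c + 1))%R
    with (Cmod (f x - l)%C) by (field; lra).
  exact Hx.
Qed.

Lemma Clim_minus {T : Type} (F : (T -> Prop) -> Prop) {FF : Filter F}
  (f g : T -> C) (l m : C) :
  Clim F f l -> Clim F g m -> Clim F (fun x => f x - g x)%C (l - m)%C.
Proof.
intros Hf Hg. apply (Clim_plus F f (fun x => - g x)%C); [exact Hf|].
replace (- m)%C with ((-(1)) * m)%C by ring.
apply (Clim_ext F (fun x => (-(1)) * g x)%C).
- apply filter_forall. intros x; ring.
- apply (Clim_scal F). exact Hg.
Qed.

Lemma Clim_Cmod_le {T : Type} (F : (T -> Prop) -> Prop) {FF : ProperFilter F}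
  (f : T -> C) (l : C) (B : R) :
  Clim F f l -> F (fun x => Cmod (f x) <= B) -> Cmod l <= B.
Proof.
intros H HB. apply le_epsilon. intros eps Heps.
destruct (filter_ex _ (filter_and _ _ (H _ Heps) HB)) as [x [H1 H2]].
generalize (Cmod_le_sub l (f x)). rewrite (Cmod_sym l (f x)). lra.
Qed.

Lemma Clim_squeeze {T : Type} (F : (T -> Prop) -> Prop) {FF : Filter F}
  (f : T -> C) (l : C) (g : T -> R) :
  F (fun x => Cmod (f x - l)%C <= g x) -> filterlim g F (locally 0) -> Clim F f l.
Proof.
intros H Hg eps Heps.
assert (H0 : F (fun x => Rabs (g x - 0) < eps)).
{ apply (Hg (fun y => Rabs (y - 0) < eps)). exists (mkposreal eps Heps). intros y Hy. exact Hy. }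
generalize (filter_and _ _ H H0). apply filter_imp. intros x [H1 H2].
rewrite Rminus_0_r in H2. generalize (Rle_abs (g x)). lra.
Qed.

Lemma Clim_conj {T : Type} (F : (T -> Prop) -> Prop) {FF : Filter F}
  (f : T -> C) (l : C) : Clim F f l -> Clim F (fun x => Cconj (f x)) (Cconj l).
Proof.
intros H eps Heps. generalize (H _ Heps). apply filter_imp. intros x Hx.
rewrite <- Cminus_conj, Cmod_conj. exact Hx.
Qed.

Lemma Clim_comp {T U : Type} (F : (T -> Prop) -> Prop) (G : (U -> Prop) -> Prop)
  (g : T -> U) (f : U -> C) (l : C) :
  filterlim g F G -> Clim G f l -> Clim F (fun x => f (g x)) l.
Proof. intros Hg H eps Heps. exact (Hg _ (H eps Heps)). Qed.

(** * The complex exponential and powers *)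

Lemma Cexp_plus (z w : C) : Cexp (z + w) = (Cexp z * Cexp w)%C.
Proof.
destruct z as [a b], w as [c d]. unfold Cexp, Cmult; simpl.
rewrite exp_plus, cos_plus, sin_plus. f_equal; ring.
Qed.

Lemma Cexp_0 : Cexp 0 = 1.
Proof. unfold Cexp; simpl. rewrite exp_0, cos_0, sin_0. unfold RtoC; f_equal; ring. Qed.

Lemma Cmod_Cexp (z : C) : Cmod (Cexp z) = exp (Re z).
Proof.
unfold Cmod, Cexp; simpl.
replace (exp (Re z) * cos (Im z) * (exp (Re z) * cos (Im z) * 1) +
  exp (Re z) * sin (Im z) * (exp (Re z) * sin (Im z) * 1))
  with (exp (Re z) * exp (Re z) * (Rsqr (sin (Im z)) + Rsqr (cos (Im z)))) by (unfold Rsqr; ring).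
rewrite sin2_cos2, Rmult_1_r. apply sqrt_square. left; apply exp_pos.
Qed.

Lemma Cexp_neq_0 (z : C) : Cexp z <> 0.
Proof. intros H. generalize (Cmod_Cexp z). rewrite H, Cmod_0. generalize (exp_pos (Re z)); lra. Qed.

Lemma Cexp_opp (z : C) : Cexp (- z) = (/ Cexp z)%C.
Proof.
generalize (Cexp_neq_0 z); intros Hz.
assert (H : (Cexp (- z) * Cexp z = 1)%C).
{ rewrite <- Cexp_plus. replace (- z + z)%C with (RtoC 0) by ring. apply Cexp_0. }
replace (Cexp (- z)) with (Cexp (- z) * Cexp z * / Cexp z)%C by (field; exact Hz).
rewrite H. field; exact Hz.
Qed.

Lemma Cexp_conj (z : C) : Cexp (Cconj z) = Cconj (Cexp z).
Proof. destruct z as [a b]. apply Ceq; simpl; rewrite ?cos_neg, ?sin_neg; ring. Qed.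

Lemma Cexp_RtoC (x : R) : Cexp x = exp x.
Proof. unfold Cexp, RtoC; simpl. rewrite cos_0, sin_0. f_equal; ring. Qed.

Lemma RtoC_conj (x : R) : Cconj x = x.
Proof. apply Ceq; simpl; ring. Qed.

Lemma Rcpow_conj (x : R) (s : C) : Rcpow x (Cconj s) = Cconj (Rcpow x s).
Proof. unfold Rcpow. rewrite <- Cexp_conj, Cmult_conj, RtoC_conj. reflexivity. Qed.

Lemma Rcpow_plus (x : R) (z w : C) : Rcpow x (z + w) = (Rcpow x z * Rcpow x w)%C.
Proof. unfold Rcpow. rewrite <- Cexp_plus. f_equal; ring. Qed.

Lemma Rcpow_opp (x : R) (z : C) : Rcpow x (- z) = (/ Rcpow x z)%C.
Proof. unfold Rcpow. rewrite <- Cexp_opp. apply f_equal. ring. Qed.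

Lemma Rcpow_neq_0 (x : R) (z : C) : Rcpow x z <> 0.
Proof. apply Cexp_neq_0. Qed.

Lemma Rcpow_mult (x y : R) (z : C) : 0 < x -> 0 < y ->
  Rcpow (x * y) z = (Rcpow x z * Rcpow y z)%C.
Proof.
intros Hx Hy. unfold Rcpow. rewrite <- Cexp_plus, ln_mult, RtoC_plus by assumption. f_equal; ring.
Qed.

Lemma Rcpow_RtoC (x y : R) : Rcpow x (RtoC y) = Rpower x y.
Proof. unfold Rcpow, Rpower. rewrite <- RtoC_mult. apply Cexp_RtoC. Qed.

Lemma Rcpow_1 (x : R) : 0 < x -> Rcpow x 1 = x.
Proof. intros Hx. rewrite Rcpow_RtoC, Rpower_1; auto. Qed.

Lemma Rcpow_0 (x : R) : Rcpow x 0 = 1.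
Proof. unfold Rcpow. rewrite Cmult_0_l. apply Cexp_0. Qed.

Lemma Rcpow_1_l (s : C) : Rcpow 1 s = 1.
Proof. unfold Rcpow. rewrite ln_1, Cmult_0_r. apply Cexp_0. Qed.

Lemma Cmod_Rcpow (x : R) (z : C) : Cmod (Rcpow x z) = Rpower x (Re z).
Proof. unfold Rcpow, Rpower. rewrite Cmod_Cexp, re_scal_r. reflexivity. Qed.

Lemma Cmod_Cexp_Ci (x : R) : Cmod (Cexp (Ci * x)%C) = 1.
Proof.
rewrite Cmod_Cexp. replace (Re (Ci * x)%C) with 0. apply exp_0. simpl; ring.
Qed.

(** * Derivatives of complex-valued functions of a real variable *)

Lemma Cder_pair (f : R -> C) (x : R) (l : C) :
  Cder f x l <-> is_derive (fun y => Re (f y)) x (Re l) /\ is_derive (fun y => Im (f y)) x (Im l).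
Proof.
split.
- intros H. split.
  + exact (filterdiff_comp (U := R_NormedModule) (V := C_R_NormedModule) (W := R_NormedModule)
      f (fun z : C => fst z) (fun y => scal y l) (fun z => fst z) H
      (filterdiff_linear _ is_linear_fst)).
  + exact (filterdiff_comp (U := R_NormedModule) (V := C_R_NormedModule) (W := R_NormedModule)
      f (fun z : C => snd z) (fun y => scal y l) (fun z => snd z) H
      (filterdiff_linear _ is_linear_snd)).
- intros [H1 H2].
  apply (filterdiff_ext (U := R_NormedModule) (V := C_R_NormedModule) (fun y : R => (Re (f y), Im (f y)) : C_R_NormedModule)).
  { intros y. destruct (f y); reflexivity. }
  apply (filterdiff_ext_lin (U := R_NormedModule) (V := C_R_NormedModule) _ (fun y : R => (scal y (Re l), scal y (Im l)) : C_R_NormedModule)).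
  2:{ intros y. destruct l; reflexivity. }
  apply (filterdiff_comp_2 (T := R_NormedModule) (U := R_NormedModule) (V := R_NormedModule) (W := C_R_NormedModule) (fun y => Re (f y)) (fun y => Im (f y))
    (fun a b => (a, b) : C_R_NormedModule) _ _ (fun a b => (a, b)) H1 H2).
  apply filterdiff_linear.
  split.
  + intros u v; reflexivity.
  + intros k u; reflexivity.
  + exists 1. split. lra. intros u. rewrite Rmult_1_l. destruct u. apply Rle_refl.
Qed.

Lemma is_derive_eq (f : R -> R) (x l l' : R) : is_derive f x l -> l = l' -> is_derive f x l'.
Proof. intros H <-; exact H. Qed.

Lemma Cder_eq (f : R -> C) (x : R) (l l' : C) : Cder f x l -> l = l' -> Cder f x l'.
Proof. intros H <-; exact H. Qed.

Lemma Cder_ext (f g : R -> C) (x : R) (l : C) :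
  (forall y, f y = g y) -> Cder f x l -> Cder g x l.
Proof. intros E H. apply is_derive_ext with (2 := H). exact E. Qed.

Lemma Cder_const (c : C) (x : R) : Cder (fun _ => c) x (RtoC 0).
Proof. apply @is_derive_const. Qed.

Lemma Cder_RtoC (f : R -> R) (x l : R) : is_derive f x l -> Cder (fun y => RtoC (f y)) x (RtoC l).
Proof. intros H. apply Cder_pair. split; simpl. exact H. apply @is_derive_const. Qed.

Lemma Cder_plus (f g : R -> C) (x : R) (l m : C) :
  Cder f x l -> Cder g x m -> Cder (fun y => f y + g y)%C x (l + m)%C.
Proof. intros Hf Hg. exact (is_derive_plus (V := C_R_NormedModule) f g x l m Hf Hg). Qed.

Lemma Cder_minus (f g : R -> C) (x : R) (l m : C) :
  Cder f x l -> Cder g x m -> Cder (fun y => f y - g y)%C x (l - m)%C.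
Proof. intros Hf Hg. exact (is_derive_minus (V := C_R_NormedModule) f g x l m Hf Hg). Qed.

Lemma Cder_mult (f g : R -> C) (x : R) (l m : C) :
  Cder f x l -> Cder g x m -> Cder (fun y => f y * g y)%C x (l * g x + f x * m)%C.
Proof.
intros Hf Hg. apply Cder_pair in Hf; apply Cder_pair in Hg.
destruct Hf as [H1 H2], Hg as [H3 H4].
assert (P : forall u v u' v', is_derive u x u' -> is_derive v x v' ->
  is_derive (fun y => u y * v y) x (u' * v x + u x * v')).
{ intros u v u' v' Hu Hv. apply @is_derive_mult; auto. intros; apply Rmult_comm. }
apply Cder_pair; split.
- replace (Re (l * g x + f x * m)%C) with
    ((Re l * Re (g x) + Re (f x) * Re m) - (Im l * Im (g x) + Im (f x) * Im m)) by (simpl; unfold Re, Im; ring).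
  exact (is_derive_minus _ _ _ _ _ (P _ _ _ _ H1 H3) (P _ _ _ _ H2 H4)).
- replace (Im (l * g x + f x * m)%C) with
    ((Re l * Im (g x) + Re (f x) * Im m) + (Im l * Re (g x) + Im (f x) * Re m)) by (simpl; unfold Re, Im; ring).
  exact (is_derive_plus _ _ _ _ _ (P _ _ _ _ H1 H4) (P _ _ _ _ H2 H3)).
Qed.

Lemma Cder_scal (c : C) (f : R -> C) (x : R) (l : C) :
  Cder f x l -> Cder (fun y => c * f y)%C x (c * l)%C.
Proof.
intros H. apply Cder_eq with (0 * f x + c * l)%C; [|ring].
apply (Cder_mult (fun _ => c)); [apply Cder_const|exact H].
Qed.

Lemma Cder_comp (f : R -> C) (g : R -> R) (x dg : R) (df : C) :
  Cder f (g x) df -> is_derive g x dg -> Cder (fun y => f (g y)) x (dg * df)%C.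
Proof.
intros Hf Hg. apply Cder_eq with (@scal R_AbsRing C_R_NormedModule dg df); [|apply scal_R_Cmult].
apply (is_derive_comp f g x df dg Hf Hg).
Qed.

Lemma Cder_Cexp (f : R -> C) (x : R) (l : C) :
  Cder f x l -> Cder (fun y => Cexp (f y)) x (l * Cexp (f x))%C.
Proof.
intros H. apply Cder_pair in H. destruct H as [H1 H2].
assert (He : is_derive (fun y => exp (Re (f y))) x (Re l * exp (Re (f x)))).
{ apply (is_derive_comp exp (fun y => Re (f y))); [apply is_derive_exp|exact H1]. }
assert (Hc : is_derive (fun y => cos (Im (f y))) x (Im l * - sin (Im (f x)))).
{ apply (is_derive_comp cos (fun y => Im (f y))); [apply is_derive_cos|exact H2]. }
assert (Hs : is_derive (fun y => sin (Im (f y))) x (Im l * cos (Im (f x)))).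
{ apply (is_derive_comp sin (fun y => Im (f y))); [apply is_derive_sin|exact H2]. }
assert (P : forall u v u' v', is_derive u x u' -> is_derive v x v' ->
  is_derive (fun y => u y * v y) x (u' * v x + u x * v')).
{ intros u v u' v' Hu Hv. apply @is_derive_mult; auto. intros; apply Rmult_comm. }
apply Cder_pair; split; simpl.
- eapply is_derive_eq; [exact (P _ _ _ _ He Hc)|unfold Re, Im; ring].
- eapply is_derive_eq; [exact (P _ _ _ _ He Hs)|unfold Re, Im; ring].
Qed.

Lemma Cder_id (x : R) : Cder (fun y => RtoC y) x (RtoC 1).
Proof. apply (Cder_RtoC (fun y => y)). apply @is_derive_id. Qed.

Lemma Cder_Rcpow (s : C) (x : R) : 0 < x -> Cder (fun y => Rcpow y s) x (s * Rcpow x (s - 1))%C.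
Proof.
intros Hx.
apply Cder_eq with ((s * RtoC (/ x)) * Rcpow x s)%C.
- apply Cder_Cexp. apply Cder_scal. apply Cder_RtoC. apply is_derive_ln, Hx.
- unfold Cminus. rewrite Rcpow_plus, Rcpow_opp, Rcpow_1 by exact Hx.
  rewrite RtoC_inv by lra. ring.
Qed.

Lemma Ccont_Cder (f : R -> C) (x : R) (l : C) : Cder f x l -> Ccont f x.
Proof. intros H. apply @ex_derive_continuous with (V := C_R_NormedModule). exists l. exact H. Qed.

Lemma Ccont_Clim (f : R -> C) (x : R) : Ccont f x <-> Clim (locally x) f (f x).
Proof. symmetry. apply (Clim_filterlim (locally x) f (f x)). Qed.

Lemma Ccont_plus (f g : R -> C) (x : R) : Ccont f x -> Ccont g x -> Ccont (fun y => f y + g y)%C x.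
Proof. intros Hf Hg. exact (@continuous_plus _ _ C_R_NormedModule f g x Hf Hg). Qed.

Lemma Ccont_minus (f g : R -> C) (x : R) : Ccont f x -> Ccont g x -> Ccont (fun y => f y - g y)%C x.
Proof. intros Hf Hg. exact (@continuous_minus _ _ C_R_NormedModule f g x Hf Hg). Qed.

Lemma Ccont_mult (f g : R -> C) (x : R) : Ccont f x -> Ccont g x -> Ccont (fun y => f y * g y)%C x.
Proof.
intros Hf Hg P HP.
apply (@continuous_mult R_UniformSpace C_AbsRing f g x
  (fun P HP => Hf P (proj2 (locally_C _ _) HP)) (fun P HP => Hg P (proj2 (locally_C _ _) HP)) P).
apply locally_C, HP.
Qed.

Lemma Ccont_const (c : C) (x : R) : Ccont (fun _ => c) x.
Proof. apply continuous_const. Qed.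

Lemma Ccont_RtoC (f : R -> R) (x : R) : continuous f x -> Ccont (fun y => RtoC (f y)) x.
Proof.
intros H. apply Ccont_Clim. intros eps Heps.
assert (H0 : locally x (fun y => Rabs (f y - f x) < eps)).
{ apply (H (fun z => Rabs (z - f x) < eps)). exists (mkposreal eps Heps). intros y Hy; exact Hy. }
generalize H0. apply filter_imp. intros y Hy. rewrite <- RtoC_minus, Cmod_R. exact Hy.
Qed.

Lemma Ccont_comp (f : R -> C) (g : R -> R) (x : R) :
  continuous g x -> Ccont f (g x) -> Ccont (fun y => f (g y)) x.
Proof. intros Hg Hf. exact (continuous_comp g f x Hg Hf). Qed.

Lemma Ccont_ext (f g : R -> C) (x : R) : (forall y, f y = g y) -> Ccont f x -> Ccont g x.
Proof. intros E H. exact (continuous_ext f g x E H). Qed.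

(** * Integrals of complex-valued functions of a real variable *)

Definition Ccont_on (f : R -> C) (a b : R) : Prop := forall x, a <= x <= b -> Ccont f x.

Lemma is_CInt_cont (f : R -> C) (a b : R) : a <= b -> Ccont_on f a b -> is_CInt f a b (CInt f a b).
Proof.
intros Hab Hc. apply (@RInt_correct C_R_CompleteNormedModule).
apply (@ex_RInt_continuous C_R_CompleteNormedModule). intros z Hz.
rewrite Rmin_left, Rmax_right in Hz by exact Hab. apply Hc, Hz.
Qed.

Lemma is_CInt_unique (f : R -> C) (a b : R) (l : C) : is_CInt f a b l -> CInt f a b = l.
Proof. intros H. apply (@is_RInt_unique C_R_CompleteNormedModule), H. Qed.

Lemma is_CInt_Cder (F f : R -> C) (a b : R) : a <= b ->
  (forall x, a <= x <= b -> Cder F x (f x)) -> Ccont_on f a b ->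
  is_CInt f a b (F b - F a)%C.
Proof.
intros Hab HF Hf.
apply (@is_RInt_derive C_R_CompleteNormedModule F f); intros x Hx;
  rewrite Rmin_left, Rmax_right in Hx by exact Hab; auto.
Qed.

Lemma CInt_Cder (F f : R -> C) (a b : R) : a <= b ->
  (forall x, a <= x <= b -> Cder F x (f x)) -> Ccont_on f a b ->
  CInt f a b = (F b - F a)%C.
Proof. intros; apply is_CInt_unique, is_CInt_Cder; assumption. Qed.

Lemma is_CInt_plus (f g : R -> C) (a b : R) (l m : C) :
  is_CInt f a b l -> is_CInt g a b m -> is_CInt (fun x => f x + g x)%C a b (l + m)%C.
Proof. intros Hf Hg. exact (is_RInt_plus (V := C_R_NormedModule) f g a b l m Hf Hg). Qed.

Lemma is_CInt_minus (f g : R -> C) (a b : R) (l m : C) :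
  is_CInt f a b l -> is_CInt g a b m -> is_CInt (fun x => f x - g x)%C a b (l - m)%C.
Proof. intros Hf Hg. exact (is_RInt_minus (V := C_R_NormedModule) f g a b l m Hf Hg). Qed.

Lemma is_CInt_pair (f : R -> C) (a b : R) (l : C) :
  is_CInt f a b l <-> is_RInt (fun x => Re (f x)) a b (Re l) /\ is_RInt (fun x => Im (f x)) a b (Im l).
Proof.
split.
- intros H; split.
  + exact (is_RInt_fct_extend_fst (U := R_NormedModule) (V := R_NormedModule) f a b l H).
  + exact (is_RInt_fct_extend_snd (U := R_NormedModule) (V := R_NormedModule) f a b l H).
- intros [H1 H2]. destruct l as [u v].
  exact (is_RInt_fct_extend_pair (U := R_NormedModule) (V := R_NormedModule) f a b u v H1 H2).
Qed.

(** The scalar is complex whereas integration is linear over R, so the product is split into real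
    and imaginary parts. *)
Lemma is_CInt_scal (c : C) (f : R -> C) (a b : R) (l : C) :
  is_CInt f a b l -> is_CInt (fun x => c * f x)%C a b (c * l)%C.
Proof.
intros H. apply is_CInt_pair in H. destruct H as [H1 H2].
apply is_CInt_pair; split.
- rewrite re_mult.
  apply (is_RInt_ext (fun x => minus (scal (Re c) (Re (f x))) (scal (Im c) (Im (f x))))).
  + intros x _. rewrite re_mult. reflexivity.
  + apply @is_RInt_minus; apply @is_RInt_scal; assumption.
- rewrite im_mult, Rplus_comm.
  apply (is_RInt_ext (fun x => plus (scal (Im c) (Re (f x))) (scal (Re c) (Im (f x))))).
  + intros x _. rewrite im_mult. rewrite Rplus_comm. reflexivity.
  + apply @is_RInt_plus; apply @is_RInt_scal; assumption.
Qed.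

Lemma is_CInt_conj (f : R -> C) (a b : R) (l : C) :
  is_CInt f a b l -> is_CInt (fun x => Cconj (f x)) a b (Cconj l).
Proof.
intros H. apply is_CInt_pair in H. destruct H as [H1 H2].
apply is_CInt_pair; split.
- exact H1.
- rewrite im_conj. apply (is_RInt_ext (fun x => opp (Im (f x)))).
  + intros x _. reflexivity.
  + apply @is_RInt_opp, H2.
Qed.

Lemma is_CInt_ext (f g : R -> C) (a b : R) (l : C) : a <= b ->
  (forall x, a < x < b -> f x = g x) -> is_CInt f a b l -> is_CInt g a b l.
Proof.
intros Hab E. apply is_RInt_ext. intros x Hx.
rewrite Rmin_left, Rmax_right in Hx by exact Hab. apply E, Hx.
Qed.

Lemma CInt_ext (f g : R -> C) (a b : R) : a <= b ->
  (forall x, a < x < b -> f x = g x) -> CInt f a b = CInt g a b.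
Proof.
intros Hab E. apply (RInt_ext (V := C_R_CompleteNormedModule)). intros x Hx.
rewrite Rmin_left, Rmax_right in Hx by exact Hab. apply E, Hx.
Qed.

Lemma is_CInt_Chasles (f : R -> C) (a b c : R) (l m : C) :
  is_CInt f a b l -> is_CInt f b c m -> is_CInt f a c (l + m)%C.
Proof. intros H1 H2. exact (is_RInt_Chasles (V := C_R_NormedModule) f a b c l m H1 H2). Qed.

Lemma CInt_Chasles (f : R -> C) (a b c : R) : a <= b -> b <= c -> Ccont_on f a c ->
  CInt f a c = (CInt f a b + CInt f b c)%C.
Proof.
intros H1 H2 Hf. apply is_CInt_unique. apply is_CInt_Chasles with b; apply is_CInt_cont; auto;
  intros x Hx; apply Hf; lra.
Qed.

Lemma CInt_plus (f g : R -> C) (a b : R) : a <= b -> Ccont_on f a b -> Ccont_on g a b ->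
  CInt (fun x => f x + g x)%C a b = (CInt f a b + CInt g a b)%C.
Proof. intros. apply is_CInt_unique, is_CInt_plus; apply is_CInt_cont; assumption. Qed.

Lemma CInt_minus (f g : R -> C) (a b : R) : a <= b -> Ccont_on f a b -> Ccont_on g a b ->
  CInt (fun x => f x - g x)%C a b = (CInt f a b - CInt g a b)%C.
Proof. intros. apply is_CInt_unique, is_CInt_minus; apply is_CInt_cont; assumption. Qed.

Lemma CInt_scal (c : C) (f : R -> C) (a b : R) : a <= b -> Ccont_on f a b ->
  CInt (fun x => c * f x)%C a b = (c * CInt f a b)%C.
Proof. intros. apply is_CInt_unique, is_CInt_scal; apply is_CInt_cont; assumption. Qed.

Lemma CInt_conj (f : R -> C) (a b : R) : a <= b -> Ccont_on f a b ->
  CInt (fun x => Cconj (f x)) a b = Cconj (CInt f a b).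
Proof. intros. apply is_CInt_unique, is_CInt_conj; apply is_CInt_cont; assumption. Qed.

Lemma is_CInt_comp_lin (f : R -> C) (u v a b : R) (l : C) :
  is_CInt f (u * a + v) (u * b + v) l -> is_CInt (fun y => u * f (u * y + v)%R)%C a b l.
Proof.
intros H. apply (is_RInt_ext (fun y => @scal R_AbsRing C_R_NormedModule u (f (u * y + v)))).
- intros x _. apply scal_R_Cmult.
- exact (is_RInt_comp_lin (V := C_R_NormedModule) f u v a b l H).
Qed.

Lemma Cmod_is_CInt_le (f : R -> C) (g : R -> R) (a b : R) (l : C) (m : R) : a <= b ->
  (forall x, a <= x <= b -> Cmod (f x) <= g x) ->
  is_CInt f a b l -> is_RInt g a b m -> Cmod l <= m.
Proof.
intros Hab H Hf Hg. rewrite Cmod_norm.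
apply (norm_RInt_le (V := C_R_NormedModule) f g a b l m Hab); auto.
intros x Hx. rewrite <- Cmod_norm. auto.
Qed.

(** The majorant enters through a primitive G, so that the bound can be combined with boundary
    terms. *)
Lemma Cmod_is_CInt_prim (f : R -> C) (G g : R -> R) (a b : R) (l : C) : a <= b ->
  (forall x, a <= x <= b -> is_derive G x (g x)) ->
  (forall x, a <= x <= b -> continuous g x) ->
  (forall x, a <= x <= b -> Cmod (f x) <= g x) ->
  is_CInt f a b l -> Cmod l <= G b - G a.
Proof.
intros Hab HG Hg H Hf.
apply (Cmod_is_CInt_le f g a b l (G b - G a) Hab H Hf).
apply (is_RInt_derive G g); intros x Hx; rewrite Rmin_left, Rmax_right in Hx by exact Hab; auto.
Qed.

Lemma Cmod_is_CInt_const (f : R -> C) (a b : R) (l : C) (B : R) : a <= b ->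
  (forall x, a <= x <= b -> Cmod (f x) <= B) -> is_CInt f a b l -> Cmod l <= (b - a) * B.
Proof.
intros Hab H Hf. rewrite Cmod_norm.
apply (norm_RInt_le_const (V := C_R_NormedModule) f a b l B Hab); auto.
intros x Hx. rewrite <- Cmod_norm. auto.
Qed.

Lemma Cmod_CInt_const (f : R -> C) (a b B : R) : a <= b -> Ccont_on f a b ->
  (forall x, a <= x <= b -> Cmod (f x) <= B) -> Cmod (CInt f a b) <= (b - a) * B.
Proof. intros Hab Hc H. apply (Cmod_is_CInt_const f); auto. apply is_CInt_cont; auto. Qed.

Lemma Cder_bound (F f : R -> C) (a b B : R) : a <= b ->
  (forall x, a <= x <= b -> Cder F x (f x)) -> Ccont_on f a b ->
  (forall x, a <= x <= b -> Cmod (f x) <= B) -> Cmod (F b - F a)%C <= (b - a) * B.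
Proof. intros Hab HF Hc H. rewrite <- (CInt_Cder F f) by assumption. apply Cmod_CInt_const; auto. Qed.

Lemma CInt_parts (F G f g : R -> C) (a b : R) : a <= b ->
  (forall x, a <= x <= b -> Cder F x (f x)) -> (forall x, a <= x <= b -> Cder G x (g x)) ->
  Ccont_on f a b -> Ccont_on g a b ->
  CInt (fun x => F x * g x)%C a b = (F b * G b - F a * G a - CInt (fun x => f x * G x)%C a b)%C.
Proof.
intros Hab HF HG Hf Hg.
assert (HcF : Ccont_on F a b) by (intros x Hx; eapply Ccont_Cder, HF, Hx).
assert (HcG : Ccont_on G a b) by (intros x Hx; eapply Ccont_Cder, HG, Hx).
assert (H1 : Ccont_on (fun x => f x * G x)%C a b) by (intros x Hx; apply Ccont_mult; auto).
assert (H2 : Ccont_on (fun x => F x * g x)%C a b) by (intros x Hx; apply Ccont_mult; auto).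
rewrite <- (CInt_Cder (fun x => F x * G x)%C (fun x => f x * G x + F x * g x)%C a b Hab).
- rewrite CInt_plus by assumption. ring.
- intros x Hx. apply Cder_mult; auto.
- intros x Hx. apply Ccont_plus; auto.
Qed.

(** * Oscillatory integrals *)

(** For s = sigma + i t the phase is l x - t ln x, with derivative (l x - t) / x and stationary
    point t / l. *)
Definition osc (s : C) (l x : R) : C := (Rcpow x (- s) * Cexp (Ci * (l * x)%R))%C.

Lemma Cmod_osc (s : C) (l x : R) : Cmod (osc s l x) = Rpower x (- Re s).
Proof. unfold osc. rewrite Cmod_mult, Cmod_Rcpow, Cmod_Cexp_Ci, re_opp. ring. Qed.

Lemma Cder_Cexp_Ci (l x : R) : Cder (fun y => Cexp (Ci * (l * y)%R))%C x (Ci * l * Cexp (Ci * (l * x)%R))%C.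
Proof.
apply Cder_Cexp. apply Cder_scal. apply Cder_RtoC.
apply is_derive_eq with (l * 1); [|ring]. apply is_derive_scal. apply @is_derive_id.
Qed.

Lemma Cder_osc (s : C) (l x : R) : 0 < x ->
  Cder (osc s l) x ((Ci * l - s * RtoC (/ x)) * osc s l x)%C.
Proof.
intros Hx. eapply Cder_eq.
- apply Cder_mult. apply Cder_Rcpow, Hx. apply Cder_Cexp_Ci.
- unfold osc, Cminus at 1. rewrite Rcpow_plus, (Rcpow_opp x 1), Rcpow_1 by exact Hx.
  rewrite RtoC_inv by lra. ring.
Qed.

Lemma Ccont_osc (s : C) (l x : R) : 0 < x -> Ccont (osc s l) x.
Proof. intros Hx. eapply Ccont_Cder, Cder_osc, Hx. Qed.

Lemma Ccont_on_osc (s : C) (l a b : R) : 0 < a -> Ccont_on (osc s l) a b.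
Proof. intros Ha x Hx. apply Ccont_osc. lra. Qed.

(** The modulus x^(-sigma) divided by the derivative of the phase: the boundary term of an
    integration by parts. *)
Definition amp (sigma t l x : R) : R := exp ((1 - sigma) * ln x) / (l * x - t).

Definition amp' (sigma t l x : R) : R :=
  exp ((1 - sigma) * ln x) * ((1 - sigma) * (l * x - t) / x - l) / (l * x - t) ^ 2.

Lemma is_derive_amp (sigma t l x : R) : 0 < x -> l * x - t <> 0 ->
  is_derive (amp sigma t l) x (amp' sigma t l x).
Proof.
intros Hx Ht. unfold amp, amp'. auto_derive. repeat split; lra. field. lra.
Qed.

Lemma continuous_amp' (sigma t l x : R) : 0 < x -> l * x - t <> 0 ->
  continuous (amp' sigma t l) x.
Proof.
intros Hx Ht. apply @ex_derive_continuous. unfold amp'. auto_derive.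
repeat split; try lra. intros H. apply Ht. nra.
Qed.

(** Integration by parts: [osc] is the derivative of -i [amp] E, up to a term [amp'] E. As E has
    modulus 1, what is left is the variation of [amp], bounded through the majorant g of
    |[amp']|. *)
Lemma osc_first_derivative (sigma t l a b : R) (G g : R -> R) :
  0 < a <= b -> (forall x, a <= x <= b -> l * x - t <> 0) ->
  (forall x, a <= x <= b -> is_derive G x (g x)) ->
  (forall x, a <= x <= b -> continuous g x) ->
  (forall x, a <= x <= b -> Rabs (amp' sigma t l x) <= g x) ->
  Cmod (CInt (osc (sigma, t) l) a b)
    <= Rabs (amp sigma t l a) + Rabs (amp sigma t l b) + (G b - G a).
Proof.
intros Hab Hl HG Hg Hle.
(* The pure phase x^(-i t) e^(i l x). *)
set (E := osc (0, t) l).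
assert (HE : forall x, Cmod (E x) = 1).
{ intros x. unfold E. rewrite Cmod_osc; simpl. unfold Rpower. rewrite Ropp_0, Rmult_0_l. apply exp_0. }
assert (Hder : forall x, a <= x <= b ->
  Cder (fun y => (- Ci) * (RtoC (amp sigma t l y) * E y))%C x
   ((- Ci) * (RtoC (amp' sigma t l x) * E x) + osc (sigma, t) l x)%C).
{ intros x Hx. eapply Cder_eq.
  - apply Cder_scal, Cder_mult.
    + apply Cder_RtoC, is_derive_amp. lra. apply Hl, Hx.
    + apply Cder_osc. lra.
  - fold E.
    assert (Ho : osc (sigma, t) l x = (RtoC (exp (- sigma * ln x)) * E x)%C).
    { unfold E, osc. replace (- (sigma, t))%C with (RtoC (- sigma) + - (0, t))%C
        by (apply Ceq; simpl; ring).
      rewrite Rcpow_plus, Rcpow_RtoC. unfold Rpower. ring. }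
    rewrite Ho. unfold amp.
    assert (Hlx : l * x - t <> 0) by (apply Hl, Hx).
    replace (exp ((1 - sigma) * ln x)) with (exp (- sigma * ln x) * x).
    2:{ replace ((1 - sigma) * ln x) with (- sigma * ln x + ln x) by ring.
        rewrite exp_plus, exp_ln by lra. reflexivity. }
    set (w := exp (- sigma * ln x)).
    replace (RtoC w) with (- Ci * ((Ci * l - (0, t) * RtoC (/ x)) * (w * x / (l * x - t))%R))%C.
    ring.
    replace ((0, t) * RtoC (/ x))%C with (Ci * (t / x)%R)%C.
    2:{ apply Ceq; simpl; field; lra. }
    apply Ceq; simpl; field; lra. }
assert (Hc1 : Ccont_on (fun x => (- Ci) * (RtoC (amp' sigma t l x) * E x))%C a b).
{ intros x Hx. apply Ccont_mult; [apply Ccont_const|]. apply Ccont_mult.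
  - apply Ccont_RtoC, continuous_amp'. lra. apply Hl, Hx.
  - apply Ccont_osc; lra. }
assert (Hc2 : Ccont_on (osc (sigma, t) l) a b) by (apply Ccont_on_osc; lra).
assert (H0 := CInt_Cder _ _ a b (proj2 Hab) Hder (fun x Hx => Ccont_plus _ _ x (Hc1 x Hx) (Hc2 x Hx))).
rewrite CInt_plus in H0 by (try lra; assumption).
assert (Hm : forall x, Cmod (- Ci * (RtoC (amp sigma t l x) * E x))%C = Rabs (amp sigma t l x)).
{ intros x. rewrite !Cmod_mult, Cmod_opp, Cmod_Ci, Cmod_R, HE. ring. }
set (K := CInt (fun x => (- Ci) * (RtoC (amp' sigma t l x) * E x))%C a b) in *.
assert (HK : Cmod K <= G b - G a).
{ apply (Cmod_is_CInt_prim (fun x => (- Ci) * (RtoC (amp' sigma t l x) * E x))%C G g); auto.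
  - lra.
  - intros x Hx. rewrite !Cmod_mult, Cmod_opp, Cmod_Ci, Cmod_R, HE. rewrite Rmult_1_l, Rmult_1_r. auto.
  - apply is_CInt_cont; [lra|exact Hc1]. }
replace (CInt (osc (sigma, t) l) a b) with
  (- Ci * (amp sigma t l b * E b) - - Ci * (amp sigma t l a * E a) - K)%C by (rewrite <- H0; ring).
generalize (Cmod_minus_le (- Ci * (amp sigma t l b * E b) - - Ci * (amp sigma t l a * E a)) K).
generalize (Cmod_minus_le (- Ci * (amp sigma t l b * E b)) (- Ci * (amp sigma t l a * E a))).
rewrite !Hm. lra.
Qed.

Lemma amp_pow (sigma t l x : R) : amp sigma t l x = Rpower x (1 - sigma) / (l * x - t).
Proof. reflexivity. Qed.

(** To the left of t / l the amplitude is negative and decreasing. Its variation telescopes with the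
    end values, and only the end b, nearest to the stationary point, remains. *)
Lemma osc_below (sigma t l a b : R) : 0 < sigma < 1 -> 0 <= l -> 0 < a <= b -> l * b < t ->
  Cmod (CInt (osc (sigma, t) l) a b) <= 2 * Rpower b (1 - sigma) / (t - l * b).
Proof.
intros Hs Hl Hab Hb.
assert (Hx : forall x, a <= x <= b -> l * x - t < 0) by (intros x Hx; nra).
eapply Rle_trans.
- apply (osc_first_derivative sigma t l a b (fun x => - amp sigma t l x) (fun x => - amp' sigma t l x)); auto.
  + intros x H. generalize (Hx x H). lra.
  + intros x H. apply (is_derive_opp (amp sigma t l)). apply is_derive_amp. lra. generalize (Hx x H); lra.
  + intros x H. apply (continuous_opp (amp' sigma t l)). apply continuous_amp'. lra. generalize (Hx x H); lra.
  + intros x H. rewrite Rabs_left1. lra. unfold amp'.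
    generalize (Hx x H); intros H1.
    assert (0 < exp ((1 - sigma) * ln x)) by apply exp_pos.
    assert (0 < (l * x - t) ^ 2) by nra.
    assert (H3 : (1 - sigma) * (l * x - t) / x <= 0).
    { apply Rmult_le_0_r. nra. left; apply Rinv_0_lt_compat; lra. }
    apply Rmult_le_0_r; [|left; apply Rinv_0_lt_compat; lra].
    nra.
- assert (Ha : amp sigma t l a <= 0).
  { apply Rmult_le_0_l. left; apply exp_pos. left. apply Rinv_lt_0_compat. apply Hx; lra. }
  assert (Hb' : amp sigma t l b <= 0).
  { apply Rmult_le_0_l. left; apply exp_pos. left. apply Rinv_lt_0_compat. apply Hx; lra. }
  rewrite !Rabs_left1 by assumption.
  replace (2 * Rpower b (1 - sigma) / (t - l * b)) with (- (2 * amp sigma t l b)).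
  lra. rewrite amp_pow. field. split; lra.
Qed.

Lemma osc_above (sigma t l a b : R) : 0 < sigma -> 0 < t -> 0 < a <= b -> t < l * a ->
  Cmod (CInt (osc (sigma, t) l) a b) <= 2 * Rpower a (1 - sigma) / (l * a - t).
Proof.
intros Hs Ht Hab Ha.
assert (Hl : 0 < l) by nra.
assert (Hx : forall x, a <= x <= b -> 0 < l * x - t) by (intros x Hx; nra).
eapply Rle_trans.
- apply (osc_first_derivative sigma t l a b (fun x => - amp sigma t l x) (fun x => - amp' sigma t l x)); auto.
  + intros x H. generalize (Hx x H). lra.
  + intros x H. apply (is_derive_opp (amp sigma t l)). apply is_derive_amp. lra. generalize (Hx x H); lra.
  + intros x H. apply (continuous_opp (amp' sigma t l)). apply continuous_amp'. lra. generalize (Hx x H); lra.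
  + intros x H. rewrite Rabs_left1. lra. unfold amp'.
    generalize (Hx x H); intros H1.
    assert (0 < exp ((1 - sigma) * ln x)) by apply exp_pos.
    assert (0 < (l * x - t) ^ 2) by nra.
    assert (H3 : (1 - sigma) * (l * x - t) / x - l <= 0).
    { replace ((1 - sigma) * (l * x - t) / x - l) with ((- sigma * (l * x - t) - t) * / x) by (field; lra).
      apply Rmult_le_0_r. nra. left; apply Rinv_0_lt_compat; lra. }
    apply Rmult_le_0_r; [|left; apply Rinv_0_lt_compat; lra].
    nra.
- assert (Ha' : 0 <= amp sigma t l a).
  { apply Rmult_le_pos. left; apply exp_pos. left. apply Rinv_0_lt_compat. apply Hx; lra. }
  assert (Hb' : 0 <= amp sigma t l b).
  { apply Rmult_le_pos. left; apply exp_pos. left. apply Rinv_0_lt_compat. apply Hx; lra. }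
  rewrite !Rabs_pos_eq by assumption.
  replace (2 * Rpower a (1 - sigma) / (l * a - t)) with (2 * amp sigma t l a).
  lra. rewrite amp_pow. field. lra.
Qed.

(** For a negative frequency |- l x - t| is at least l x, whence a bound uniform in t. The range of
    sigma extends to 2 to cover sigma + 1. *)
Lemma osc_negative (sigma t l a b : R) : 0 < sigma <= 2 -> 0 < t -> 0 < a <= b -> 0 < l ->
  Cmod (CInt (osc (sigma, t) (- l)) a b) <= (2 + 3 / sigma) * Rpower a (- sigma) / l.
Proof.
intros Hs Ht Hab Hl.
assert (Hx : forall x, a <= x <= b -> 0 < l * x) by (intros x Hx; nra).
assert (Hamp : forall x, a <= x <= b -> Rabs (amp sigma t (- l) x) <= Rpower a (- sigma) / l).
{ intros x H. rewrite amp_pow. unfold Rdiv. rewrite Rabs_mult, Rabs_inv.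
  rewrite (Rabs_left (- l * x - t)) by (generalize (Hx x H); lra).
  rewrite Rabs_pos_eq by (left; apply exp_pos).
  apply Rle_trans with (Rpower x (1 - sigma) * / (l * x)).
  - apply Rmult_le_compat_l. left; apply exp_pos. apply Rinv_le_contravar. apply Hx, H. lra.
  - replace (1 - sigma) with (1 + - sigma) by ring. rewrite Rpower_plus, Rpower_1 by lra.
    replace (x * Rpower x (- sigma) * / (l * x)) with (Rpower x (- sigma) * / l) by (field; lra).
    apply Rmult_le_compat_r. left; apply Rinv_0_lt_compat; lra.
    apply Rpower_opp_le; lra. }
eapply Rle_trans.
- apply (osc_first_derivative sigma t (- l) a b (fun x => - (3 / (sigma * l)) * exp (- sigma * ln x))
    (fun x => 3 / l * exp (- sigma * ln x) / x)); auto.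
  + intros x H. generalize (Hx x H). lra.
  + intros x H. auto_derive. lra. field. lra.
  + intros x H. apply @ex_derive_continuous. auto_derive. split; lra.
  + intros x H. unfold amp'.
    generalize (Hx x H); intros H1.
    replace (exp ((1 - sigma) * ln x)) with (exp (- sigma * ln x) * x).
    2:{ replace ((1 - sigma) * ln x) with (- sigma * ln x + ln x) by ring.
        rewrite exp_plus, exp_ln by lra. reflexivity. }
    assert (Hw : 0 < exp (- sigma * ln x)) by apply exp_pos.
    set (w := exp (- sigma * ln x)) in *.
    replace (w * x * ((1 - sigma) * (- l * x - t) / x - - l) / (- l * x - t) ^ 2)
      with (w * (((1 - sigma) * (- l * x - t) + l * x) / (l * x + t) ^ 2)) by (field; lra).
    replace (3 / l * w / x) with (w * (3 / (l * x))) by (field; lra).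
    rewrite Rabs_mult, (Rabs_pos_eq w) by lra.
    apply Rmult_le_compat_l. lra.
    unfold Rdiv. rewrite Rabs_mult, Rabs_inv. rewrite (Rabs_pos_eq ((l * x + t) ^ 2)) by nra.
    apply Rle_trans with (3 * (l * x + t) * / (l * x + t) ^ 2).
    * apply Rmult_le_compat_r. left; apply Rinv_0_lt_compat; nra.
      apply Rabs_le. split; nra.
    * replace (3 * (l * x + t) * / (l * x + t) ^ 2) with (3 * / (l * x + t)) by (field; lra).
      apply Rmult_le_compat_l. lra. apply Rinv_le_contravar; lra.
- assert (Hp : exp (- sigma * ln a) = Rpower a (- sigma)) by reflexivity.
  cbv beta. rewrite Hp.
  assert (Hb : 0 < exp (- sigma * ln b)) by apply exp_pos.
  assert (Hk : 0 < 3 / (sigma * l)) by (apply Rdiv_lt_0_compat; nra).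
  generalize (Hamp a ltac:(lra)) (Hamp b ltac:(lra)). intros H1 H2.
  replace ((2 + 3 / sigma) * Rpower a (- sigma) / l) with
    (Rpower a (- sigma) / l + Rpower a (- sigma) / l + 3 / (sigma * l) * Rpower a (- sigma)) by (field; lra).
  nra.
Qed.

(** * Elementary bounds for the exponential and the sine *)

Lemma Cmod_Cexp_sub_1 (w : C) : Cmod (Cexp w - 1)%C <= Cmod w * exp (Cmod w).
Proof.
assert (Hd : forall x, Cder (fun y => Cexp (w * y))%C x (w * Cexp (w * x))%C).
{ intros x. apply Cder_eq with (w * 1 * Cexp (w * x))%C; [|ring]. apply Cder_Cexp, Cder_scal, Cder_id. }
assert (H := Cder_bound (fun y => Cexp (w * y))%C (fun x => w * Cexp (w * x))%C 0 1
  (Cmod w * exp (Cmod w)) ltac:(lra)).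
cbv beta in H. rewrite Cmult_1_r, Cmult_0_r, Cexp_0 in H.
eapply Rle_trans. apply H.
- intros x _. apply Hd.
- intros x _. apply Ccont_mult. apply Ccont_const. eapply Ccont_Cder, Hd.
- intros x Hx. rewrite !Cmod_mult, Cmod_Cexp.
  apply Rmult_le_compat_l. apply Cmod_ge_0. apply exp_le_compat.
  rewrite re_scal_r. generalize (re_le_Cmod w) (Rle_abs (Re w)) (Cmod_ge_0 w). nra.
- lra.
Qed.

Lemma Cmod_Cexp_sub_1_sub (w : C) : Cmod (Cexp w - 1 - w)%C <= Cmod w ^ 2 * exp (Cmod w).
Proof.
assert (Hd : forall x, Cder (fun y => Cexp (w * y) - w * y)%C x (w * Cexp (w * x) - w)%C).
{ intros x. apply Cder_eq with (w * 1 * Cexp (w * x) - w * 1)%C; [|ring]. apply Cder_minus. apply Cder_Cexp, Cder_scal, Cder_id. apply Cder_scal, Cder_id. }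
assert (H := Cder_bound (fun y => Cexp (w * y) - w * y)%C (fun x => w * Cexp (w * x) - w)%C 0 1
  (Cmod w ^ 2 * exp (Cmod w)) ltac:(lra)).
cbv beta in H. rewrite Cmult_1_r, Cmult_0_r, Cexp_0 in H.
replace (Cexp w - 1 - w)%C with (Cexp w - w - (1 - 0))%C by ring.
eapply Rle_trans. apply H.
- intros x _. apply Hd.
- intros x _. apply Ccont_minus; [|apply Ccont_const]. apply Ccont_mult. apply Ccont_const.
  eapply Ccont_Cder. apply Cder_Cexp, Cder_scal, Cder_id.
- intros x Hx. replace (w * Cexp (w * x) - w)%C with (w * (Cexp (w * x) - 1))%C by ring.
  rewrite Cmod_mult.
  assert (Hw := Cmod_ge_0 w).
  apply Rle_trans with (Cmod w * (Cmod w * exp (Cmod w))); [|right; ring].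
  apply Rmult_le_compat_l. exact Hw.
  eapply Rle_trans. apply Cmod_Cexp_sub_1.
  assert (Cmod (w * x)%C <= Cmod w).
  { rewrite Cmod_mult, Cmod_R, Rabs_pos_eq by lra. nra. }
  apply Rmult_le_compat; auto. apply Cmod_ge_0. left; apply exp_pos. apply exp_le_compat; auto.
- lra.
Qed.

(** A weak form of Jordan's inequality, from sin x >= x - x^3 / 6 and x <= 2. *)
Lemma sin_ge_third (x : R) : 0 <= x <= PI / 2 -> x / 3 <= sin x.
Proof.
intros Hx. assert (HP := PI_4).
destruct (Req_dec x 0) as [->|Hx0]. rewrite sin_0; lra.
assert (H := sin_bound x 0 ltac:(lra) ltac:(lra)).
destruct H as [H _]. unfold sin_approx, sin_term in H. simpl in H.
assert (x <= 2) by lra.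
assert (x * x * x <= 4 * x) by nra. lra.
Qed.

Lemma Rabs_le_sin (x : R) : - (PI / 2) <= x <= PI / 2 -> Rabs x <= 3 * Rabs (sin x).
Proof.
intros Hx. destruct (Rle_dec 0 x) as [H|H].
- assert (H1 := sin_ge_third x ltac:(lra)). rewrite !Rabs_pos_eq; lra.
- assert (H1 := sin_ge_third (- x) ltac:(lra)). rewrite sin_neg in H1. rewrite !Rabs_left1; lra.
Qed.

(** * The product formula for the sine *)

Definition wallis (n : nat) : R := RInt (fun x => cos x ^ (2 * n)) (- (PI / 2)) (PI / 2).

(** The Fourier transform of cos^(2n) on its central arch. At n = 0 it is sin(pi s) / s, which is
    how the sine enters. *)
Definition wallisC (s : C) (n : nat) : C :=
  CInt (fun x => Cexp (2 * Ci * s * x) * RtoC (cos x ^ (2 * n)))%C (- (PI / 2)) (PI / 2).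

Lemma continuous_cos_pow (n : nat) (x : R) : continuous (fun y => cos y ^ n) x.
Proof. apply @ex_derive_continuous. auto_derive. exact I. Qed.

Lemma is_wallis (n : nat) : is_RInt (fun x => cos x ^ (2 * n)) (- (PI / 2)) (PI / 2) (wallis n).
Proof.
apply @RInt_correct, @ex_RInt_continuous. intros x _. apply continuous_cos_pow.
Qed.

Lemma wallis_0 : wallis 0 = PI.
Proof.
unfold wallis. simpl. rewrite RInt_const. unfold scal; simpl; unfold mult; simpl. field.
Qed.

Lemma cos_pow_even_nonneg (n : nat) (x : R) : 0 <= cos x ^ (2 * n).
Proof. rewrite pow_mult. apply pow_le. nra. Qed.

Lemma is_derive_cos_pow (m : nat) (x : R) :
  is_derive (fun y => cos y ^ S m) x (- ((INR m + 1) * (cos x ^ m * sin x))).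
Proof.
eapply is_derive_eq.
- apply is_derive_pow. apply is_derive_cos.
- rewrite S_INR. simpl pred. ring.
Qed.

Lemma is_derive_cos_pow_sin (m : nat) (x : R) :
  is_derive (fun y => cos y ^ S m * sin y) x ((INR m + 2) * cos x ^ S (S m) - (INR m + 1) * cos x ^ m).
Proof.
eapply is_derive_eq.
- apply (is_derive_mult (fun y => cos y ^ S m) sin). apply is_derive_cos_pow. apply is_derive_sin.
  intros; apply Rmult_comm.
- unfold plus, mult; simpl.
  transitivity ((INR m + 1) * - (sin x * sin x) * cos x ^ m + cos x * cos x ^ m * cos x). ring.
  replace (sin x * sin x) with (1 - cos x * cos x) by (generalize (sin2_cos2 x); unfold Rsqr; lra).
  ring.
Qed.

Lemma wallis_rec (n : nat) : (2 * INR n + 2) * wallis (S n) = (2 * INR n + 1) * wallis n.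
Proof.
assert (HP := PI_RGT_0).
assert (E2 : INR (2 * n) = 2 * INR n) by (rewrite mult_INR; reflexivity).
set (m := (2 * n)%nat) in *.
assert (H : is_RInt (fun x => (INR m + 2) * cos x ^ S (S m) - (INR m + 1) * cos x ^ m)
  (- (PI / 2)) (PI / 2) (cos (PI / 2) ^ S m * sin (PI / 2)
     - cos (- (PI / 2)) ^ S m * sin (- (PI / 2)))).
{ apply (is_RInt_derive (fun x => cos x ^ S m * sin x)).
  - intros x _. apply is_derive_cos_pow_sin.
  - intros x _. apply @ex_derive_continuous. auto_derive. repeat split; auto. }
rewrite cos_neg, cos_PI2 in H.
assert (H2 : is_RInt (fun x => (INR m + 2) * cos x ^ S (S m) - (INR m + 1) * cos x ^ m)
  (- (PI / 2)) (PI / 2) ((INR m + 2) * wallis (S n) - (INR m + 1) * wallis n)).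
{ replace (S (S m)) with (2 * S n)%nat by (unfold m; lia).
  apply @is_RInt_minus; apply (@is_RInt_scal R_NormedModule); apply is_wallis. }
assert (H3 := is_RInt_unique _ _ _ _ H). rewrite (is_RInt_unique _ _ _ _ H2) in H3.
simpl in H3. rewrite <- E2. lra.
Qed.

Lemma wallis_pos (n : nat) : 0 < wallis n.
Proof.
induction n as [|n IH]. rewrite wallis_0; apply PI_RGT_0.
assert (H := wallis_rec n). assert (Hn := pos_INR n). nra.
Qed.

Lemma wallisC_cont (s : C) (n : nat) (x : R) : Ccont (fun x => Cexp (2 * Ci * s * x) * RtoC (cos x ^ n))%C x.
Proof.
apply Ccont_mult.
- eapply Ccont_Cder, Cder_Cexp, Cder_scal, Cder_id.
- apply Ccont_RtoC, continuous_cos_pow.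
Qed.

Lemma is_wallisC (s : C) (n : nat) :
  is_CInt (fun x => Cexp (2 * Ci * s * x) * RtoC (cos x ^ (2 * n)))%C (- (PI / 2)) (PI / 2) (wallisC s n).
Proof.
assert (HP := PI_RGT_0).
apply is_CInt_cont. lra. intros x _. apply wallisC_cont.
Qed.

Lemma Ci2 : (Ci * Ci = - (1))%C.
Proof. apply Ceq; simpl; ring. Qed.

(** Two integrations by parts, packed into the single primitive U, which vanishes at both ends
    together with the cosine. *)
Lemma wallisC_rec (s : C) (n : nat) :
  ((INR (S n) * INR (S n) - s * s) * wallisC s (S n)
    = (INR n + 1) * (2 * INR n + 1) / 2 * wallisC s n)%C.
Proof.
assert (HP := PI_RGT_0).
assert (E2 : INR (2 * n) = 2 * INR n) by (rewrite mult_INR; reflexivity).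
set (m := (2 * n)%nat) in *.
set (e := fun x : R => Cexp (2 * Ci * s * x)).
set (f := fun x => (((INR m + 2) * (INR m + 2) - 4 * (s * s)) * (e x * RtoC (cos x ^ S (S m)))
     - (INR m + 2) * (INR m + 1) * (e x * RtoC (cos x ^ m)))%C).
assert (H : is_CInt f (- (PI / 2)) (PI / 2) (RtoC 0)).
{ set (U := fun x : R => (e x * (2 * Ci * s * RtoC (cos x ^ S (S m))
     + (INR m + 2) * RtoC (cos x ^ S m * sin x)))%C).
  replace (RtoC 0) with (U (PI / 2)%R - U (- (PI / 2))%R)%C.
  2:{ unfold U. rewrite cos_neg, cos_PI2. simpl pow. rewrite !Rmult_0_l. ring. }
  apply is_CInt_Cder. lra.
  - intros x _. eapply Cder_eq.
    + apply Cder_mult.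
      * apply Cder_Cexp, Cder_scal, Cder_id.
      * apply Cder_plus; apply Cder_scal, Cder_RtoC.
        apply is_derive_cos_pow. apply is_derive_cos_pow_sin.
    + unfold f. fold (e x). rewrite S_INR.
      rewrite !RtoC_opp, !RtoC_minus, !RtoC_mult, !RtoC_plus.
      transitivity (e x * (2 * s * (Ci * Ci * 2 * s * RtoC (cos x ^ S (S m))) +
        (INR m + 2) * ((INR m + 2) * RtoC (cos x ^ S (S m)) - (INR m + 1) * RtoC (cos x ^ m))))%C.
      ring. rewrite Ci2. ring.
  - intros x _. apply Ccont_minus; apply Ccont_mult; try apply Ccont_const; apply wallisC_cont. }
assert (H2 : is_CInt f (- (PI / 2)) (PI / 2)
  (((INR m + 2) * (INR m + 2) - 4 * (s * s)) * wallisC s (S n)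
     - (INR m + 2) * (INR m + 1) * wallisC s n)%C).
{ unfold f. replace (S (S m)) with (2 * S n)%nat by (unfold m; lia).
  apply is_CInt_minus; apply is_CInt_scal; apply is_wallisC. }
apply is_CInt_unique in H. rewrite (is_CInt_unique _ _ _ _ H2) in H.
rewrite E2, RtoC_mult in H. rewrite S_INR, RtoC_plus.
assert (H4 : (4 * ((INR n + 1) * (INR n + 1) - s * s) * wallisC s (S n)
  = 2 * (INR n + 1) * (2 * INR n + 1) * wallisC s n)%C).
{ apply Ceq_minus. rewrite <- H. ring. }
replace (((INR n + 1) * (INR n + 1) - s * s) * wallisC s (S n))%C with
  (/ 4 * (4 * ((INR n + 1) * (INR n + 1) - s * s) * wallisC s (S n)))%C.
rewrite H4. field. field.
Qed.

Fixpoint sqprod (s : C) (n : nat) : C :=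
  match n with
  | O => RtoC 1
  | S k => (sqprod s k * (INR (S k) * INR (S k) - s * s))%C
  end.

(** The two recurrences iterated. Since [wallisC s n / wallis n] will tend to 1, division by n!^2
    turns this into Euler's product: the factors 1 - s^2 / k^2 multiply up to sin(pi s) / (pi s). *)
Lemma sqprod_wallisC (s : C) (n : nat) :
  (sqprod s n * wallisC s n * PI = INR (fact n) * INR (fact n) * wallis n * wallisC s 0)%C.
Proof.
induction n as [|n IH].
- simpl. rewrite wallis_0. ring.
- change (sqprod s (S n)) with (sqprod s n * (INR (S n) * INR (S n) - s * s))%C.
  replace (sqprod s n * (INR (S n) * INR (S n) - s * s) * wallisC s (S n) * PI)%C with
    (sqprod s n * PI * ((INR (S n) * INR (S n) - s * s) * wallisC s (S n)))%C by ring.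
  rewrite wallisC_rec.
  replace (sqprod s n * PI * ((INR n + 1) * (2 * INR n + 1) / 2 * wallisC s n))%C with
    ((INR n + 1) * (2 * INR n + 1) / 2 * (sqprod s n * wallisC s n * PI))%C by (field).
  rewrite IH.
  assert (Hn := pos_INR n).
  assert (E : wallis (S n) = (2 * INR n + 1) / (2 * (INR n + 1)) * wallis n).
  { generalize (wallis_rec n). intros H. apply Rmult_eq_reg_l with (2 * INR n + 2); [|lra].
    rewrite H. field. lra. }
  rewrite E. replace (INR (fact (S n))) with ((INR n + 1) * INR (fact n)).
  2:{ rewrite fact_simpl, mult_INR, S_INR. reflexivity. }
  assert (HC : (INR n + 1)%C <> 0).
  { rewrite <- RtoC_plus. intros H. apply RtoC_inj in H. lra. }
  rewrite RtoC_mult, (RtoC_mult (_ / _)), RtoC_div by lra.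
  rewrite !RtoC_mult, !RtoC_plus, !RtoC_mult. field. exact HC.
Qed.

(** |e^(2 i s x) - 1| is at most a constant times |sin x|, and 2 |sin x| <= d + sin^2 x / d reduces
    the integral to a second moment. That moment is [wallis n - wallis (S n)], because sin^2 x
    cos^(2n) x = cos^(2n) x - cos^(2n+2) x, and equals [wallis n] / (2n + 2). *)
Lemma wallisC_le (s : C) (n : nat) (d : R) : 0 < d ->
  Cmod (wallisC s n - wallis n)%C
   <= 6 * Cmod s * exp (4 * Cmod s) / 2 * ((d + / (d * (2 * INR n + 2))) * wallis n).
Proof.
intros Hd. assert (HP := PI_RGT_0). assert (HP4 := PI_4).
assert (Hs := Cmod_ge_0 s). assert (Hn := pos_INR n).
assert (HC : 0 <= 6 * Cmod s * exp (4 * Cmod s) / 2) by (generalize (exp_pos (4 * Cmod s)); nra).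
set (K := 6 * Cmod s * exp (4 * Cmod s) / 2) in *.
assert (H1 : is_CInt (fun x => Cexp (2 * Ci * s * x) * RtoC (cos x ^ (2 * n)) - RtoC (cos x ^ (2 * n)))%C
  (- (PI / 2)) (PI / 2) (wallisC s n - wallis n)%C).
{ apply is_CInt_minus. apply is_wallisC. apply is_CInt_pair; split; simpl.
  apply is_wallis.
  assert (H0 := is_RInt_const (V := R_NormedModule) (- (PI / 2)) (PI / 2) 0).
  assert (E0 := Rmult_0_r (PI / 2 - - (PI / 2))).
  exact (eq_ind _ (fun z => is_RInt (fun _ : R => 0) (- (PI / 2)) (PI / 2) z) H0 _ E0). }
assert (H2 : is_RInt (fun x => K * (d * cos x ^ (2 * n) + / d * (cos x ^ (2 * n) - cos x ^ (2 * S n))))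
   (- (PI / 2)) (PI / 2) (K * (d * wallis n + / d * (wallis n - wallis (S n))))).
{ apply (@is_RInt_scal R_NormedModule). apply (@is_RInt_plus R_NormedModule).
  apply (@is_RInt_scal R_NormedModule), is_wallis.
  apply (@is_RInt_scal R_NormedModule). apply (@is_RInt_minus R_NormedModule); apply is_wallis. }
replace ((d + / (d * (2 * INR n + 2))) * wallis n) with (d * wallis n + / d * (wallis n - wallis (S n))).
2:{ generalize (wallis_rec n). intros H. replace (wallis (S n)) with ((2 * INR n + 1) / (2 * INR n + 2) * wallis n).
    field. lra. apply Rmult_eq_reg_l with (2 * INR n + 2); [|lra]. rewrite H. field. lra. }
refine (Cmod_is_CInt_le _ _ _ _ _ _ _ _ H1 H2). lra.
intros x Hx.
replace (Cexp (2 * Ci * s * x) * RtoC (cos x ^ (2 * n)) - RtoC (cos x ^ (2 * n)))%C with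
  ((Cexp (2 * Ci * s * x) - 1) * RtoC (cos x ^ (2 * n)))%C by ring.
rewrite Cmod_mult, Cmod_R, (Rabs_pos_eq (_ ^ _)) by apply cos_pow_even_nonneg.
replace (cos x ^ (2 * S n)) with (cos x ^ (2 * n) * (1 - sin x * sin x)).
2:{ replace (2 * S n)%nat with (2 * n + 2)%nat by lia. rewrite pow_add.
    generalize (sin2_cos2 x); unfold Rsqr; intros E.
    replace (1 - sin x * sin x) with (cos x * cos x) by lra. simpl; ring. }
replace (K * (d * cos x ^ (2 * n) + / d * (cos x ^ (2 * n) - cos x ^ (2 * n) * (1 - sin x * sin x)))) with
  (K * (d + / d * (sin x * sin x)) * cos x ^ (2 * n)) by ring.
apply Rmult_le_compat_r. apply cos_pow_even_nonneg.
eapply Rle_trans. apply Cmod_Cexp_sub_1.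
rewrite !Cmod_mult, Cmod_Ci, !Cmod_R, (Rabs_pos_eq 2) by lra.
assert (Hax : Rabs x <= 2) by (apply Rabs_le; lra).
assert (Hax0 := Rabs_pos x).
assert (Hse := Rabs_le_sin x Hx).
apply Rle_trans with (2 * Cmod s * (3 * Rabs (sin x)) * exp (4 * Cmod s)).
- apply Rmult_le_compat; try nra. left; apply exp_pos.
  apply exp_le_compat. nra.
- unfold K.
  assert (Hag : 2 * Rabs (sin x) <= d + / d * (sin x * sin x)).
  { replace (sin x * sin x) with (Rabs (sin x) * Rabs (sin x)) by (rewrite <- Rabs_mult; apply Rabs_pos_eq; nra).
    set (y := Rabs (sin x)). apply Rmult_le_reg_l with d. lra.
    replace (d * (d + / d * (y * y))) with (d * d + y * y) by (field; lra).
    generalize (Rle_0_sqr (d - y)). unfold Rsqr. lra. }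
  generalize (exp_pos (4 * Cmod s)); intros He.
  replace (2 * Cmod s * (3 * Rabs (sin x)) * exp (4 * Cmod s)) with
   (6 * Cmod s * exp (4 * Cmod s) / 2 * (2 * Rabs (sin x))) by field.
  apply Rmult_le_compat_l; assumption.
Qed.

(* The measures [cos^(2n)] concentrate at the origin. *)
Lemma wallisC_lim (s : C) : Clim eventually (fun n => wallisC s n / wallis n)%C 1.
Proof.
set (K := 6 * Cmod s * exp (4 * Cmod s) / 2).
assert (HK : 0 <= K) by (unfold K; generalize (exp_pos (4 * Cmod s)) (Cmod_ge_0 s); intros; nra).
intros eps Heps.
(* As soon as 2n + 2 > 1 / d^2, both summands of the concentration bound are at most d, and 2 d K <
   eps. *)
set (d := eps / (2 * (K + 1))).
assert (Hd : 0 < d) by (apply Rdiv_lt_0_compat; lra).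
destruct (nfloor_ex (/ (d * d)) ltac:(left; apply Rinv_0_lt_compat; nra)) as [n0 [_ Hn0]].
exists n0. intros n Hn.
assert (HnR : / (d * d) < 2 * INR n + 2).
{ apply le_INR in Hn. generalize (pos_INR n). lra. }
assert (Hw := wallis_pos n).
assert (Hw' : RtoC (wallis n) <> 0) by (intros H; apply RtoC_inj in H; lra).
replace (wallisC s n / wallis n - 1)%C with ((wallisC s n - wallis n) * RtoC (/ wallis n))%C.
2:{ rewrite RtoC_inv by lra. field. exact Hw'. }
rewrite Cmod_mult, Cmod_R, Rabs_pos_eq by (left; apply Rinv_0_lt_compat; lra).
apply Rmult_lt_reg_r with (wallis n). lra.
rewrite Rmult_assoc, Rinv_l, Rmult_1_r by lra.
eapply Rle_lt_trans. apply (wallisC_le s n d Hd). fold K.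
rewrite <- Rmult_assoc. apply Rmult_lt_compat_r. lra.
assert (Hi : / (d * (2 * INR n + 2)) <= d).
{ apply Rmult_le_reg_l with (2 * INR n + 2). generalize (pos_INR n); lra.
  replace ((2 * INR n + 2) * / (d * (2 * INR n + 2))) with (/ (d * d) * d).
  apply Rmult_le_compat_r; lra. generalize (pos_INR n); intros. field. split; lra. }
assert (Hi0 : 0 < / (d * (2 * INR n + 2))).
{ apply Rinv_0_lt_compat. generalize (pos_INR n); intros; nra. }
apply Rle_lt_trans with (K * (2 * d)). nra.
replace (2 * d) with (eps / (K + 1)) by (unfold d; field; lra). apply Rmult_div_succ_lt; assumption.
Qed.

(** * Products of limits, the Cauchy criterion, comparison of integrals *)

Lemma Clim_mult {T : Type} (F : (T -> Prop) -> Prop) {FF : Filter F}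
  (f g : T -> C) (l m : C) :
  Clim F f l -> Clim F g m -> Clim F (fun x => f x * g x)%C (l * m)%C.
Proof.
intros Hf Hg.
assert (H1 : Clim F (fun x => (f x - l) * (g x - m))%C 0).
{ intros eps Heps.
  assert (He : 0 < Rmin eps 1) by (apply Rmin_glb_lt; lra).
  generalize (filter_and _ _ (Hf _ He) (Hg _ He)). apply filter_imp. intros x [H1 H2].
  replace ((f x - l) * (g x - m) - 0)%C with ((f x - l) * (g x - m))%C by ring.
  rewrite Cmod_mult.
  generalize (Rmin_l eps 1) (Rmin_r eps 1) (Cmod_ge_0 (f x - l)%C) (Cmod_ge_0 (g x - m)%C). intros. nra. }
replace (l * m)%C with (0 + (l * m + m * l - l * m))%C by ring.
apply (Clim_ext F (fun x => (f x - l) * (g x - m) + (l * g x + m * f x - l * m))%C).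
- apply filter_forall. intros x. ring.
- apply (Clim_plus F). exact H1. apply (Clim_minus F). apply (Clim_plus F); apply (Clim_scal F); assumption.
  apply (Clim_const F).
Qed.

(** The majorant is complex-valued with only its real part used, so that both sides can be limits of
    [pint]. *)
Lemma Clim_Cmod_le_Re {T : Type} (F : (T -> Prop) -> Prop) {FF : ProperFilter F}
  (f g : T -> C) (l m : C) :
  Clim F f l -> Clim F g m -> F (fun x => Cmod (f x) <= Re (g x)) -> Cmod l <= Re m.
Proof.
intros Hf Hg H. apply le_epsilon. intros eps Heps.
assert (He : 0 < eps / 2) by lra.
destruct (filter_ex _ (filter_and _ _ H (filter_and _ _ (Hf _ He) (Hg _ He)))) as [x [H1 [H2 H3]]].
generalize (Cmod_le_sub l (f x)). rewrite (Cmod_sym l (f x)).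
generalize (re_le_Cmod (g x - m)%C) (Rle_abs (Re (g x - m)%C)).
assert (E : Re (g x - m)%C = Re (g x) - Re m) by reflexivity. lra.
Qed.

Lemma Clim_cauchy {T : Type} (F : (T -> Prop) -> Prop) {FF : ProperFilter F} (f : T -> C) :
  (forall eps : R, 0 < eps -> exists c : C, F (fun x => Cmod (f x - c)%C < eps)) ->
  exists l, Clim F f l.
Proof.
intros H.
destruct (proj1 (filterlim_locally_cauchy (U := C_R_CompleteNormedModule) (F := F) f)) as [l Hl].
- intros eps. assert (He : 0 < eps / 2) by (generalize (cond_pos eps); lra).
  destruct (H _ He) as [c Hc].
  exists (fun x => Cmod (f x - c)%C < eps / 2). split. exact Hc.
  intros u v Hu Hv. apply C_NormedModule_mixin_compat1.
  change (Cmod (f v - f u)%C < eps).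
  generalize (Cmod_sub_triangle (f v) c (f u)). rewrite (Cmod_sym c). lra.
- exists l. apply (Clim_filterlim F). exact Hl.
Qed.

Lemma Cmod_CInt_Re (f g : R -> C) (a b : R) : a <= b -> Ccont_on f a b -> Ccont_on g a b ->
  (forall x, a <= x <= b -> Cmod (f x) <= Re (g x)) -> Cmod (CInt f a b) <= Re (CInt g a b).
Proof.
intros Hab Hf Hg H.
apply (Cmod_is_CInt_le f (fun x => Re (g x)) a b); auto.
- apply is_CInt_cont; auto.
- assert (H0 := is_CInt_cont g a b Hab Hg). apply is_CInt_pair in H0. apply H0.
Qed.

(** * The Gamma function *)

Notation F0 := (filter_prod (at_right 0) (Rbar_locally p_infty)).

Definition pint (f : R -> C) (ab : R * R) : C := CInt f (fst ab) (snd ab).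

(** The neighbourhoods are shrunk to a < 1 < b, which is what allows a <= b to be assumed. *)
Lemma F0_intro (P : R * R -> Prop) (a0 b0 : R) : 0 < a0 ->
  (forall a b, 0 < a < a0 -> b0 < b -> a <= b -> P (a, b)) -> F0 P.
Proof.
intros Ha H. apply Filter_prod with (fun a => 0 < a < Rmin a0 1) (fun b => Rmax b0 1 < b).
- assert (Hm : 0 < Rmin a0 1) by (apply Rmin_glb_lt; lra).
  exists (mkposreal _ Hm). intros a Ha1 Ha2. simpl in Ha1.
  unfold ball in Ha1; simpl in Ha1; unfold AbsRing_ball, abs, minus, plus, opp in Ha1; simpl in Ha1.
  split. exact Ha2. generalize (Rle_abs (a + - 0)); lra.
- exists (Rmax b0 1). intros b Hb; exact Hb.
- intros a b Ha1 Hb. generalize (Rmin_l a0 1) (Rmin_r a0 1) (Rmax_l b0 1) (Rmax_r b0 1). intros.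
  apply H; lra.
Qed.

Definition gam (z : C) (x : R) : C := (Rcpow x (z - 1) * exp (- x))%C.

Lemma Ccont_Rcpow (s : C) (x : R) : 0 < x -> Ccont (fun y => Rcpow y s) x.
Proof. intros Hx. eapply Ccont_Cder, Cder_Rcpow, Hx. Qed.

Lemma Ccont_exp_opp (x : R) : Ccont (fun y => RtoC (exp (- y))) x.
Proof. apply Ccont_RtoC. apply @ex_derive_continuous. auto_derive. exact I. Qed.

Lemma Ccont_on_gam (z : C) (a b : R) : 0 < a -> Ccont_on (gam z) a b.
Proof.
intros Ha x Hx. apply Ccont_mult. apply Ccont_Rcpow; lra. apply Ccont_exp_opp.
Qed.

Lemma Cmod_gam (z : C) (x : R) : Cmod (gam z x) = Rpower x (Re z - 1) * exp (- x).
Proof.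
unfold gam. rewrite Cmod_mult, Cmod_Rcpow, Cmod_R, Rabs_pos_eq by (left; apply exp_pos).
f_equal.
Qed.

Lemma Rpower_small (p eps : R) : 0 < p -> 0 < eps ->
  exists a0, 0 < a0 < 1 /\ forall a, 0 < a < a0 -> Rpower a p < eps.
Proof.
intros Hp He.
set (m := Rmin eps (1 / 2)).
assert (Hm : 0 < m) by (apply Rmin_glb_lt; lra).
assert (Hm1 : m <= 1 / 2) by apply Rmin_r.
exists (Rpower m (/ p)). split.
- split. apply exp_pos. unfold Rpower. rewrite <- exp_0. apply exp_increasing.
  assert (ln m < 0). { rewrite <- ln_1. apply ln_increasing; lra. }
  assert (0 < / p) by (apply Rinv_0_lt_compat, Hp). nra.
- intros a Ha. apply Rlt_le_trans with m; [|apply Rmin_l].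
  replace m with (Rpower (Rpower m (/ p)) p).
  + unfold Rpower at 1 2. apply exp_increasing. apply Rmult_lt_compat_l. exact Hp.
    apply ln_increasing; lra.
  + rewrite Rpower_mult, Rinv_l by lra. apply Rpower_1, Hm.
Qed.

Lemma Rpower_exp_small (p eps : R) : 0 < p -> 0 < eps ->
  exists b0, 1 <= b0 /\ forall b, b0 < b -> Rpower b p * exp (- b) < eps.
Proof.
intros Hp He.
set (K := exp (p * ln (2 * p))).
assert (HK : 0 < K) by apply exp_pos.
exists (Rmax 1 (2 * K / eps)). split. apply Rmax_l.
intros b Hb.
assert (Hb1 : 1 < b) by (generalize (Rmax_l 1 (2 * K / eps)); lra).
assert (Hb2 : 2 * K / eps < b) by (generalize (Rmax_r 1 (2 * K / eps)); lra).
assert (Hln : p * ln b <= b / 2 + p * ln (2 * p)).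
{ replace (ln b) with (ln (b / (2 * p)) + ln (2 * p)).
  2:{ rewrite <- ln_mult by (try apply Rdiv_lt_0_compat; lra). f_equal. field. lra. }
  assert (H : ln (b / (2 * p)) <= b / (2 * p)).
  { assert (0 < b / (2 * p)) by (apply Rdiv_lt_0_compat; lra).
    rewrite <- (ln_exp (b / (2 * p))) at 2. apply ln_le_compat. lra.
    generalize (exp_ineq1_le (b / (2 * p))). lra. }
  assert (p * (b / (2 * p)) = b / 2) by (field; lra). nra. }
apply Rle_lt_trans with (K * exp (- (b / 2))).
- unfold Rpower, K. rewrite <- !exp_plus. apply exp_le_compat. lra.
- rewrite exp_Ropp. assert (H := exp_ineq1_le (b / 2)).
  apply Rmult_lt_reg_r with (exp (b / 2)). apply exp_pos.
  rewrite Rmult_assoc, Rinv_l by (generalize (exp_pos (b / 2)); lra).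
  assert (2 * K < b * eps).
  { apply Rmult_lt_reg_r with (/ eps). apply Rinv_0_lt_compat, He.
    rewrite (Rmult_assoc b), Rinv_r by lra. unfold Rdiv in Hb2. lra. }
  nra.
Qed.

(** Cauchy criterion: below a0 the integrand is dominated by x^(p - 1), with primitive x^p / p, and
    beyond b0 > 1 by e^(-x), because p < 1. *)
Lemma gam_ex (z : C) : 0 < Re z < 1 -> exists l, Clim F0 (pint (gam z)) l.
Proof.
intros Hz. apply (Clim_cauchy F0). intros eps He.
set (p := Re z) in *.
destruct (Rpower_small p (eps * p / 4) ltac:(lra) ltac:(nra)) as [a1 [Ha1 Hs]].
set (a0 := a1 / 2). assert (Ha0 : Rpower a0 p < eps * p / 4) by (apply Hs; unfold a0; lra).
set (b0 := 1 + 4 / eps).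
assert (Hb0 : exp (- b0) <= eps / 4).
{ assert (0 < 4 / eps) by (apply Rdiv_lt_0_compat; lra).
  rewrite exp_Ropp. replace (eps / 4) with (/ (4 / eps)) by (field; lra).
  apply Rinv_le_contravar. lra. generalize (exp_ineq1_le b0). unfold b0; lra. }
assert (Hb1 : 1 < b0) by (unfold b0; assert (0 < 4 / eps) by (apply Rdiv_lt_0_compat; lra); lra).
exists (CInt (gam z) a0 b0).
apply F0_intro with a0 b0. unfold a0; lra.
intros a b Ha Hb Hab. unfold pint; simpl.
assert (Hc : forall c d, 0 < c -> Ccont_on (gam z) c d) by (intros; apply Ccont_on_gam; auto).
assert (a0 < 1) by (unfold a0; lra).
rewrite (CInt_Chasles (gam z) a a0 b), (CInt_Chasles (gam z) a0 b0 b) by (try lra; apply Hc; lra).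
replace (CInt (gam z) a a0 + (CInt (gam z) a0 b0 + CInt (gam z) b0 b) - CInt (gam z) a0 b0)%C
  with (CInt (gam z) a a0 + CInt (gam z) b0 b)%C by ring.
assert (H1 : Cmod (CInt (gam z) a a0) <= / p * exp (p * ln a0) - / p * exp (p * ln a)).
{ apply (Cmod_is_CInt_prim (gam z) (fun x => / p * exp (p * ln x)) (fun x => exp (p * ln x) / x)).
  - lra.
  - intros x Hx. auto_derive. lra. field. lra.
  - intros x Hx. apply @ex_derive_continuous. auto_derive. lra.
  - intros x Hx. rewrite Cmod_gam. fold p.
    replace (p - 1) with (p + - (1)) by ring. rewrite Rpower_plus, Rpower_Ropp, Rpower_1 by lra.
    unfold Rpower. assert (exp (- x) <= 1) by (rewrite <- exp_0; apply exp_le_compat; lra).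
    assert (0 < exp (p * ln x)) by apply exp_pos.
    assert (0 < / x) by (apply Rinv_0_lt_compat; lra).
    unfold Rdiv. assert (0 < exp (p * ln x) * / x) by (apply Rmult_lt_0_compat; auto). nra.
  - apply is_CInt_cont. lra. apply Hc; lra. }
assert (H2 : Cmod (CInt (gam z) b0 b) <= - exp (- b) - - exp (- b0)).
{ apply (Cmod_is_CInt_prim (gam z) (fun x => - exp (- x)) (fun x => exp (- x))).
  - lra.
  - intros x Hx. auto_derive. exact I. ring.
  - intros x Hx. apply @ex_derive_continuous. auto_derive. exact I.
  - intros x Hx. rewrite Cmod_gam. fold p.
    rewrite <- (Rmult_1_l (exp (- x))) at 2. apply Rmult_le_compat_r. left; apply exp_pos.
    replace (p - 1) with (- (1 - p)) by ring.
    apply Rle_trans with (Rpower 1 (- (1 - p))). apply Rpower_opp_le; lra.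
    unfold Rpower; rewrite ln_1, Rmult_0_r, exp_0. lra.
  - apply is_CInt_cont. lra. apply Hc; lra. }
assert (H3 : / p * exp (p * ln a0) < eps / 4).
{ change (exp (p * ln a0)) with (Rpower a0 p). replace (eps / 4) with (/ p * (eps * p / 4)) by (field; lra).
  apply Rmult_lt_compat_l; auto. apply Rinv_0_lt_compat; lra. }
assert (H4 : 0 < / p * exp (p * ln a)) by (apply Rmult_lt_0_compat; [apply Rinv_0_lt_compat; lra|apply exp_pos]).
assert (H5 := exp_pos (- b)).
generalize (Cmod_triangle (CInt (gam z) a a0) (CInt (gam z) b0 b)). lra.
Qed.

Lemma Cder_exp_opp (x : R) : Cder (fun y => RtoC (exp (- y))) x (- RtoC (exp (- x)))%C.
Proof.
eapply Cder_eq. apply Cder_RtoC with (l := - exp (- x)). auto_derive. exact I. ring.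
apply RtoC_opp.
Qed.

Lemma gam_boundary (z : C) : 0 < Re z ->
  Clim F0 (fun ab => Rcpow (snd ab) z * exp (- snd ab) - Rcpow (fst ab) z * exp (- fst ab))%C 0.
Proof.
intros Hz eps He.
destruct (Rpower_small (Re z) (eps / 2) Hz ltac:(lra)) as [a0 [Ha0 Hs]].
destruct (Rpower_exp_small (Re z) (eps / 2) Hz ltac:(lra)) as [b0 [Hb0 Hl]].
apply F0_intro with a0 b0. lra. intros a b Ha Hb Hab. cbn [fst snd].
generalize (Cmod_minus_le (Rcpow b z * exp (- b)) (Rcpow a z * exp (- a))).
rewrite Cminus_0_r.
rewrite !Cmod_mult, !Cmod_Rcpow, !Cmod_R, !Rabs_pos_eq by (left; apply exp_pos).
generalize (Hl b Hb) (Hs a Ha) (exp_pos (Re z * ln a)). fold (Rpower a (Re z)).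
assert (exp (- a) <= 1) by (rewrite <- exp_0; apply exp_le_compat; lra).
assert (0 < exp (- a)) by apply exp_pos. nra.
Qed.

Lemma gam_succ (z l : C) : 0 < Re z -> Clim F0 (pint (gam z)) l ->
  Clim F0 (pint (gam (z + 1))) (z * l)%C.
Proof.
intros Hz Hl.
replace (z * l)%C with (z * l - 0)%C by ring.
apply (Clim_ext F0 (fun ab => z * pint (gam z) ab -
  (Rcpow (snd ab) z * exp (- snd ab) - Rcpow (fst ab) z * exp (- fst ab)))%C).
- apply F0_intro with 1 1. lra. intros a b Ha Hb Hab. cbn [fst snd]. unfold pint; cbn [fst snd].
  assert (H := CInt_parts (fun x => Rcpow x z) (fun x => - RtoC (exp (- x)))%C
    (fun x => z * Rcpow x (z - 1))%C (fun x => RtoC (exp (- x))) a b ltac:(lra)).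
  assert (E1 : CInt (gam (z + 1)) a b = CInt (fun x => Rcpow x z * RtoC (exp (- x)))%C a b).
  { apply CInt_ext. lra. intros x _. unfold gam. do 2 f_equal. ring. }
  rewrite E1, H.
  + assert (E2 : CInt (fun x => z * Rcpow x (z - 1) * - RtoC (exp (- x)))%C a b
      = (- z * CInt (gam z) a b)%C).
    { rewrite <- CInt_scal by (try lra; apply Ccont_on_gam; lra).
      apply CInt_ext. lra. intros x _. unfold gam. ring. }
    rewrite E2. ring.
  + intros x Hx. apply Cder_Rcpow. lra.
  + intros x Hx. eapply Cder_eq.
    apply Cder_ext with (fun y => (-(1)) * RtoC (exp (- y)))%C. intros; ring.
    apply Cder_scal, Cder_exp_opp. ring.
  + intros x Hx. apply Ccont_mult. apply Ccont_const. apply Ccont_Rcpow; lra.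
  + intros x Hx. apply Ccont_exp_opp.
- apply (Clim_minus F0). apply (Clim_scal F0), Hl. apply gam_boundary, Hz.
Qed.

Lemma gam_rising (z l : C) (m : nat) : 0 < Re z -> Clim F0 (pint (gam z)) l ->
  Clim F0 (pint (gam (z + INR m))) (rising z m * l)%C.
Proof.
intros Hz Hl. induction m as [|m IH].
- simpl. rewrite Cplus_0_r, Cmult_1_l. exact Hl.
- rewrite S_INR, RtoC_plus, Cplus_assoc.
  replace (rising z (S m) * l)%C with ((z + INR m) * (rising z m * l))%C by (simpl; ring).
  apply gam_succ. rewrite re_plus, re_RtoC. generalize (pos_INR m); lra. exact IH.
Qed.

Lemma gam_1 : Clim F0 (pint (gam 1)) 1.
Proof.
intros eps He.
set (b0 := Rmax 1 (- ln (eps / 2))).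
apply F0_intro with (eps / 2) b0. lra. intros a b Ha Hb Hab. unfold pint; cbn [fst snd].
assert (Hb1 : - ln (eps / 2) < b) by (generalize (Rmax_r 1 (- ln (eps / 2))); unfold b0 in Hb; lra).
assert (E : CInt (gam 1) a b = (- RtoC (exp (- b)) - - RtoC (exp (- a)))%C).
{ rewrite <- (CInt_Cder (fun x => - RtoC (exp (- x)))%C (fun x => RtoC (exp (- x)))).
  - apply CInt_ext. lra. intros x Hx. unfold gam.
    replace (1 - 1)%C with (RtoC 0) by ring. rewrite Rcpow_0. ring.
  - lra.
  - intros x Hx. eapply Cder_eq.
    apply Cder_ext with (fun y => (-(1)) * RtoC (exp (- y)))%C. intros; ring.
    apply Cder_scal, Cder_exp_opp. ring.
  - intros x Hx. apply Ccont_exp_opp. }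
rewrite E. replace (- RtoC (exp (- b)) - - RtoC (exp (- a)) - 1)%C with (RtoC (exp (- a) - 1 - exp (- b))).
2:{ rewrite !RtoC_minus. ring. }
rewrite Cmod_R.
assert (exp (- b) < eps / 2).
{ rewrite <- (exp_ln (eps / 2)) by lra. apply exp_increasing. lra. }
assert (exp (- a) <= 1) by (rewrite <- exp_0; apply exp_le_compat; lra).
generalize (exp_ineq1_le (- a)) (exp_pos (- b)). intros. apply Rabs_def1; lra.
Qed.

(** * Euler's limit for Gamma and the reflection formula *)

Lemma rising_1 (m : nat) : rising 1 m = INR (fact m).
Proof.
induction m as [|m IH]. reflexivity.
change (rising 1 (S m)) with (rising 1 m * (1 + INR m))%C.
rewrite IH, fact_simpl, mult_INR, S_INR, RtoC_mult, RtoC_plus. ring.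
Qed.

Lemma gam_fact (m : nat) : Clim F0 (pint (gam (1 + INR m))) (INR (fact m)).
Proof.
rewrite <- rising_1. rewrite <- (Cmult_1_r (rising 1 m)).
apply gam_rising. simpl; lra. apply gam_1.
Qed.

(** The comparison |u^p - 1| <= |u - 1| for 0 < p < 1 holds for all u > 0. The bound is therefore
    global and linear, and a mean of u^z can be controlled by a second moment alone. *)
Lemma Cmod_Rcpow_sub_1 (z : C) (u : R) : 0 < Re z < 1 -> 0 < u ->
  Cmod (Rcpow u z - 1)%C <= Cmod z / Re z * Rabs (u - 1).
Proof.
intros Hz Hu. set (p := Re z) in *.
assert (Hz0 := Cmod_ge_0 z).
assert (HK : 0 <= Cmod z / p) by (apply Rmult_le_pos; [lra|left; apply Rinv_0_lt_compat; lra]).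
assert (Hgen : forall a b, 0 < a <= b ->
  Cmod (Rcpow b z - Rcpow a z)%C <= Cmod z / p * Rpower b p - Cmod z / p * Rpower a p).
{ intros a b Hab.
  rewrite <- (CInt_Cder (fun x => Rcpow x z) (fun x => z * Rcpow x (z - 1))%C).
  - apply (Cmod_is_CInt_prim (fun x => z * Rcpow x (z - 1))%C (fun x => Cmod z / p * exp (p * ln x))
      (fun x => Cmod z * exp (p * ln x) / x)).
    + lra.
    + intros x Hx. auto_derive. lra. field. lra.
    + intros x Hx. apply @ex_derive_continuous. auto_derive. lra.
    + intros x Hx. rewrite Cmod_mult, Cmod_Rcpow. right.
      replace (Re (z - 1)%C) with (p + - (1)) by reflexivity.
      rewrite Rpower_plus, Rpower_Ropp, Rpower_1 by lra. unfold Rpower. field. lra.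
    + apply is_CInt_cont. lra. intros x Hx. apply Ccont_mult. apply Ccont_const. apply Ccont_Rcpow; lra.
  - lra.
  - intros x Hx. apply Cder_Rcpow; lra.
  - intros x Hx. apply Ccont_mult. apply Ccont_const. apply Ccont_Rcpow; lra. }
assert (H1 : Rpower 1 p = 1) by (unfold Rpower; rewrite ln_1, Rmult_0_r; apply exp_0).
destruct (Rle_dec 1 u) as [H|H].
- rewrite <- (Rcpow_1_l z). eapply Rle_trans. apply Hgen; lra. rewrite H1.
  rewrite Rabs_pos_eq by lra.
  assert (Rpower u p <= u).
  { rewrite <- (Rpower_1 u) at 2 by lra. unfold Rpower. apply exp_le_compat.
    assert (0 <= ln u) by (rewrite <- ln_1; apply ln_le_compat; lra). nra. }
  nra.
- rewrite Cmod_sym. rewrite <- (Rcpow_1_l z). eapply Rle_trans. apply Hgen; lra. rewrite H1.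
  rewrite Rabs_left1 by lra.
  assert (u <= Rpower u p).
  { rewrite <- (Rpower_1 u) at 1 by lra. unfold Rpower. apply exp_le_compat.
    assert (ln u <= 0) by (rewrite <- ln_1; apply ln_le_compat; lra). nra. }
  nra.
Qed.

Lemma gam_INR (m : nat) (x : R) : 0 < x -> gam (1 + INR m) x = RtoC (x ^ m * exp (- x)).
Proof.
intros Hx. unfold gam. replace (1 + INR m - 1)%C with (RtoC (INR m)) by ring.
rewrite Rcpow_RtoC, Rpower_pow, RtoC_mult by exact Hx. reflexivity.
Qed.

(* [Gamma (z + m + 1) / m!] is the mean of [x^z] under a law with mean [m + 1] and variance [m + 1]. *)
Lemma rising_bound (z l : C) (m : nat) (d : R) : 0 < Re z < 1 -> 0 < d ->
  Clim F0 (pint (gam z)) l ->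
  Cmod (rising z (S m) * l - Rcpow (INR m + 1) z * INR (fact m))%C
   <= Rpower (INR m + 1) (Re z) * (Cmod z / Re z) * (INR (fact m) * (d + / (d * (INR m + 1)))) .
Proof.
intros Hz Hd Hl.
assert (Hm := pos_INR m). set (N := INR m + 1).
assert (HN : 1 <= N) by (unfold N; lra).
assert (HRN : RtoC N <> 0) by (intros E; apply RtoC_inj in E; lra).
assert (HRd : RtoC d <> 0) by (intros E; apply RtoC_inj in E; lra).
assert (H1 : Clim F0 (fun ab => pint (gam (z + INR (S m))) ab - Rcpow N z * pint (gam (1 + INR m)) ab)%C
  (rising z (S m) * l - Rcpow N z * INR (fact m))%C).
{ apply (Clim_minus F0). apply gam_rising; [lra|exact Hl]. apply (Clim_scal F0). apply gam_fact. }
set (K := Rpower N (Re z) * (Cmod z / Re z)).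
assert (HK : 0 <= K).
{ apply Rmult_le_pos. left; apply exp_pos. apply Rmult_le_pos. apply Cmod_ge_0.
  left; apply Rinv_0_lt_compat; lra. }
(* On x > 0 this is K (d + (x / N - 1)^2 / d) x^m e^(-x), expanded so that its integral is a
   combination of m!, (m + 1)! and (m + 2)!. These add up to K m! (d + 1 / (d N)). *)
set (g := fun x => (RtoC (K * (d + / d)) * gam (1 + INR m) x
   + (RtoC (K * (- 2 / (d * N))) * gam (1 + INR (S m)) x + RtoC (K * / (d * N ^ 2)) * gam (1 + INR (S (S m))) x))%C).
assert (Hg : Clim F0 (pint g) (RtoC (K * (INR (fact m) * (d + / (d * N)))))).
{ apply (Clim_ext F0 (fun ab => RtoC (K * (d + / d)) * pint (gam (1 + INR m)) ab
   + (RtoC (K * (- 2 / (d * N))) * pint (gam (1 + INR (S m))) ab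
      + RtoC (K * / (d * N ^ 2)) * pint (gam (1 + INR (S (S m)))) ab))%C).
  - apply F0_intro with 1 1. lra. intros a b Ha Hb Hab. unfold pint; cbn [fst snd].
    symmetry. apply is_CInt_unique. unfold g.
    apply is_CInt_plus; [|apply is_CInt_plus]; apply is_CInt_scal, is_CInt_cont; try lra; apply Ccont_on_gam; lra.
  - replace (RtoC (K * (INR (fact m) * (d + / (d * N))))) with
     (RtoC (K * (d + / d)) * INR (fact m) + (RtoC (K * (- 2 / (d * N))) * INR (fact (S m))
        + RtoC (K * / (d * N ^ 2)) * INR (fact (S (S m)))))%C.
    + apply (Clim_plus F0). apply (Clim_scal F0), gam_fact.
      apply (Clim_plus F0); apply (Clim_scal F0), gam_fact.
    + rewrite !fact_simpl, !mult_INR, !S_INR. fold N. rewrite <- !RtoC_mult, <- !RtoC_plus.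
      f_equal. field. lra. }
apply (Clim_Cmod_le_Re F0 _ _ _ _ H1 Hg).
apply F0_intro with 1 1. lra. intros a b Ha Hb Hab. unfold pint; cbn [fst snd].
rewrite <- CInt_scal by (try lra; apply Ccont_on_gam; lra).
assert (Hcg : forall w c d, 0 < c -> Ccont_on (gam w) c d) by (intros; apply Ccont_on_gam; assumption).
rewrite <- CInt_minus.
2: lra. 2: apply Hcg; lra. 2: intros x Hx; apply Ccont_mult; [apply Ccont_const|apply (Hcg _ a b); lra].
apply Cmod_CInt_Re.
- lra.
- intros x Hx; apply Ccont_minus. apply (Hcg _ a b); lra. apply Ccont_mult; [apply Ccont_const|apply (Hcg _ a b); lra].
- intros x Hx. unfold g. repeat apply Ccont_plus; apply Ccont_mult; try apply Ccont_const; apply (Hcg _ a b); lra.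
- intros x Hx.
  assert (Hx0 : 0 < x) by lra.
  assert (Hq : 0 <= x ^ m * exp (- x)).
  { apply Rmult_le_pos. apply pow_le; lra. left; apply exp_pos. }
  unfold g. rewrite !gam_INR by lra.
  assert (E1 : gam (z + INR (S m)) x = (Rcpow x z * RtoC (x ^ m * exp (- x)))%C).
  { rewrite <- gam_INR by lra. unfold gam. rewrite Cmult_assoc, <- Rcpow_plus.
    do 2 f_equal. rewrite S_INR, RtoC_plus. ring. }
  rewrite E1.
  assert (E2 : Rcpow x z = (Rcpow N z * Rcpow (x / N) z)%C).
  { rewrite <- Rcpow_mult. f_equal. field. lra. lra. apply Rdiv_lt_0_compat; lra. }
  rewrite E2.
  replace (Rcpow N z * Rcpow (x / N) z * RtoC (x ^ m * exp (- x)) - Rcpow N z * RtoC (x ^ m * exp (- x)))%C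
    with (Rcpow N z * (Rcpow (x / N) z - 1) * RtoC (x ^ m * exp (- x)))%C by ring.
  rewrite !Cmod_mult, Cmod_Rcpow, Cmod_R, (Rabs_pos_eq _ Hq).
  rewrite <- !RtoC_mult, <- !RtoC_plus, re_RtoC.
  replace (K * (d + / d) * (x ^ m * exp (- x)) + (K * (-2 / (d * N)) * (x ^ S m * exp (- x)) + K * / (d * N ^ 2) * (x ^ S (S m) * exp (- x))))
    with (K * (d + / d * (x / N - 1) ^ 2) * (x ^ m * exp (- x))) by (simpl; field; lra).
  apply Rmult_le_compat_r. exact Hq.
  unfold K. rewrite !Rmult_assoc. apply Rmult_le_compat_l. left; apply exp_pos.
  eapply Rle_trans. apply Cmod_Rcpow_sub_1. exact Hz. apply Rdiv_lt_0_compat; lra.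
  apply Rle_trans with (Cmod z / Re z * (d + / d * (x / N - 1) ^ 2)); [|right; unfold Rdiv; ring].
  apply Rmult_le_compat_l.
  + apply Rmult_le_pos. apply Cmod_ge_0. left; apply Rinv_0_lt_compat; lra.
  + rewrite <- (pow2_abs (x / N - 1)). set (y := Rabs (x / N - 1)).
    assert (Hy : 0 <= y) by apply Rabs_pos.
    apply Rmult_le_reg_l with d. lra.
    replace (d * (d + / d * y ^ 2)) with (d * d + y * y) by (field; lra).
    generalize (Rle_0_sqr (d - y)). unfold Rsqr. nra.
Qed.

(** Euler's limit formula. As for the cosine moments, d is taken small and then m + 1 > 1 / d^2,
    which makes both error terms at most d. *)
Lemma rising_lim (z l : C) : 0 < Re z < 1 -> Clim F0 (pint (gam z)) l ->
  Clim eventually (fun m => rising z (S m) * l / (Rcpow (INR m + 1) z * INR (fact m)))%C 1.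
Proof.
intros Hz Hl.
set (K := Cmod z / Re z).
assert (HK : 0 <= K).
{ apply Rmult_le_pos. apply Cmod_ge_0. left; apply Rinv_0_lt_compat; lra. }
intros eps Heps.
set (d := eps / (2 * (K + 1))).
assert (Hd : 0 < d) by (apply Rdiv_lt_0_compat; lra).
destruct (nfloor_ex (/ (d * d)) ltac:(left; apply Rinv_0_lt_compat; nra)) as [n0 [_ Hn0]].
exists n0. intros n Hn.
assert (HnR : / (d * d) < INR n + 1) by (apply le_INR in Hn; lra).
assert (Hn' := pos_INR n).
assert (Hf : 0 < INR (fact n)) by apply INR_fact_lt_0.
assert (Hf' : RtoC (INR (fact n)) <> 0) by (intros E; apply RtoC_inj in E; lra).
assert (HP := Rcpow_neq_0 (INR n + 1) z).
set (D := (Rcpow (INR n + 1) z * INR (fact n))%C).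
assert (HD : D <> 0) by (apply Cmult_neq_0; assumption).
assert (HmD : Cmod D = Rpower (INR n + 1) (Re z) * INR (fact n)).
{ unfold D. rewrite Cmod_mult, Cmod_Rcpow, Cmod_R, Rabs_pos_eq; lra. }
assert (HmD0 : 0 < Cmod D) by (apply Cmod_gt_0, HD).
replace (rising z (S n) * l / D - 1)%C with ((rising z (S n) * l - D) / D)%C by (field; exact HD).
rewrite Cmod_div by exact HD.
apply Rmult_lt_reg_r with (Cmod D). exact HmD0.
unfold Rdiv. rewrite Rmult_assoc, Rinv_l, Rmult_1_r by lra.
eapply Rle_lt_trans. apply (rising_bound z l n d Hz Hd Hl). fold K.
replace (Rpower (INR n + 1) (Re z) * K * (INR (fact n) * (d + / (d * (INR n + 1)))))
  with (K * (d + / (d * (INR n + 1))) * Cmod D) by (rewrite HmD; ring).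
apply Rmult_lt_compat_r. exact HmD0.
assert (Hi : / (d * (INR n + 1)) <= d).
{ apply Rmult_le_reg_l with (INR n + 1). lra.
  replace ((INR n + 1) * / (d * (INR n + 1))) with (/ (d * d) * d) by (field; lra).
  apply Rmult_le_compat_r; lra. }
apply Rle_lt_trans with (K * (2 * d)). nra.
replace (2 * d) with (eps / (K + 1)) by (unfold d; field; lra). apply Rmult_div_succ_lt; assumption.
Qed.

(** Each z + k is paired with k - z; the unpaired factors are z and n + 1 - z. *)
Lemma rising_mul (z : C) (n : nat) :
  (rising z (S n) * rising (1 - z) (S n) = z * sqprod z n * (INR n + 1 - z))%C.
Proof.
induction n as [|n IH].
- simpl. ring.
- change (rising z (S (S n))) with (rising z (S n) * (z + INR (S n)))%C.
  change (rising (1 - z) (S (S n))) with (rising (1 - z) (S n) * (1 - z + INR (S n)))%C.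
  change (sqprod z (S n)) with (sqprod z n * (INR (S n) * INR (S n) - z * z))%C.
  replace (rising z (S n) * (z + INR (S n)) * (rising (1 - z) (S n) * (1 - z + INR (S n))))%C
    with ((rising z (S n) * rising (1 - z) (S n)) * ((z + INR (S n)) * (1 - z + INR (S n))))%C.
2:{ generalize (rising z (S n)) (rising (1 - z) (S n)) (INR (S n)). intros. ring. }
  rewrite IH, S_INR, RtoC_plus. ring.
Qed.

(** Multiplying Euler's limits for z and 1 - z by [wallisC z n / wallis n] produces [sqprod z n],
    which [sqprod_wallisC] evaluates. Powers and factorials cancel, leaving c (1 - z / (n + 1)) with
    c constant; the limit forces c = 1. *)
Lemma gamma_reflection_wallis (z l l' : C) : 0 < Re z < 1 ->
  Clim F0 (pint (gam z)) l -> Clim F0 (pint (gam (1 - z))) l' ->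
  (l * l' * z * wallisC z 0 = PI)%C.
Proof.
intros Hz Hl Hl'.
assert (HP : RtoC PI <> 0) by (intros E; apply RtoC_inj in E; generalize PI_RGT_0; lra).
assert (Hz' : 0 < Re (1 - z)%C < 1) by (simpl; unfold Re in Hz; lra).
assert (H1 := Clim_mult eventually _ _ _ _
  (Clim_mult eventually _ _ _ _ (rising_lim z l Hz Hl) (rising_lim (1 - z)%C l' Hz' Hl')) (wallisC_lim z)).
rewrite !Cmult_1_l in H1.
set (c := (l * l' * z * wallisC z 0 / PI)%C).
assert (H2 : Clim eventually (fun n => c * (1 - z * RtoC (/ (INR n + 1))))%C (c * (1 - z * 0))%C).
{ apply (Clim_scal eventually). apply (Clim_minus eventually). apply (Clim_const eventually).
  apply (Clim_scal eventually). apply (Clim_squeeze eventually) with (fun n => / (INR n + 1)).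
  - exists O. intros n _. rewrite Cminus_0_r, Cmod_R, Rabs_pos_eq.
    lra. left. apply Rinv_0_lt_compat. generalize (pos_INR n); lra.
  - assert (Hl0 := is_lim_seq_INR).
    assert (H0 : is_lim_seq (fun n => / (INR n + 1)) (Rbar_inv p_infty)).
    { apply is_lim_seq_inv. apply is_lim_seq_plus with p_infty 1. exact Hl0. apply is_lim_seq_const.
      reflexivity. discriminate. }
    exact H0. }
assert (E : c = 1).
{ replace c with (c * (1 - z * 0))%C by ring.
  apply (Clim_unique eventually _ _ _ H2).
  apply (Clim_ext eventually) with (2 := H1).
  exists O. intros n _.
  assert (Hn := pos_INR n).
  assert (Hf : RtoC (INR (fact n)) <> 0).
  { intros E; apply RtoC_inj in E. generalize (INR_fact_lt_0 n). lra. }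
  assert (Hw : RtoC (wallis n) <> 0).
  { intros E; apply RtoC_inj in E. generalize (wallis_pos n). lra. }
  assert (HN : RtoC (INR n + 1) <> 0) by (intros E; apply RtoC_inj in E; lra).
  assert (EP : (Rcpow (INR n + 1) z * Rcpow (INR n + 1) (1 - z) = RtoC (INR n + 1))%C).
  { rewrite <- Rcpow_plus. replace (z + (1 - z))%C with (RtoC 1) by ring. apply Rcpow_1; lra. }
  assert (HP1 := Rcpow_neq_0 (INR n + 1) z). assert (HP2 := Rcpow_neq_0 (INR n + 1) (1 - z)).
  assert (ES := sqprod_wallisC z n).
  transitivity ((rising z (S n) * rising (1 - z) (S n)) * (l * l') * wallisC z n
    / ((Rcpow (INR n + 1) z * Rcpow (INR n + 1) (1 - z)) * INR (fact n) * INR (fact n) * wallis n))%C.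
  { field. repeat split; assumption. }
  rewrite EP, rising_mul.
  transitivity (z * (l * l') * (INR n + 1 - z) * (sqprod z n * wallisC z n * PI)
    / (RtoC (INR n + 1) * INR (fact n) * INR (fact n) * wallis n * PI))%C.
  { field. repeat split; assumption. }
  rewrite ES. rewrite RtoC_inv by lra. unfold c.
  replace (INR n + 1 - z)%C with (RtoC (INR n + 1) - z)%C by (rewrite RtoC_plus; ring).
  field. repeat split; assumption. }
unfold c in E. replace (l * l' * z * wallisC z 0)%C with (l * l' * z * wallisC z 0 / PI * PI)%C.
rewrite E. ring. field. exact HP.
Qed.

Lemma wallisC_0 (z : C) : (2 * Ci * z * wallisC z 0 = Cexp (Ci * PI * z) - Cexp (- (Ci * PI * z)))%C.
Proof.
assert (HP := PI_RGT_0).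
unfold wallisC.
rewrite <- CInt_scal by (try lra; intros x _; apply wallisC_cont).
rewrite (CInt_Cder (fun x : R => Cexp (2 * Ci * z * x)) ).
- f_equal; [|f_equal]; f_equal; rewrite ?RtoC_opp, RtoC_div by lra; field.
- lra.
- intros x Hx. eapply Cder_eq. apply Cder_Cexp, Cder_scal, Cder_id. change (2 * 0)%nat with 0%nat. rewrite pow_O. ring.
- intros x _. apply Ccont_mult. apply Ccont_const. apply wallisC_cont.
Qed.

Lemma gamma_reflection (z l l' : C) : 0 < Re z < 1 ->
  Clim F0 (pint (gam z)) l -> Clim F0 (pint (gam (1 - z))) l' ->
  (l * l' * (Cexp (Ci * PI * z) - Cexp (- (Ci * PI * z))) = 2 * Ci * PI)%C.
Proof.
intros Hz Hl Hl'. rewrite <- wallisC_0.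
rewrite <- (gamma_reflection_wallis z l l' Hz Hl Hl'). ring.
Qed.

(** * Rotating the contour of Euler's integral *)

Lemma is_derive_quadratic (f : R -> R) (x l K : R) :
  (forall y, Rabs (y - x) <= 1 -> Rabs (f y - f x - (y - x) * l) <= K * (y - x) ^ 2) ->
  is_derive f x l.
Proof.
intros H. apply is_derive_Reals. intros eps He.
assert (HK : 0 <= Rabs K) by apply Rabs_pos.
set (d := Rmin 1 (eps / (Rabs K + 1))).
assert (Hd : 0 < d) by (apply Rmin_glb_lt; [lra|apply Rdiv_lt_0_compat; lra]).
exists (mkposreal d Hd). intros h Hh Hhd. simpl in Hhd.
assert (Hd1 : d <= 1) by apply Rmin_l.
assert (Hd2 : d <= eps / (Rabs K + 1)) by apply Rmin_r.
specialize (H (x + h)). replace (x + h - x) with h in H by ring.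
specialize (H ltac:(lra)).
assert (Hh0 : 0 < Rabs h) by (apply Rabs_pos_lt, Hh).
replace ((f (x + h) - f x) / h - l) with ((f (x + h) - f x - h * l) / h) by (field; exact Hh).
unfold Rdiv. rewrite Rabs_mult, Rabs_inv.
apply Rle_lt_trans with (Rabs K * Rabs h).
- apply Rmult_le_reg_r with (Rabs h). exact Hh0.
  rewrite Rmult_assoc, Rinv_l, Rmult_1_r by lra.
  eapply Rle_trans. apply H. rewrite <- (pow2_abs h).
  replace (Rabs K * Rabs h * Rabs h) with (Rabs K * Rabs h ^ 2) by ring.
  apply Rmult_le_compat_r. nra. apply Rle_abs.
- apply Rle_lt_trans with (Rabs K * (eps / (Rabs K + 1))).
  apply Rmult_le_compat_l; lra. apply Rmult_div_succ_lt; assumption.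
Qed.

(** This form suits differentiation under the integral sign, where pointwise quadratic remainders
    are integrated. *)
Lemma Cder_quadratic (f : R -> C) (x : R) (l : C) (K : R) :
  (forall y, Rabs (y - x) <= 1 -> Cmod (f y - f x - (y - x)%R * l)%C <= K * (y - x) ^ 2) ->
  Cder f x l.
Proof.
intros H. apply Cder_pair; split; apply is_derive_quadratic with K; intros y Hy;
  (eapply Rle_trans; [|apply (H y Hy)]).
- replace (Re (f y) - Re (f x) - (y - x) * Re l) with (Re (f y - f x - (y - x)%R * l)%C)
    by (simpl; unfold Re; ring). apply re_le_Cmod.
- replace (Im (f y) - Im (f x) - (y - x) * Im l) with (Im (f y - f x - (y - x)%R * l)%C)
    by (simpl; unfold Im; ring).
  eapply Rle_trans; [|apply Rmax_Cmod]. apply Rmax_r.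
Qed.

(** Euler's integrand on the ray x = y e^(-i th), with the factor dx / dy = e^(-i th) included. *)
Definition rot (z : C) (th y : R) : C :=
  (Rcpow y (z - 1) * Cexp (- Ci * z * th - y * Cexp (- Ci * th)))%C.

(** Euler's integrand along the arc of radius y, with the factor dx / d th = -i x included. *)
Definition rot' (z : C) (th y : R) : C :=
  (- Ci * Rcpow y z * Cexp (- Ci * z * th - y * Cexp (- Ci * th)))%C.

(** The common value of the th-derivative of [rot] and the y-derivative of [rot']: the
    Cauchy-Riemann equations in polar form. *)
Definition rotd (z : C) (th y : R) : C :=
  (rot z th y * (- Ci * z - - Ci * y * Cexp (- Ci * th)))%C.

Lemma Cder_rot' (z : C) (th y : R) : 0 < y -> Cder (rot' z th) y (rotd z th y).
Proof.
intros Hy. unfold rot'.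
apply Cder_ext with (fun y => - Ci * (Rcpow y z * Cexp (- Ci * z * th - Cexp (- Ci * th) * y)))%C.
{ intros u. rewrite (Cmult_comm (Cexp _) u). ring. }
eapply Cder_eq.
- apply Cder_scal, Cder_mult. apply Cder_Rcpow, Hy. apply Cder_Cexp, Cder_minus. apply Cder_const.
  apply Cder_scal, Cder_id.
- unfold rotd, rot. rewrite (Cmult_comm (Cexp _) y).
  replace (Rcpow y z) with (y * Rcpow y (z - 1))%C.
  ring. rewrite <- (Rcpow_1 y) at 1 by exact Hy. rewrite <- Rcpow_plus. f_equal. ring.
Qed.

Lemma Ccont_rot (z : C) (th y : R) : 0 < y -> Ccont (rot z th) y.
Proof.
intros Hy. apply Ccont_mult. apply Ccont_Rcpow, Hy.
apply Ccont_ext with (fun y => Cexp (- Ci * z * th - Cexp (- Ci * th) * y)).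
{ intros u. rewrite (Cmult_comm (Cexp _) u). reflexivity. }
eapply Ccont_Cder. apply Cder_Cexp, Cder_minus. apply Cder_const. apply Cder_scal, Cder_id.
Qed.

Lemma Ccont_rotd (z : C) (th y : R) : 0 < y -> Ccont (rotd z th) y.
Proof.
intros Hy. apply Ccont_mult. apply Ccont_rot, Hy. apply Ccont_minus. apply Ccont_const.
apply Ccont_mult; [|apply Ccont_const]. apply Ccont_mult. apply Ccont_const.
eapply Ccont_Cder, Cder_id.
Qed.

Lemma Re_Cexp_Ci (th : R) : Re (Cexp (- Ci * th)) = cos th.
Proof.
unfold Cexp; simpl. replace (-0 * th - - (1) * 0) with 0 by ring.
replace (-0 * 0 + - (1) * th) with (- th) by ring. rewrite exp_0, cos_neg. ring.
Qed.

Lemma Cmod_Cexp_Ci' (th : R) : Cmod (Cexp (- Ci * th)) = 1.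
Proof.
replace (- Ci * th)%C with (Ci * (- th)%R)%C by (rewrite RtoC_opp; ring). apply Cmod_Cexp_Ci.
Qed.

Lemma Cmod_rot_exp (z : C) (th y : R) : Rabs th <= 2 ->
  Cmod (Cexp (- Ci * z * th - y * Cexp (- Ci * th))) <= exp (2 * Cmod z) * exp (- (y * cos th)).
Proof.
intros Hth. rewrite Cmod_Cexp, <- exp_plus. apply exp_le_compat.
replace (Re (- Ci * z * th - y * Cexp (- Ci * th))%C) with (Re (- Ci * z * th)%C - y * Re (Cexp (- Ci * th))).
2:{ unfold Cminus. rewrite re_plus, re_opp, re_scal_l. reflexivity. }
rewrite Re_Cexp_Ci.
assert (H := re_le_Cmod (- Ci * z * th)%C).
rewrite !Cmod_mult, Cmod_opp, Cmod_Ci, Cmod_R in H.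
generalize (Rle_abs (Re (- Ci * z * th)%C)) (Cmod_ge_0 z) (Rabs_pos th). intros. nra.
Qed.

(** Cauchy's theorem for a sector in differential form: differentiating the ray integral under the
    integral sign gives [rotd], which integrates in y to the two arc terms. *)
Lemma Cder_rot_int (z : C) (a b th : R) : 0 < a <= b -> Rabs th <= 2 ->
  Cder (fun th => CInt (rot z th) a b) th (rot' z th b - rot' z th a)%C.
Proof.
intros Hab Hth.
assert (Hcr : forall t, Ccont_on (rot z t) a b) by (intros t x Hx; apply Ccont_rot; lra).
assert (Hcd : Ccont_on (rotd z th) a b) by (intros x Hx; apply Ccont_rotd; lra).
rewrite <- (CInt_Cder (rot' z th) (rotd z th) a b); [|lra|intros x Hx; apply Cder_rot'; lra|exact Hcd].
(* Bounds |v| / |d| for the increment v of the exponent introduced below, given y <= b and |d| <=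
   1. *)
set (V := Cmod z + b * exp 1).
assert (HV0 : 0 <= V) by (unfold V; generalize (Cmod_ge_0 z) (exp_pos 1); nra).
destruct (continuity_ab_maj (fun y => Rpower y (Re z - 1)) a b ltac:(lra)) as [ym [Hym _]].
{ intros c Hc. apply derivable_continuous_pt.
  apply ex_derive_Reals_0. unfold Rpower. auto_derive. lra. }
set (P := Rpower ym (Re z - 1)) in *.
set (Q := P * (exp (2 * Cmod z) * exp b)).
assert (HQ : forall y, a <= y <= b -> Cmod (rot z th y) <= Q).
{ intros y Hy. unfold rot. rewrite Cmod_mult, Cmod_Rcpow. apply Rmult_le_compat.
  left; apply exp_pos. apply Cmod_ge_0. apply Hym, Hy.
  eapply Rle_trans. apply Cmod_rot_exp, Hth. apply Rmult_le_compat_l. left; apply exp_pos.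
  apply exp_le_compat. generalize (COS_bound th). nra. }
assert (HQ0 : 0 <= Q).
{ apply Rle_trans with (1 := Cmod_ge_0 _) (2 := HQ a ltac:(lra)). }
set (W := Q * (V ^ 2 * exp V + b * exp 1)).
apply Cder_quadratic with ((b - a) * W).
intros th' Hth'. set (d := th' - th) in *.
assert (E : (CInt (rot z th') a b - CInt (rot z th) a b - d * CInt (rotd z th) a b)%C =
  CInt (fun y => rot z th' y - rot z th y - d * rotd z th y)%C a b).
{ symmetry. apply is_CInt_unique. apply is_CInt_minus. apply is_CInt_minus; apply is_CInt_cont; auto; lra.
  apply is_CInt_scal, is_CInt_cont; auto; lra. }
rewrite E. rewrite Rmult_assoc. apply Cmod_CInt_const.
- lra.
- intros y Hy. apply Ccont_minus. apply Ccont_minus; apply Hcr; lra.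
  apply Ccont_mult. apply Ccont_const. apply Hcd, Hy.
- intros y Hy.
  set (u := Cexp (- Ci * th)).
  set (w := (- Ci * d)%C).
  assert (Hu : Cmod u = 1) by apply Cmod_Cexp_Ci'.
  assert (Hw : Cmod w = Rabs d).
  { unfold w. rewrite Cmod_mult, Cmod_opp, Cmod_Ci, Cmod_R. ring. }
  (* The exact increment of the exponent between th and th'. Replacing e^w - 1 by w gives the linear
     part, which is that of [rotd]; the remainders of e^v and e^w are all that is left. *)
  set (v := (z * w - y * u * (Cexp w - 1))%C).
  assert (Er : rot z th' y = (rot z th y * Cexp v)%C).
  { unfold rot. rewrite <- (Cmult_assoc (Rcpow y (z - 1))), <- Cexp_plus. do 2 f_equal.
    replace (- Ci * th')%C with (- Ci * th + w)%C.
    2:{ unfold w, d. rewrite RtoC_minus. ring. }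
    rewrite Cexp_plus. fold u. unfold v.
    replace (RtoC th') with (th + d)%C by (unfold d; rewrite RtoC_minus; ring).
    unfold w. ring. }
  assert (Ed : (rot z th' y - rot z th y - d * rotd z th y)%C =
    (rot z th y * ((Cexp v - 1 - v) + - (y * u * (Cexp w - 1 - w))))%C).
  { rewrite Er. unfold rotd, v. fold u. unfold w. ring. }
  assert (He1 : exp (Rabs d) <= exp 1) by (apply exp_le_compat; lra).
  assert (Hd0 := Rabs_pos d). assert (Hep := exp_pos (Rabs d)).
  assert (Hv : Cmod v <= Rabs d * V).
  { unfold v. eapply Rle_trans. apply Cmod_minus_le.
    rewrite !Cmod_mult, Hu, Hw, Cmod_R, (Rabs_pos_eq y) by lra.
    assert (H1 := Cmod_Cexp_sub_1 w). rewrite Hw in H1.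
    unfold V.
    assert (y * 1 * Cmod (Cexp w - 1)%C <= b * (Rabs d * exp 1)).
    { apply Rmult_le_compat; try lra. apply Cmod_ge_0. nra. }
    nra. }
  assert (H2 := Cmod_Cexp_sub_1_sub v). assert (H3 := Cmod_Cexp_sub_1_sub w). rewrite Hw in H3.
  rewrite Ed, Cmod_mult. unfold W. rewrite Rmult_assoc.
  apply Rmult_le_compat. apply Cmod_ge_0. apply Cmod_ge_0. apply HQ, Hy.
  eapply Rle_trans. apply Cmod_triangle. rewrite Cmod_opp, !Cmod_mult, Hu, Cmod_R, (Rabs_pos_eq y) by lra.
  rewrite Rmult_plus_distr_r. apply Rplus_le_compat.
  + eapply Rle_trans. apply H2. assert (Hv0 := Cmod_ge_0 v).
    replace (V ^ 2 * exp V * d ^ 2) with ((Rabs d * V) ^ 2 * exp V).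
    2:{ rewrite Rpow_mult_distr, pow2_abs. ring. }
    apply Rmult_le_compat. nra. left; apply exp_pos. apply pow_incr; lra.
    apply exp_le_compat. nra.
  + rewrite pow2_abs in H3.
    assert (0 <= d ^ 2) by nra.
    assert (y * 1 * Cmod (Cexp w - 1 - w)%C <= b * (d ^ 2 * exp 1)).
    { apply Rmult_le_compat; try lra. apply Cmod_ge_0. nra. }
    lra.
Qed.

Lemma Cmod_rot'_le (z : C) (th y : R) : Rabs th <= 2 ->
  Cmod (rot' z th y) <= Rpower y (Re z) * exp (2 * Cmod z) * exp (- (y * cos th)).
Proof.
intros Hth. unfold rot'. rewrite !Cmod_mult, Cmod_opp, Cmod_Ci, Cmod_Rcpow, Rmult_1_l, Rmult_assoc.
apply Rmult_le_compat_l. left; apply exp_pos. apply Cmod_rot_exp, Hth.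
Qed.

Lemma Ccont_rot'_th (z : C) (y th : R) : Ccont (fun th => rot' z th y) th.
Proof.
apply Ccont_mult. apply Ccont_const.
eapply Ccont_Cder. apply Cder_Cexp, Cder_minus. apply Cder_scal, Cder_id.
apply Cder_scal, Cder_Cexp, Cder_scal, Cder_id.
Qed.

(** Jordan's lemma. On the outer arc cos th >= (pi/2 - th) / 3, and the exponential integrates to at
    most 3 / b; on the inner arc it is at most 1 and the angle at most 2. *)
Lemma rot_diff_le (z : C) (a b : R) : 0 < a <= b ->
  Cmod (CInt (rot z (PI / 2)) a b - CInt (rot z 0) a b)%C
   <= exp (2 * Cmod z) * (3 * (Rpower b (Re z) / b) + 2 * Rpower a (Re z)).
Proof.
intros Hab. assert (HP := PI_RGT_0). assert (HP4 := PI_4).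
assert (Hc : forall y, Ccont_on (fun th => rot' z th y) 0 (PI / 2)) by (intros y th _; apply Ccont_rot'_th).
rewrite <- (CInt_Cder (fun th => CInt (rot z th) a b) (fun th => rot' z th b - rot' z th a)%C).
2: lra.
2:{ intros th Hth. apply Cder_rot_int. exact Hab. apply Rabs_le; lra. }
2:{ intros th Hth. apply Ccont_minus; apply Ccont_rot'_th. }
rewrite CInt_minus by (try lra; apply Hc).
eapply Rle_trans. apply Cmod_minus_le. rewrite Rmult_plus_distr_l. apply Rplus_le_compat.
- set (K := Rpower b (Re z) * exp (2 * Cmod z)).
  assert (HK : 0 < K) by (apply Rmult_lt_0_compat; apply exp_pos).
  apply Rle_trans with (K * (3 / b) * exp (- (b * (PI / 2 - PI / 2) / 3)) - K * (3 / b) * exp (- (b * (PI / 2 - 0) / 3))).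
  + apply (Cmod_is_CInt_prim (fun th => rot' z th b) (fun th => K * (3 / b) * exp (- (b * (PI / 2 - th) / 3)))
      (fun th => K * exp (- (b * (PI / 2 - th) / 3)))).
    * lra.
    * intros th _. auto_derive. exact I.
      match goal with |- context [exp ?u] => replace u with (- (b * (PI / 2 - th) / 3)) by field end.
      field. lra.
    * intros th _. apply @ex_derive_continuous. auto_derive. exact I.
    * intros th Hth. eapply Rle_trans. apply Cmod_rot'_le. apply Rabs_le; lra. fold K.
      apply Rmult_le_compat_l. lra. apply exp_le_compat.
      assert (H := sin_ge_third (PI / 2 - th) ltac:(lra)). rewrite sin_shift in H. nra.
    * apply is_CInt_cont. lra. apply Hc.
  + assert (0 < K * (3 / b) * exp (- (b * (PI / 2 - 0) / 3))).
    { apply Rmult_lt_0_compat; [|apply exp_pos]. apply Rmult_lt_0_compat. exact HK. apply Rdiv_lt_0_compat; lra. }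
    replace (PI / 2 - PI / 2) with 0 by ring. replace (- (b * 0 / 3)) with 0 by field. rewrite exp_0.
    unfold K in *. unfold Rdiv in *. lra.
- eapply Rle_trans. apply (Cmod_CInt_const _ 0 (PI / 2) (Rpower a (Re z) * exp (2 * Cmod z))).
  lra. apply Hc.
  intros th Hth. eapply Rle_trans. apply Cmod_rot'_le. apply Rabs_le; lra.
  apply Rle_trans with (Rpower a (Re z) * exp (2 * Cmod z) * 1); [|lra]. apply Rmult_le_compat_l.
  left; apply Rmult_lt_0_compat; apply exp_pos.
  rewrite <- exp_0. apply exp_le_compat. assert (0 <= cos th) by (apply cos_ge_0; lra). nra.
  assert (0 < Rpower a (Re z) * exp (2 * Cmod z)) by (apply Rmult_lt_0_compat; apply exp_pos). nra.
Qed.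

(** With p = Re z the arcs contribute O(b^(p - 1)) and O(a^p), which vanish because 0 < p < 1. At th
    = pi/2 the ray integrand is e^(-i pi z / 2) y^(z - 1) e^(i y). *)
Lemma gam_rotate (z l : C) : 0 < Re z < 1 -> Clim F0 (pint (gam z)) l ->
  Clim F0 (pint (fun y => Rcpow y (z - 1) * Cexp (Ci * y))%C) (Cexp (Ci * PI / 2 * z) * l)%C.
Proof.
intros Hz Hl. assert (HP := PI_RGT_0).
assert (H1 : Clim F0 (pint (rot z (PI / 2))) l).
{ apply (Clim_ext F0 (fun ab => (pint (rot z (PI / 2)) ab - pint (gam z) ab) + pint (gam z) ab)%C).
  apply filter_forall. intros ab. ring.
  rewrite <- (Cplus_0_l l). apply (Clim_plus F0); [|exact Hl].
  intros eps He.
  set (K := exp (2 * Cmod z)). assert (HK : 0 < K) by apply exp_pos.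
  destruct (Rpower_small (Re z) (eps / (4 * K)) ltac:(lra) ltac:(apply Rdiv_lt_0_compat; lra)) as [a0 [Ha0 Hs]].
  destruct (Rpower_small (1 - Re z) (eps / (6 * K)) ltac:(lra) ltac:(apply Rdiv_lt_0_compat; lra)) as [b0 [Hb0 Hb]].
  apply F0_intro with a0 (/ b0). lra. intros a b Ha Hb' Hab. unfold pint; cbn [fst snd].
  assert (E : CInt (gam z) a b = CInt (rot z 0) a b).
  { apply CInt_ext. lra. intros x Hx. unfold gam, rot. f_equal.
    replace (- Ci * z * 0 - x * Cexp (- Ci * 0))%C with (RtoC (- x)). symmetry; apply Cexp_RtoC.
    rewrite Cmult_0_r, (Cmult_0_r (- Ci)), Cexp_0, RtoC_opp. ring. }
  rewrite E, Cminus_0_r. eapply Rle_lt_trans. apply rot_diff_le. lra. fold K.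
  assert (Hbi : 0 < / b < b0).
  { assert (0 < / b0) by (apply Rinv_0_lt_compat; lra). split. apply Rinv_0_lt_compat; lra.
    rewrite <- (Rinv_inv b0). apply Rinv_lt_contravar. nra. lra. }
  assert (H2 := Hb _ Hbi). assert (H3 := Hs a Ha).
  replace (Rpower (/ b) (1 - Re z)) with (Rpower b (Re z) / b) in H2.
  2:{ assert (Hb3 : 0 < b) by lra. unfold Rdiv. rewrite <- (Rpower_1 b Hb3) at 2. rewrite <- Rpower_Ropp, <- Rpower_plus.
      unfold Rpower. rewrite ln_Rinv by lra. f_equal. ring. }
  assert (H4 : K * (3 * (Rpower b (Re z) / b)) < eps / 2).
  { replace (eps / 2) with (K * (3 * (eps / (6 * K)))) by (field; lra).
    apply Rmult_lt_compat_l. lra. lra. }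
  assert (H5 : K * (2 * Rpower a (Re z)) < eps / 2).
  { replace (eps / 2) with (K * (2 * (eps / (4 * K)))) by (field; lra).
    apply Rmult_lt_compat_l. lra. lra. }
  lra. }
apply (Clim_ext F0 (fun ab => Cexp (Ci * PI / 2 * z) * pint (rot z (PI / 2)) ab)%C).
2: apply (Clim_scal F0), H1.
apply F0_intro with 1 1. lra. intros a b Ha Hb Hab. unfold pint; cbn [fst snd].
rewrite <- CInt_scal. 2: lra. 2: intros x Hx; apply Ccont_rot; lra.
apply CInt_ext. lra. intros x Hx. unfold rot.
replace (Cexp (- Ci * RtoC (PI / 2))) with (- Ci)%C.
2:{ unfold Cexp; simpl. replace (-0 * (PI / 2) - - (1) * 0) with 0 by ring.
    replace (-0 * 0 + - (1) * (PI / 2)) with (- (PI / 2)) by ring.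
    rewrite exp_0, cos_neg, sin_neg, cos_PI2, sin_PI2. apply Ceq; simpl; ring. }
rewrite Cmult_assoc, (Cmult_comm (Cexp (Ci * PI / 2 * z))), <- Cmult_assoc. f_equal.
rewrite <- Cexp_plus. f_equal. rewrite RtoC_div by lra. field.
Qed.

(** * Gamma in the strip and oscillatory integrals over the half-line *)

Lemma Gamma_integral_lim (z l : C) : Clim F0 (pint (gam z)) l -> Gamma_integral z = l.
Proof.
intros H. unfold Gamma_integral.
apply (is_RInt_gen_unique (V := C_R_CompleteNormedModule)).
intros P HP.
assert (H1 := proj1 (Clim_filterlim F0 (pint (gam z)) l) H P HP).
unfold filtermapi. unfold filtermap in H1.
assert (Hp : F0 (fun ab => 0 < fst ab <= snd ab)).
{ apply F0_intro with 1 1. lra. intros a b Ha Hb Hab; simpl; lra. }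
generalize (filter_and _ _ H1 Hp). apply filter_imp. intros ab [H2 H3].
exists (pint (gam z) ab). split; [|exact H2].
apply (is_CInt_cont (gam z)). apply H3. apply Ccont_on_gam, H3.
Qed.

Lemma Gamma_lim (z : C) : 0 < Re z < 1 -> Clim F0 (pint (gam z)) (Gamma z).
Proof.
intros Hz. destruct (gam_ex z Hz) as [l Hl].
replace (Gamma z) with l. exact Hl.
(* In the strip -1 < - Re z < 0, so the shift in [Gamma] is 0 and Euler's integral itself
   remains. *)
unfold Gamma. replace (up (- Re z)) with 0%Z.
2:{ apply tech_up; simpl; lra. }
simpl. rewrite Cplus_0_r, (Gamma_integral_lim z l Hl). field.
Qed.

Lemma Gamma_conj (z : C) : 0 < Re z < 1 -> Gamma (Cconj z) = Cconj (Gamma z).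
Proof.
intros Hz. apply (Clim_unique F0 (pint (gam (Cconj z)))).
- apply Gamma_lim. exact Hz.
- apply (Clim_ext F0 (fun ab => Cconj (pint (gam z) ab))).
  + apply F0_intro with 1 1. lra. intros a b Ha Hb Hab. unfold pint; cbn [fst snd].
    rewrite <- CInt_conj. 2: lra. 2: apply Ccont_on_gam; lra.
    apply CInt_ext. lra. intros x _. unfold gam.
    rewrite Cmult_conj, RtoC_conj, <- Rcpow_conj, Cminus_conj, RtoC_conj. reflexivity.
  + apply (Clim_conj F0). apply Gamma_lim, Hz.
Qed.

Lemma pint_osc_1_lim (s : C) : 0 < Re s < 1 ->
  Clim F0 (pint (osc s 1)) (Cexp (Ci * PI / 2 * (1 - s)) * Gamma (1 - s))%C.
Proof.
intros Hs. assert (Hz : 0 < Re (1 - s)%C < 1) by (simpl; unfold Re in Hs; lra).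
apply (Clim_ext F0 _ _ _) with (2 := gam_rotate (1 - s)%C _ Hz (Gamma_lim _ Hz)).
apply F0_intro with 1 1. lra. intros a b Ha Hb Hab. unfold pint; cbn [fst snd].
apply CInt_ext. lra. intros x _. unfold osc. rewrite Rmult_1_l. do 2 f_equal. ring.
Qed.

Lemma F0_scale (l : R) : 0 < l -> filterlim (fun ab => (l * fst ab, l * snd ab)) F0 F0.
Proof.
intros Hl P HP. destruct HP as [Q R HQ HR H].
destruct HQ as [d Hd]. destruct HR as [M HM].
unfold filtermap.
apply F0_intro with (d / l) (M / l). apply Rdiv_lt_0_compat. apply cond_pos. exact Hl.
intros a b Ha Hb Hab. cbn [fst snd]. apply H.
- apply Hd.
  + unfold ball; simpl; unfold AbsRing_ball, abs, minus, plus, opp; simpl.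
    rewrite Rabs_pos_eq by nra. apply Rmult_lt_reg_r with (/ l). apply Rinv_0_lt_compat, Hl.
    replace ((l * a + - 0) * / l) with a by (field; lra). apply Ha.
  + nra.
- apply HM. apply Rmult_lt_reg_r with (/ l). apply Rinv_0_lt_compat, Hl.
  replace (l * b * / l) with b by (field; lra). exact Hb.
Qed.

Lemma pint_osc_lim (s : C) (l : R) : 0 < Re s < 1 -> 0 < l ->
  Clim F0 (pint (osc s l)) (Rcpow l (s - 1) * (Cexp (Ci * PI / 2 * (1 - s)) * Gamma (1 - s)))%C.
Proof.
intros Hs Hl.
apply (Clim_ext F0 (fun ab => Rcpow l (s - 1) * pint (osc s 1) (l * fst ab, l * snd ab)%R)%C).
2: apply (Clim_scal F0), (Clim_comp F0 F0 _ _ _ (F0_scale l Hl)), pint_osc_1_lim, Hs.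
apply F0_intro with 1 1. lra. intros a b Ha Hb Hab. unfold pint; cbn [fst snd].
assert (H : is_CInt (fun y => l * osc s 1 (l * y + 0)%R)%C a b (CInt (osc s 1) (l * a) (l * b))).
{ apply is_CInt_comp_lin. rewrite !Rplus_0_r. apply is_CInt_cont. nra. apply Ccont_on_osc. nra. }
apply (is_CInt_scal (Rcpow l (s - 1))) in H. apply is_CInt_unique in H. rewrite <- H.
apply CInt_ext. lra. intros x Hx. unfold osc. rewrite Rplus_0_r, Rmult_1_l.
rewrite Rcpow_mult by lra.
transitivity (Rcpow l (s - 1) * (l * Rcpow l (- s)) * (Rcpow x (- s) * Cexp (Ci * RtoC (l * x))))%C. ring.
replace (Rcpow l (s - 1) * (l * Rcpow l (- s)))%C with (RtoC 1). ring.
rewrite <- (Rcpow_1 l) by exact Hl. rewrite <- !Rcpow_plus.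
replace (s - 1 + (1 + - s))%C with (RtoC 0) by ring. symmetry. apply Rcpow_0.
Qed.

(* There is no stationary point in [(0, 1)] when [l < t]. *)
Lemma osc_tail_value (sigma t l : R) (A : C) : 0 < sigma < 1 -> 0 < l < t ->
  Clim eventually (fun m => CInt (osc (sigma, t) l) 1 (INR m + 1)) A ->
  Cmod (A - Rcpow l ((sigma, t) - 1) * (Cexp (Ci * PI / 2 * (1 - (sigma, t))) * Gamma (1 - (sigma, t))))%C
   <= 2 / (t - l).
Proof.
intros Hs Hl HA. set (s := (sigma, t) : C) in *.
set (L := (Rcpow l (s - 1) * (Cexp (Ci * PI / 2 * (1 - s)) * Gamma (1 - s)))%C).
assert (HL : Clim F0 (pint (osc s l)) L) by (apply pint_osc_lim; [exact Hs|lra]).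
apply le_epsilon. intros eps He.
assert (He2 : 0 < eps / 2) by lra.
destruct (HL _ He2) as [Q R HQ HR H].
destruct HQ as [d Hd]. destruct HR as [M HM].
set (a := Rmin (d / 2) 1).
assert (Ha : 0 < a) by (apply Rmin_glb_lt; generalize (cond_pos d); lra).
assert (Ha1 : a <= 1) by apply Rmin_r. assert (Had : a <= d / 2) by apply Rmin_l.
assert (HQa : Q a).
{ apply Hd; [|exact Ha]. unfold ball; simpl; unfold AbsRing_ball, abs, minus, plus, opp; simpl.
  rewrite Rabs_pos_eq by lra. generalize (cond_pos d); lra. }
destruct (HA _ He2) as [m0 Hm0].
destruct (nfloor_ex (Rmax M 0) (Rmax_r M 0)) as [n1 [_ Hn1]].
set (m := Nat.max m0 n1).
assert (Hm1 : INR n1 <= INR m) by (apply le_INR; unfold m; lia).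
assert (HMm : M < INR m + 1) by (generalize (Rmax_l M 0); lra).
assert (H1 := Hm0 m ltac:(unfold m; lia)).
assert (H2 := H a (INR m + 1) HQa (HM _ HMm)). unfold pint in H2; cbn [fst snd] in H2.
assert (Hmp := pos_INR m).
rewrite (CInt_Chasles (osc s l) a 1) in H2 by (try lra; apply Ccont_on_osc; lra).
assert (H3 : Cmod (CInt (osc s l) a 1) <= 2 / (t - l)).
{ eapply Rle_trans. apply osc_below; try lra.
  unfold Rpower. rewrite ln_1, Rmult_0_r, exp_0, Rmult_1_r, (Rmult_1_r l). apply Rle_refl. }
set (B := CInt (osc s l) 1 (INR m + 1)) in *. set (D := CInt (osc s l) a 1) in *.
replace (A - L)%C with (- (B - A) + ((D + B - L) - D))%C by ring.
eapply Rle_trans. apply Cmod_triangle. rewrite Cmod_opp.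
generalize (Cmod_minus_le (D + B - L) D). lra.
Qed.

(** * The factor in the functional equation *)

(** The size of Gamma(1 - s) is read off J, the integral of x^(-s) e^(i x) over (0, oo), cut at t -
    sqrt t and t + sqrt t: first derivative bounds outside, the trivial bound inside. |J| carries a
    factor e^(pi t / 2), which absorbs the growth of the sine. *)
Lemma chi_modulus (sigma t : R) : 0 < sigma < 1 -> 4 <= t ->
  Cmod (chi (sigma, t)) <= 20 * Rpower t (1 / 2 - sigma).
Proof.
intros Hs Ht. set (s := (sigma, t) : C). assert (HP := PI_RGT_0). assert (HP4 := PI_4).
set (J := (Cexp (Ci * PI / 2 * (1 - s)) * Gamma (1 - s))%C).
set (r := sqrt t).
assert (Hr : r * r = t) by (apply sqrt_sqrt; lra).
assert (Hr2 : 2 <= r).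
{ unfold r. rewrite <- (sqrt_square 2) by lra. apply sqrt_le_1; lra. }
assert (Hrt : r <= t / 2) by nra.
set (T := Rpower t (1 / 2 - sigma)).
assert (HT : 0 < T) by apply exp_pos.
assert (HTr : T = r * Rpower t (- sigma)).
{ unfold T, Rminus. rewrite Rpower_plus. unfold r.
  replace (1 / 2) with (/ 2) by field. rewrite Rpower_sqrt by lra. reflexivity. }
assert (HTt : Rpower t (1 - sigma) = r * T).
{ rewrite HTr, <- Rmult_assoc, Hr. unfold Rminus. rewrite Rpower_plus, Rpower_1 by lra. reflexivity. }
assert (H2s : forall p, 0 <= p <= 1 -> Rpower 2 p <= 2).
{ intros p Hp. rewrite <- (Rpower_1 2) at 2 by lra. apply Rle_Rpower; lra. }
(* 2 T comes from the left part, 4 T from the middle and 4 T from the right part. *)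
assert (HJ : Cmod J <= 10 * T).
{ apply (Clim_Cmod_le F0 (pint (osc s 1))). apply pint_osc_1_lim. exact Hs.
  apply F0_intro with (t - r) (t + r). lra. intros a b Ha Hb Hab. unfold pint; cbn [fst snd].
  assert (Hc : forall c d, 0 < c -> Ccont_on (osc s 1) c d) by (intros; apply Ccont_on_osc; auto).
  rewrite (CInt_Chasles _ a (t - r) b), (CInt_Chasles _ (t - r) (t + r) b) by (try lra; apply Hc; lra).
  assert (H1 : Cmod (CInt (osc s 1) a (t - r)) <= 2 * T).
  { eapply Rle_trans. apply osc_below; lra.
    replace (t - 1 * (t - r)) with r by ring.
    apply Rmult_le_reg_r with r. lra. unfold Rdiv. rewrite Rmult_assoc, Rinv_l, Rmult_1_r by lra.
    rewrite Rmult_assoc, (Rmult_comm T), <- HTt. apply Rmult_le_compat_l. lra.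
    apply Rle_Rpower_l; lra. }
  assert (H3 : Cmod (CInt (osc s 1) (t + r) b) <= 4 * T).
  { eapply Rle_trans. apply osc_above; lra.
    replace (1 * (t + r) - t) with r by ring.
    apply Rmult_le_reg_r with r. lra. unfold Rdiv. rewrite Rmult_assoc, Rinv_l, Rmult_1_r by lra.
    rewrite Rmult_assoc, (Rmult_comm T), <- HTt.
    apply Rle_trans with (2 * Rpower (2 * t) (1 - sigma)).
    apply Rmult_le_compat_l. lra. apply Rle_Rpower_l; lra.
    rewrite Rpower_mult_distr || rewrite <- Rpower_mult_distr by lra.
    assert (0 < Rpower t (1 - sigma)) by apply exp_pos. generalize (H2s (1 - sigma) ltac:(lra)). nra. }
  assert (H4 : Cmod (CInt (osc s 1) (t - r) (t + r)) <= 4 * T).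
  { eapply Rle_trans. apply (Cmod_CInt_const _ _ _ (2 * Rpower t (- sigma))). lra. apply Hc; lra.
    intros x Hx. rewrite Cmod_osc. simpl Re.
    apply Rle_trans with (Rpower (t / 2) (- sigma)). apply Rpower_opp_le; lra.
    replace (t / 2) with (t * / 2) by reflexivity. rewrite <- Rpower_mult_distr by lra.
    replace (Rpower (/ 2) (- sigma)) with (Rpower 2 sigma).
    assert (0 < Rpower t (- sigma)) by apply exp_pos. generalize (H2s sigma ltac:(lra)). nra.
    unfold Rpower. rewrite ln_Rinv by lra. f_equal. ring.
    right. rewrite HTr. ring. }
  generalize (Cmod_triangle (CInt (osc s 1) a (t - r)) (CInt (osc s 1) (t - r) (t + r) + CInt (osc s 1) (t + r) b)).
  generalize (Cmod_triangle (CInt (osc s 1) (t - r) (t + r)) (CInt (osc s 1) (t + r) b)). lra. }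
unfold chi. fold s.
assert (HmJ : Cmod J = exp (PI * t / 2) * Cmod (Gamma (1 - s))).
{ unfold J. rewrite Cmod_mult, Cmod_Cexp. f_equal. f_equal.
  replace (Ci * PI / 2 * (1 - s))%C with (RtoC (PI / 2) * (Ci * (1 - s)))%C.
  rewrite re_scal_l. simpl. field. rewrite RtoC_div by lra. field. }
assert (Hsin : Cmod (Csin (PI * s / 2)) <= exp (PI * t / 2)).
{ unfold Csin. rewrite Cmod_div.
  2:{ intros E. apply (f_equal Im) in E. simpl in E. lra. }
  rewrite Cmod_mult, Cmod_Ci, Cmod_R, Rabs_pos_eq, Rmult_1_r by lra.
  assert (E : (Ci * (PI * s / 2))%C = (RtoC (PI / 2) * (Ci * s))%C) by (rewrite RtoC_div by lra; field).
  rewrite E.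
  apply Rmult_le_reg_r with 2. lra. unfold Rdiv at 1. rewrite Rmult_assoc, Rinv_l, Rmult_1_r by lra.
  eapply Rle_trans. apply Cmod_minus_le. rewrite !Cmod_Cexp, re_opp, re_scal_l.
  replace (- (PI / 2 * Re (Ci * s)%C)) with (PI * t / 2) by (simpl; field).
  replace (PI / 2 * Re (Ci * s)%C) with (- (PI * t / 2)) by (simpl; field).
  assert (exp (- (PI * t / 2)) <= exp (PI * t / 2)) by (apply exp_le_compat; nra). lra. }
rewrite !Cmod_mult, !Cmod_Rcpow.
replace (Re s) with sigma by reflexivity.
replace (Re (s - 1)%C) with (- (1 - sigma)) by (simpl; ring).
assert (HPp : Rpower PI (- (1 - sigma)) <= 1).
{ apply Rle_trans with (Rpower 1 (- (1 - sigma))). apply Rpower_opp_le; [lra|]. generalize PI2_1; lra.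
  unfold Rpower; rewrite ln_1, Rmult_0_r, exp_0; lra. }
assert (HPp0 : 0 < Rpower PI (- (1 - sigma))) by apply exp_pos.
assert (H2p0 : 0 < Rpower 2 sigma) by apply exp_pos.
assert (H2p := H2s sigma ltac:(lra)).
assert (HGs : Cmod (Csin (PI * s / 2)) * Cmod (Gamma (1 - s)) <= 10 * T).
{ eapply Rle_trans; [|apply HJ]. rewrite HmJ. apply Rmult_le_compat_r. apply Cmod_ge_0. exact Hsin. }
assert (HG0 : 0 <= Cmod (Csin (PI * s / 2)) * Cmod (Gamma (1 - s))) by (apply Rmult_le_pos; apply Cmod_ge_0).
replace (20 * T) with (2 * 1 * (10 * T)) by ring.
rewrite Rmult_assoc.
apply Rmult_le_compat; auto. nra. nra.
Qed.

(** This is chi(s) times 2 (2 pi)^(-s) cos(pi s / 2) Gamma(s) = 1. The cosine is written as e^(-i pi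
    s / 2) (1 + e^(i pi s)) / 2 because e^(i pi s) is exponentially small for large t. *)
Lemma chi_reflection (s : C) : 0 < Re s < 1 -> 0 < Im s ->
  (chi s * (Rcpow (2 * PI) (- s) * (Gamma s * Cexp (- (Ci * PI / 2 * s)))) * (1 + Cexp (Ci * PI * s)) = 1)%C.
Proof.
intros Hs Ht. assert (HP := PI_RGT_0).
assert (Hs' : 0 < Re (1 - s)%C < 1) by (simpl; unfold Re in Hs; lra).
assert (HR := gamma_reflection s (Gamma s) (Gamma (1 - s)) Hs (Gamma_lim s Hs) (Gamma_lim _ Hs')).
set (E := Cexp (Ci * PI / 2 * s)).
assert (HE : E <> 0) by apply Cexp_neq_0.
assert (E2 : Cexp (Ci * PI * s) = (E * E)%C).
{ unfold E. rewrite <- Cexp_plus. f_equal. field. }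
assert (HEm : Cmod (E * E)%C < 1).
{ rewrite <- E2, Cmod_Cexp. rewrite <- exp_0. apply exp_increasing.
  replace (Ci * PI * s)%C with (PI * (Ci * s))%C by ring. rewrite re_scal_l. simpl. unfold Im in Ht. nra. }
rewrite (Cexp_opp (Ci * PI / 2 * s)). fold E.
rewrite Cexp_opp, E2 in HR. rewrite E2.
unfold chi, Csin.
replace (Ci * (PI * s / 2))%C with (Ci * PI / 2 * s)%C by field.
rewrite Cexp_opp. fold E.
assert (H1 : (E * E - 1)%C <> 0).
{ intros E0. apply (Rlt_irrefl 1). replace 1 with (Cmod (E * E)) at 1. exact HEm.
  replace (E * E)%C with (E * E - 1 + 1)%C by ring. rewrite E0, Cplus_0_l. apply Cmod_1. }
assert (HPc : RtoC PI <> 0) by (intros E0; apply RtoC_inj in E0; lra).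
assert (H2 : (Rcpow 2 s * Rcpow PI (s - 1) * Rcpow (2 * PI) (- s) = / PI)%C).
{ rewrite Rcpow_mult, !Rcpow_opp by lra. unfold Cminus. rewrite Rcpow_plus, Rcpow_opp, Rcpow_1 by lra.
  field. repeat split; try assumption; apply Rcpow_neq_0. }
transitivity ((Rcpow 2 s * Rcpow PI (s - 1) * Rcpow (2 * PI) (- s)) * ((E - / E) / (2 * Ci))
   * (Gamma s * Gamma (1 - s)) * / E * (1 + E * E))%C.
{ field. repeat split; try assumption. apply Ci_nz. }
rewrite H2.
transitivity (/ (2 * Ci * PI) * (Gamma s * Gamma (1 - s) * (E * E - / (E * E))))%C.
{ field. repeat split; try assumption. apply Ci_nz. }
rewrite HR. field. split. assumption. apply Ci_nz.
Qed.

(** * Finite sums *)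

(** The index runs over k < n from 0; hence the shifts k + 1 in [freq] and [hsum]. *)
Fixpoint Csm (u : nat -> C) (n : nat) : C :=
  match n with O => RtoC 0 | S k => (Csm u k + u k)%C end.

Lemma Csm_sum_n (u : nat -> C) (n : nat) : @sum_n C_AbelianMonoid u n = Csm u (S n).
Proof.
induction n as [|n IH].
- rewrite sum_O. simpl. ring.
- rewrite sum_Sn, IH. reflexivity.
Qed.

Lemma Csm_ext (u v : nat -> C) (n : nat) : (forall k, (k < n)%nat -> u k = v k) -> Csm u n = Csm v n.
Proof.
induction n as [|n IH]; intros H; simpl. reflexivity.
rewrite IH by (intros; apply H; lia). rewrite H by lia. reflexivity.
Qed.

Lemma Csm_plus (u v : nat -> C) (n : nat) : Csm (fun k => u k + v k)%C n = (Csm u n + Csm v n)%C.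
Proof. induction n as [|n IH]; simpl. ring. rewrite IH. ring. Qed.

Lemma Csm_minus (u v : nat -> C) (n : nat) : Csm (fun k => u k - v k)%C n = (Csm u n - Csm v n)%C.
Proof. induction n as [|n IH]; simpl. ring. rewrite IH. ring. Qed.

Lemma Csm_scal (c : C) (u : nat -> C) (n : nat) : Csm (fun k => c * u k)%C n = (c * Csm u n)%C.
Proof. induction n as [|n IH]; simpl. ring. rewrite IH. ring. Qed.

Lemma Csm_conj (u : nat -> C) (n : nat) : Cconj (Csm u n) = Csm (fun k => Cconj (u k)) n.
Proof. induction n as [|n IH]; simpl. apply RtoC_conj. rewrite Cplus_conj, IH. reflexivity. Qed.

(** v is a discrete primitive of the bounds on the terms, so the right-hand side telescopes. *)
Lemma Csm_Cmod_le (u : nat -> C) (v : nat -> R) (n : nat) :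
  (forall k, (k < n)%nat -> Cmod (u k) <= v (S k) - v k) -> Cmod (Csm u n) <= v n - v O.
Proof.
induction n as [|n IH]; intros H; simpl. rewrite Cmod_0; lra.
eapply Rle_trans. apply Cmod_triangle.
generalize (IH ltac:(intros; apply H; lia)) (H n ltac:(lia)). lra.
Qed.

Lemma Csm_Clim {T : Type} (F : (T -> Prop) -> Prop) {FF : Filter F} (u : T -> nat -> C) (l : nat -> C) (n : nat) :
  (forall k, (k < n)%nat -> Clim F (fun x => u x k) (l k)) -> Clim F (fun x => Csm (u x) n) (Csm l n).
Proof.
induction n as [|n IH]; intros H; simpl. apply (Clim_const F).
apply (Clim_plus F). apply IH. intros; apply H; lia. apply H; lia.
Qed.

Lemma Clim_shift (u : nat -> C) (l : C) : Clim eventually (fun n => u (S n)) l <-> Clim eventually u l.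
Proof.
split; intros H eps He; destruct (H eps He) as [N HN].
- exists (S N). intros n Hn. destruct n as [|n]. lia. apply HN. lia.
- exists N. intros n Hn. apply HN. lia.
Qed.

Lemma is_series_Clim (u : nat -> C) (l : C) :
  @is_series C_AbsRing C_NormedModule u l <-> Clim eventually (Csm u) l.
Proof.
rewrite <- Clim_shift.
assert (E : forall n, @sum_n C_AbelianMonoid u n = Csm u (S n)) by apply Csm_sum_n.
split; intros H.
- apply (Clim_ext eventually (fun n => @sum_n C_AbelianMonoid u n)).
  exists O. intros n _. apply E.
  apply (Clim_filterlim eventually). exact H.
- apply (Clim_filterlim eventually (fun n => @sum_n C_AbelianMonoid u n)).
  apply (Clim_ext eventually (fun n => Csm u (S n))).
  exists O. intros n _. symmetry; apply E. exact H.
Qed.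

(** A total choice of limit, meaningful only for convergent sequences; it lets limits be named as
    functions of a parameter. *)
Definition Cseq_lim (u : nat -> C) : C :=
  (real (Lim_seq (fun n => Re (u n))), real (Lim_seq (fun n => Im (u n)))).

Lemma Cseq_lim_correct (u : nat -> C) : (exists l, Clim eventually u l) -> Clim eventually u (Cseq_lim u).
Proof.
intros [l Hl]. replace (Cseq_lim u) with l. exact Hl.
assert (Hp : forall p : C -> R, (forall z w, Rabs (p z - p w) <= Cmod (z - w)%C) ->
  Lim_seq (fun n => p (u n)) = p l).
{ intros p Hp. apply is_lim_seq_unique. apply is_lim_seq_spec. intros eps.
  destruct (Hl eps (cond_pos eps)) as [N HN]. exists N. intros n Hn.
  eapply Rle_lt_trans. apply Hp. apply HN, Hn. }
unfold Cseq_lim. apply Ceq; cbn [Re Im fst snd]; rewrite Hp; try reflexivity; intros z w.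
apply (re_le_Cmod (z - w)%C). eapply Rle_trans; [|apply Rmax_Cmod]. apply (Rmax_r (Rabs (fst (z - w)%C))).
Qed.

(** * Power series in a real variable *)

Definition psum (a : nat -> C) (h : R) (n : nat) : C := Csm (fun k => a k * RtoC (h ^ k))%C n.

Definition rps (a : nat -> C) (h : R) (l : C) : Prop := Clim eventually (psum a h) l.

(** With q = |h| / r <= 1/2 each term is at most B q^n <= 2 B (q^n - q^(n+1)), which telescopes. *)
Lemma psum_tail (a : nat -> C) (h r B : R) (m n : nat) : 0 < r -> Rabs h <= r / 2 ->
  (forall j, Cmod (a j) * r ^ j <= B) -> (m <= n)%nat ->
  Cmod (psum a h n - psum a h m)%C <= 2 * B * (Rabs h / r) ^ m - 2 * B * (Rabs h / r) ^ n.
Proof.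
intros Hr Hh HB Hmn.
set (q := Rabs h / r).
assert (Hq : 0 <= q <= 1 / 2).
{ assert (Hh0 := Rabs_pos h). unfold q. split.
  apply Rmult_le_pos. exact Hh0. left; apply Rinv_0_lt_compat, Hr.
  apply Rmult_le_reg_r with r. exact Hr. unfold Rdiv at 1. rewrite Rmult_assoc, Rinv_l; lra. }
induction Hmn as [|n Hmn IH].
- replace (psum a h m - psum a h m)%C with (RtoC 0) by ring. rewrite Cmod_0. lra.
- assert (E : psum a h (S n) = (psum a h n + a n * RtoC (h ^ n))%C) by reflexivity.
  rewrite E.
  replace (psum a h n + a n * RtoC (h ^ n) - psum a h m)%C
    with (psum a h n - psum a h m + a n * RtoC (h ^ n))%C by ring.
  eapply Rle_trans. apply Cmod_triangle.
  assert (H1 : Cmod (a n * RtoC (h ^ n))%C <= B * q ^ n).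
  { rewrite Cmod_mult, Cmod_R, <- RPow_abs.
    replace (Rabs h) with (r * q) by (unfold q; field; lra).
    rewrite Rpow_mult_distr, <- Rmult_assoc. apply Rmult_le_compat_r. apply pow_le; lra. apply HB. }
  assert (HB0 : 0 <= B).
  { eapply Rle_trans; [|apply (HB O)]. apply Rmult_le_pos. apply Cmod_ge_0. simpl; lra. }
  assert (0 <= B * q ^ n) by (apply Rmult_le_pos; [exact HB0|apply pow_le; lra]).
  simpl pow. nra.
Qed.

Lemma Clim_bounded (u : nat -> C) (l : C) : Clim eventually u l -> exists B, forall n, Cmod (u n) <= B.
Proof.
intros H. destruct (H 1 ltac:(lra)) as [N HN].
assert (HF : forall M, exists B, forall n, (n < M)%nat -> Cmod (u n) <= B).
{ induction M as [|M [B HB]]. exists 0. intros; lia.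
  exists (Rmax B (Cmod (u M))). intros n Hn.
  destruct (Nat.eq_dec n M) as [->|Hne]. apply Rmax_r.
  eapply Rle_trans; [|apply Rmax_l]. apply HB; lia. }
destruct (HF N) as [B HB].
exists (Rmax B (Cmod l + 1)). intros n.
destruct (Nat.lt_ge_cases n N) as [Hn|Hn].
- eapply Rle_trans; [|apply Rmax_l]. apply HB, Hn.
- eapply Rle_trans; [|apply Rmax_r]. generalize (HN n Hn) (Cmod_le_sub (u n) l). lra.
Qed.

Lemma rps_coef_bound (a : nat -> C) (r : R) (l : C) : 0 < r -> rps a r l ->
  exists B, forall j, Cmod (a j) * r ^ j <= B.
Proof.
intros Hr H. destruct (Clim_bounded _ _ H) as [B HB].
exists (B + B). intros j.
replace (Cmod (a j) * r ^ j) with (Cmod (psum a r (S j) - psum a r j)%C).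
- generalize (Cmod_minus_le (psum a r (S j)) (psum a r j)) (HB j) (HB (S j)). lra.
- replace (psum a r (S j) - psum a r j)%C with (a j * RtoC (r ^ j))%C.
  rewrite Cmod_mult, Cmod_R, Rabs_pos_eq. reflexivity. apply pow_le; lra.
  change (psum a r (S j)) with (psum a r j + a j * RtoC (r ^ j))%C. ring.
Qed.

Lemma rps_tail (a : nat -> C) (h r B : R) (l : C) (m : nat) : 0 < r -> Rabs h <= r / 2 ->
  (forall j, Cmod (a j) * r ^ j <= B) -> rps a h l ->
  Cmod (l - psum a h m)%C <= 2 * B * (Rabs h / r) ^ m.
Proof.
intros Hr Hh HB Hl.
apply (Clim_Cmod_le eventually (fun n => psum a h n - psum a h m)%C).
apply (Clim_minus eventually). exact Hl. apply (Clim_const eventually).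
exists m. intros n Hn. eapply Rle_trans. apply (psum_tail a h r B m n); auto.
assert (HB0 : 0 <= B).
{ eapply Rle_trans; [|apply (HB O)]. apply Rmult_le_pos. apply Cmod_ge_0. simpl; lra. }
assert (0 <= (Rabs h / r) ^ n).
{ apply pow_le. apply Rmult_le_pos. apply Rabs_pos. left; apply Rinv_0_lt_compat, Hr. }
nra.
Qed.

(** At the first coefficient not yet known to vanish, the tail bound gives |a_k| h^k <= 2 B (h /
    q)^(k+1), and h can be made small. Only h > 0 is assumed, since in the identity theorem
    agreement is known on one side. *)
Lemma rps_zero (a : nat -> C) (r : R) : 0 < r -> (forall h, 0 < h < r -> rps a h 0) ->
  forall k, a k = 0.
Proof.
intros Hr H.
destruct (rps_coef_bound a (r / 2) 0 ltac:(lra) (H (r / 2) ltac:(lra))) as [B HB].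
set (q := r / 2) in *. assert (Hq : 0 < q) by (unfold q; lra).
assert (HB0 : 0 <= B).
{ eapply Rle_trans; [|apply (HB O)]. apply Rmult_le_pos. apply Cmod_ge_0. simpl; lra. }
assert (Hps : forall h n, (forall j, (j < n)%nat -> a j = 0) -> psum a h n = 0).
{ intros h n Hn. unfold psum. induction n as [|n IH]; simpl. reflexivity.
  rewrite IH by (intros; apply Hn; lia). rewrite (Hn n) by lia. ring. }
intros k. induction k as [k IH] using (well_founded_induction Wf_nat.lt_wf).
apply Cmod_eq_0. apply Rle_antisym; [|apply Cmod_ge_0].
apply le_epsilon. intros eps He. rewrite Rplus_0_l.
assert (Hqk : 0 < q ^ S k) by (apply pow_lt, Hq).
set (h := Rmin (q / 2) (eps * q ^ S k / (2 * (B + 1)))).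
assert (Hh : 0 < h).
{ apply Rmin_glb_lt. lra. apply Rdiv_lt_0_compat. apply Rmult_lt_0_compat; lra. lra. }
assert (Hh1 : h <= q / 2) by apply Rmin_l.
assert (Hh2 : h <= eps * q ^ S k / (2 * (B + 1))) by apply Rmin_r.
assert (HT := rps_tail a h q B 0 (S k) Hq ltac:(rewrite Rabs_pos_eq; lra) HB (H h ltac:(unfold q in *; lra))).
change (psum a h (S k)) with (psum a h k + a k * RtoC (h ^ k))%C in HT.
rewrite Hps in HT by (intros; apply IH; assumption).
replace (0 - (0 + a k * RtoC (h ^ k)))%C with (- (a k * RtoC (h ^ k)))%C in HT by ring.
rewrite Cmod_opp, Cmod_mult, Cmod_R, Rabs_pos_eq in HT by (apply pow_le; lra).
rewrite Rabs_pos_eq in HT by lra.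
assert (Hhk : 0 < h ^ k) by (apply pow_lt, Hh).
apply Rmult_le_reg_r with (h ^ k). exact Hhk.
eapply Rle_trans. apply HT.
unfold Rdiv. rewrite Rpow_mult_distr, pow_inv. simpl (h ^ S k).
replace (2 * B * (h * h ^ k * / q ^ S k)) with (2 * B * h * / q ^ S k * h ^ k) by ring.
apply Rmult_le_compat_r. lra.
apply Rmult_le_reg_r with (q ^ S k). exact Hqk.
rewrite Rmult_assoc, Rinv_l, Rmult_1_r by lra.
apply Rle_trans with (2 * (B + 1) * h). nra.
apply Rle_trans with (2 * (B + 1) * (eps * q ^ S k / (2 * (B + 1)))).
apply Rmult_le_compat_l; lra. right. field. lra.
Qed.

(** The common coefficient bound makes the tails uniform in m, so partial sums may be passed to the
    limit coefficient by coefficient. *)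
Lemma rps_limit (c : nat -> nat -> C) (a : nat -> C) (d : nat -> C) (l : C) (h r B : R) :
  0 < r -> Rabs h <= r / 2 ->
  (forall m j, Cmod (c m j) * r ^ j <= B) ->
  (forall j, Clim eventually (fun m => c m j) (a j)) ->
  (forall m, rps (c m) h (d m)) -> Clim eventually d l -> rps a h l.
Proof.
intros Hr Hh HB Ha Hd Hl.
apply (Clim_squeeze eventually) with (fun n => 2 * B * (Rabs h / r) ^ n).
- exists O. intros n _. rewrite Cmod_sym.
  apply (Clim_Cmod_le eventually (fun m => d m - psum (c m) h n)%C).
  + apply (Clim_minus eventually). exact Hl. unfold psum.
    apply (Csm_Clim eventually (fun m k => c m k * RtoC (h ^ k))%C (fun k => a k * RtoC (h ^ k))%C).
    intros k _. rewrite Cmult_comm. apply (Clim_ext eventually (fun m => RtoC (h ^ k) * c m k)%C).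
    exists O; intros; ring. apply (Clim_scal eventually), Ha.
  + exists O. intros m _. apply rps_tail; auto.
- assert (Hg : is_lim_seq (fun n => 2 * B * (Rabs h / r) ^ n) (Rbar_mult (2 * B) 0)).
  { apply is_lim_seq_scal_l. apply is_lim_seq_geom.
    assert (Hh0 := Rabs_pos h).
    rewrite Rabs_pos_eq. 2: apply Rmult_le_pos; [lra|left; apply Rinv_0_lt_compat, Hr].
    apply Rmult_lt_reg_r with r. exact Hr. unfold Rdiv. rewrite Rmult_assoc, Rinv_l; lra. }
  simpl in Hg. rewrite Rmult_0_r in Hg. exact Hg.
Qed.

Lemma rps_plus (a b : nat -> C) (h : R) (l m : C) : rps a h l -> rps b h m ->
  rps (fun k => a k + b k)%C h (l + m)%C.
Proof.
intros Ha Hb. apply (Clim_ext eventually (fun n => psum a h n + psum b h n)%C).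
exists O. intros n _. unfold psum. rewrite <- Csm_plus. apply Csm_ext. intros; ring.
apply (Clim_plus eventually); assumption.
Qed.

Lemma rps_minus (a b : nat -> C) (h : R) (l m : C) : rps a h l -> rps b h m ->
  rps (fun k => a k - b k)%C h (l - m)%C.
Proof.
intros Ha Hb. apply (Clim_ext eventually (fun n => psum a h n - psum b h n)%C).
exists O. intros n _. unfold psum. rewrite <- Csm_minus. apply Csm_ext. intros; ring.
apply (Clim_minus eventually); assumption.
Qed.

Lemma rps_scal (c : C) (a : nat -> C) (h : R) (l : C) : rps a h l -> rps (fun k => c * a k)%C h (c * l)%C.
Proof.
intros Ha. apply (Clim_ext eventually (fun n => c * psum a h n)%C).
exists O. intros n _. unfold psum. rewrite <- Csm_scal. apply Csm_ext. intros; ring.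
apply (Clim_scal eventually); assumption.
Qed.

(** Coefficients of h times the series. *)
Definition shift1 (a : nat -> C) (k : nat) : C := match k with O => RtoC 0 | S j => a j end.

Lemma rps_shift (a : nat -> C) (h : R) (l : C) : rps a h l -> rps (shift1 a) h (h * l)%C.
Proof.
intros Ha. apply Clim_shift. apply (Clim_ext eventually (fun n => h * psum a h n)%C).
- exists O. intros n _. unfold psum. induction n as [|n IH].
  + simpl. ring.
  + change (Csm (fun k => shift1 a k * RtoC (h ^ k))%C (S (S n))) with
      (Csm (fun k => shift1 a k * RtoC (h ^ k))%C (S n) + a n * RtoC (h ^ S n))%C.
    rewrite <- IH. simpl (h ^ S n). rewrite RtoC_mult. simpl Csm. ring.
- apply (Clim_scal eventually), Ha.
Qed.

(** * Identity theorem on a horizontal line *)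

Definition ran (F : R -> C) (x : R) : Prop :=
  exists a r, 0 < r /\ forall h, Rabs h < r -> rps a h (F (x + h)).

(** At the supremum x0 of the points of disagreement the two power series agree for h > 0, hence
    have equal coefficients, hence agree to the left of x0 as well, against the choice of x0. *)
Lemma ran_identity (F G : R -> C) :
  (forall x, 0 < x <= 1 -> ran F x) -> (forall x, 0 < x <= 1 -> ran G x) ->
  (forall x, 1 < x -> F x = G x) -> forall x, 0 < x -> F x = G x.
Proof.
intros HF HG H y Hy. destruct (Ceq_dec (F y) (G y)) as [E|E]; [exact E|exfalso].
destruct (completeness (fun x => F x <> G x)) as [x0 [Hub Hlub]].
- exists 1. intros x Hx. destruct (Rle_dec x 1) as [H1|H1]. exact H1. exfalso. apply Hx, H. lra.
- exists y. exact E.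
- assert (Hx0 : y <= x0) by (apply Hub, E).
  assert (Hx1 : x0 <= 1).
  { apply Hlub. intros x Hx. destruct (Rle_dec x 1) as [H1|H1]. exact H1. exfalso. apply Hx, H. lra. }
  destruct (HF x0 ltac:(lra)) as [a [r [Hr Ha]]]. destruct (HG x0 ltac:(lra)) as [b [r' [Hr' Hb]]].
  set (d := Rmin r r'). assert (Hd : 0 < d) by (apply Rmin_glb_lt; assumption).
  assert (Hdr : d <= r) by apply Rmin_l. assert (Hdr' : d <= r') by apply Rmin_r.
  assert (Hab : forall h, Rabs h < d -> rps (fun k => a k - b k)%C h (F (x0 + h)%R - G (x0 + h)%R)%C).
  { intros h Hh. apply rps_minus; [apply Ha|apply Hb]; lra. }
  assert (Hz : forall k, (a k - b k)%C = 0).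
  { apply (rps_zero _ d Hd). intros h Hh.
    replace (RtoC 0) with (F (x0 + h)%R - G (x0 + h)%R)%C. apply Hab. rewrite Rabs_pos_eq; lra.
    destruct (Ceq_dec (F (x0 + h)) (G (x0 + h))) as [E1|E1]. rewrite E1; ring.
    exfalso. generalize (Hub _ E1). lra. }
  assert (Hzero : forall h, Rabs h < d -> F (x0 + h) = G (x0 + h)).
  { intros h Hh. apply Ceq_minus. apply (Clim_unique eventually _ _ _ (Hab h Hh)).
    apply (Clim_ext eventually (fun _ => RtoC 0)); [|apply (Clim_const eventually)].
    exists O. intros n _. unfold psum. induction n as [|n IH]; simpl. reflexivity.
    rewrite <- IH, Hz. ring. }
  assert (Hc : is_upper_bound (fun x => F x <> G x) (x0 - d / 2)).
  { intros x Hx. destruct (Rle_dec x (x0 - d / 2)) as [H1|H1]. exact H1. exfalso.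
    assert (x <= x0) by (apply Hub, Hx).
    apply Hx. replace x with (x0 + (x - x0)) by ring. apply Hzero. apply Rabs_def1; lra. }
  generalize (Hlub _ Hc). lra.
Qed.

Lemma ran_analytic (f : C -> C) (x t : R) : analytic_at f (x, t) -> ran (fun u => f (u, t)) x.
Proof.
intros [a [r Hr]]. exists a, r. split. apply cond_pos. intros h Hh.
assert (Hz : (((x + h)%R, t) - (x, t))%C = RtoC h) by (apply Ceq; simpl; ring).
assert (H : @is_pseries C_AbsRing C_NormedModule a (((x + h)%R, t) - (x, t))%C (f ((x + h)%R, t))).
{ apply Hr. split; simpl; unfold ball; simpl; unfold AbsRing_ball, abs, minus, plus, opp; simpl.
  replace (x + h + - x) with h by ring. exact Hh.
  replace (t + - t) with 0 by ring. rewrite Rabs_R0. apply cond_pos. }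
rewrite Hz in H. unfold is_pseries in H.
apply is_series_Clim in H.
apply (Clim_ext eventually) with (2 := H).
exists O. intros n _. unfold psum. apply Csm_ext. intros k _.
assert (E : @pow_n C_AbsRing (RtoC h) k = RtoC (h ^ k)).
{ induction k as [|k IH]. reflexivity.
  change (@pow_n C_AbsRing (RtoC h) (S k)) with (RtoC h * @pow_n C_AbsRing (RtoC h) k)%C.
  rewrite IH, <- RtoC_mult. reflexivity. }
rewrite <- E. apply Cmult_comm.
Qed.

(** * Continuation of the Hurwitz zeta function *)

(* Taylor coefficients in [h] of [x ^ (w - h)]. *)
Definition Ec (w : C) (x : R) (j : nat) : C := (Rcpow x w * RtoC ((- ln x) ^ j / INR (fact j)))%C.

Lemma Csm_RtoC (u : nat -> R) (n : nat) : Csm (fun k => RtoC (u k)) (S n) = RtoC (sum_n u n).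
Proof.
induction n as [|n IH].
- rewrite sum_O. simpl. ring.
- rewrite sum_Sn. unfold plus; simpl. rewrite RtoC_plus, <- IH. reflexivity.
Qed.

Lemma rps_Ec (w : C) (x h : R) : rps (Ec w x) h (Rcpow x (w - h)).
Proof.
assert (H := is_exp_Reals (- ln x * h)).
assert (E : Rcpow x (w - h) = (Rcpow x w * RtoC (exp (- ln x * h)))%C).
{ unfold Cminus. rewrite Rcpow_plus. f_equal. rewrite <- RtoC_opp, Rcpow_RtoC.
  unfold Rpower. f_equal. f_equal. ring. }
rewrite E. apply Clim_shift.
apply (Clim_ext eventually (fun n => Rcpow x w * RtoC (sum_n (fun k => / INR (fact k) * (- ln x * h) ^ k)%R n))%C).
- exists O. intros n _. rewrite <- Csm_RtoC, <- Csm_scal. unfold psum. apply Csm_ext.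
  intros k _. unfold Ec. rewrite Rpow_mult_distr. unfold Rdiv. rewrite !RtoC_mult. ring.
- apply (Clim_scal eventually). intros eps He.
  assert (H1 : filterlim (sum_n (fun k => scal (pow_n (- ln x * h) k) (/ INR (fact k)))) eventually (locally (exp (- ln x * h)))) by exact H.
  destruct (proj1 (filterlim_locally _ _) H1 (mkposreal eps He)) as [N HN].
  exists N. intros n Hn. rewrite <- RtoC_minus, Cmod_R.
  assert (H2 := HN n Hn). unfold ball in H2; simpl in H2; unfold AbsRing_ball, abs, minus, plus, opp in H2; simpl in H2.
  replace (sum_n (fun k => / INR (fact k) * (- ln x * h) ^ k) n) with
    (sum_n (fun k => scal (pow_n (- ln x * h) k) (/ INR (fact k))) n).
  exact H2.
  apply sum_n_ext. intros k. rewrite pow_n_pow. unfold scal; simpl; unfold mult; simpl. ring.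
Qed.

(** The coefficients in h of (w - h) x^(w - 1 - h); multiplication by h appears as [shift1]. *)
Lemma Cder_Ec (w : C) (x : R) (j : nat) : 0 < x ->
  Cder (fun y => Ec w y j) x (w * Ec (w - 1) x j - shift1 (Ec (w - 1) x) j)%C.
Proof.
intros Hx. unfold Ec.
eapply Cder_eq.
- apply Cder_mult. apply Cder_Rcpow, Hx. apply Cder_RtoC.
  apply is_derive_eq with (match j with O => 0 | S i => - ((- ln x) ^ i / INR (fact i)) * / x end).
  2: reflexivity.
  destruct j as [|i].
  + apply (is_derive_ext (fun _ => 1 / INR (fact 0))). intros; reflexivity. apply @is_derive_const.
  + assert (Hf := INR_fact_neq_0 i). assert (Hi := pos_INR i).
    eapply is_derive_eq.
    * apply (is_derive_ext (fun y => / INR (fact (S i)) * (- ln y) ^ S i)).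
      intros y. apply Rmult_comm.
      apply is_derive_scal. apply is_derive_pow. apply @is_derive_opp. apply is_derive_ln, Hx.
    * unfold opp; simpl Init.Nat.pred. cbn [opp AbelianGroup.class]. rewrite fact_simpl, mult_INR, S_INR.
      simpl. field. repeat split; lra.
- assert (E : Rcpow x w = (x * Rcpow x (w - 1))%C).
  { rewrite <- (Rcpow_1 x) by exact Hx. rewrite <- Rcpow_plus. f_equal. ring. }
  assert (HxC : RtoC x <> 0) by (intros E0; apply RtoC_inj in E0; lra).
  destruct j as [|i].
  + simpl shift1. ring.
  + unfold shift1. rewrite E, RtoC_mult, RtoC_opp, RtoC_inv by lra. field. exact HxC.
Qed.

(** For x >= 1 the left side, divided by x^(Re w), is one term of the nonnegative exponential series
    for e^(r ln x). *)
Lemma Ec_bound (w : C) (x r : R) (j : nat) : 1 <= x -> 0 <= r ->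
  Cmod (Ec w x j) * r ^ j <= Rpower x (Re w + r).
Proof.
intros Hx Hr. unfold Ec. rewrite Cmod_mult, Cmod_Rcpow, Cmod_R, Rpower_plus, Rmult_assoc.
apply Rmult_le_compat_l. left; apply exp_pos.
assert (Hl : 0 <= ln x) by (rewrite <- ln_1; apply ln_le_compat; lra).
unfold Rdiv. rewrite Rabs_mult, Rabs_inv, (Rabs_pos_eq (INR _)) by apply pos_INR.
rewrite <- RPow_abs, Rabs_Ropp, (Rabs_pos_eq (ln x)) by exact Hl.
replace (ln x ^ j * / INR (fact j) * r ^ j) with ((r * ln x) ^ j / INR (fact j)).
2:{ rewrite Rpow_mult_distr. unfold Rdiv. ring. }
unfold Rpower.
assert (H0 : 0 <= r * ln x) by nra. set (y := r * ln x) in *.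
eapply Rle_trans; [|apply (exp_ge_taylor y j H0)].
assert (Hp : forall k, 0 <= y ^ k / INR (fact k)).
{ intros k. apply Rmult_le_pos. apply pow_le, H0. left; apply Rinv_0_lt_compat, INR_fact_lt_0. }
destruct j as [|j]. simpl; lra.
rewrite tech5. generalize (cond_pos_sum (fun k => y ^ k / INR (fact k)) j Hp). lra.
Qed.

Lemma shift1_bound (a : nat -> C) (r B : R) : 0 <= r -> (forall j, Cmod (a j) * r ^ j <= B) ->
  forall j, Cmod (shift1 a j) * r ^ j <= r * B.
Proof.
intros Hr H j. destruct j as [|j]; unfold shift1.
- rewrite Cmod_0, Rmult_0_l. apply Rmult_le_pos. exact Hr.
  eapply Rle_trans; [|apply (H O)]. apply Rmult_le_pos. apply Cmod_ge_0. simpl; lra.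
- simpl pow. generalize (H j). intros. nra.
Qed.

(** Coefficients in h of (1 - s - h) v^(-s-h) - ((v + 1)^(1-s-h) - v^(1-s-h)), a first-order Taylor
    remainder in v. Bounding every coefficient with the weight r^j takes the place of a bound
    uniform over complex h. *)
Lemma Ec_taylor (s : C) (v r : R) (j : nat) : 1 <= v -> 0 <= r -> r <= Re s + 1 ->
  Cmod (((1 - s) * Ec (- s) v j - shift1 (Ec (- s) v) j)
     - (Ec (1 - s) (v + 1) j - Ec (1 - s) v j))%C * r ^ j
   <= (Cmod (1 - s)%C + r) * (Cmod s + r) * Rpower v (- (Re s + 1 - r)).
Proof.
intros Hv Hr Hrs.
set (D := fun x => ((1 - s) * Ec (- s) x j - shift1 (Ec (- s) x) j)%C).
set (D1 := fun x i => (- s * Ec (- s - 1) x i - shift1 (Ec (- s - 1) x) i)%C).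
set (D' := fun x => ((1 - s) * D1 x j - shift1 (D1 x) j)%C).
assert (HD : forall x, 0 < x -> Cder (fun y => Ec (1 - s) y j) x (D x)).
{ intros x Hx. eapply Cder_eq. apply Cder_Ec, Hx. unfold D.
  replace (1 - s - 1)%C with (- s)%C by ring. reflexivity. }
assert (HD' : forall x, 0 < x -> Cder D x (D' x)).
{ intros x Hx. apply Cder_minus. apply Cder_scal, Cder_Ec, Hx.
  destruct j as [|i]; unfold shift1. apply Cder_const. apply Cder_Ec, Hx. }
assert (HcE : forall w i x, 0 < x -> Ccont (fun y => Ec w y i) x).
{ intros w i x Hx. eapply Ccont_Cder, Cder_Ec, Hx. }
assert (Hcs : forall w i x, 0 < x -> Ccont (fun y => shift1 (Ec w y) i) x).
{ intros w i x Hx. destruct i; unfold shift1. apply Ccont_const. apply HcE, Hx. }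
assert (HcD1 : forall i x, 0 < x -> Ccont (fun y => D1 y i) x).
{ intros i x Hx. apply Ccont_minus. apply Ccont_mult. apply Ccont_const. apply HcE, Hx. apply Hcs, Hx. }
assert (HcD' : forall x, 0 < x -> Ccont D' x).
{ intros x Hx. apply Ccont_minus. apply Ccont_mult. apply Ccont_const. apply HcD1, Hx.
  destruct j; unfold shift1. apply Ccont_const. apply HcD1, Hx. }
set (B := (Cmod (1 - s)%C + r) * (Cmod s + r) * Rpower v (- (Re s + 1 - r))).
assert (HB : forall x, v <= x -> Cmod (D' x) * r ^ j <= B).
{ intros x Hx.
  assert (Hrj : forall k, 0 <= r ^ k) by (intros; apply pow_le, Hr).
  assert (Hpv : forall i, Cmod (Ec (- s - 1) x i) * r ^ i <= Rpower v (- (Re s + 1 - r))).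
  { intros i. eapply Rle_trans. apply Ec_bound; lra.
    replace (Re (- s - 1)%C + r) with (- (Re s + 1 - r)) by (simpl; unfold Re; ring).
    apply Rpower_opp_le; lra. }
  set (P := Rpower v (- (Re s + 1 - r))) in *.
  assert (HP0 : 0 < P) by apply exp_pos.
  assert (Hs0 := Cmod_ge_0 s). assert (Hs1 := Cmod_ge_0 (1 - s)%C).
  assert (H1 : forall i, Cmod (D1 x i) * r ^ i <= (Cmod s + r) * P).
  { intros i. unfold D1.
    apply Rle_trans with ((Cmod (- s * Ec (- s - 1) x i)%C + Cmod (shift1 (Ec (- s - 1) x) i)) * r ^ i).
    apply Rmult_le_compat_r. apply Hrj. apply Cmod_minus_le.
    rewrite Cmod_mult, Cmod_opp.
    generalize (shift1_bound _ r P Hr Hpv i) (Hpv i). intros.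
    rewrite !Rmult_plus_distr_r, Rmult_assoc. apply Rplus_le_compat; [|assumption].
    apply Rmult_le_compat_l; assumption. }
  unfold D'.
  apply Rle_trans with ((Cmod ((1 - s) * D1 x j)%C + Cmod (shift1 (D1 x) j)) * r ^ j).
  apply Rmult_le_compat_r. apply Hrj. apply Cmod_minus_le.
  rewrite Cmod_mult.
  generalize (shift1_bound _ r _ Hr H1 j) (H1 j). intros. unfold B.
  replace ((Cmod (1 - s)%C + r) * (Cmod s + r) * P) with
    (Cmod (1 - s)%C * ((Cmod s + r) * P) + r * ((Cmod s + r) * P)) by ring.
  rewrite Rmult_plus_distr_r, Rmult_assoc. apply Rplus_le_compat; [|assumption].
  apply Rmult_le_compat_l; assumption. }
(* The case r = 0, j > 0, in which the weight cannot be divided out. *)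
destruct (Req_dec (r ^ j) 0) as [Hz|Hz].
{ rewrite Hz, Rmult_0_r. rewrite <- (Rmult_0_r (Cmod (D' v))), <- Hz. apply HB. lra. }
assert (Hrp : 0 < r ^ j) by (generalize (pow_le r j Hr); lra).
assert (HB2 : forall x, v <= x -> Cmod (D' x) <= B / r ^ j).
{ intros x Hx. apply Rmult_le_reg_r with (r ^ j). exact Hrp.
  unfold Rdiv. rewrite Rmult_assoc, Rinv_l, Rmult_1_r by exact Hz. apply HB, Hx. }
assert (HB0 : 0 <= B / r ^ j) by (eapply Rle_trans; [apply Cmod_ge_0|apply (HB2 v); lra]).
apply Rmult_le_reg_r with (/ r ^ j). apply Rinv_0_lt_compat, Hrp.
rewrite Rmult_assoc, Rinv_r, Rmult_1_r by exact Hz. fold (D v). fold (B / r ^ j).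
assert (H1 : forall x, v <= x <= v + 1 -> Cmod (D x - D v)%C <= B / r ^ j).
{ intros x Hx. eapply Rle_trans. apply (Cder_bound D D' v x (B / r ^ j)); try lra.
  intros y Hy; apply HD'; lra. intros y Hy; apply HcD'; lra. intros y Hy; apply HB2; lra. nra. }
assert (H2 := Cder_bound (fun x => Ec (1 - s) x j - x * D v)%C (fun x => D x - D v)%C v (v + 1) (B / r ^ j) ltac:(lra)).
cbv beta in H2.
replace (Ec (1 - s) (v + 1) j - RtoC (v + 1) * D v - (Ec (1 - s) v j - v * D v))%C with
  (- (D v - (Ec (1 - s) (v + 1) j - Ec (1 - s) v j)))%C in H2 by (rewrite RtoC_plus; ring).
rewrite Cmod_opp in H2. eapply Rle_trans. apply H2.
- intros x Hx. apply Cder_minus. apply HD; lra.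
  eapply Cder_eq. apply Cder_mult. apply Cder_id. apply Cder_const. cbv beta. simpl. ring.
- intros x Hx. apply Ccont_minus. eapply Ccont_Cder, HD'; lra. apply Ccont_const.
- exact H1.
- lra.
Qed.

(** Mean value theorem with a point c <= v + 1 <= 2 v; the 4 comes from 2^(-(1 + k)) >= 1/4. *)
Lemma Rpower_telescope (v k : R) : 1 <= v -> 0 < k <= 1 ->
  Rpower v (- (1 + k)) <= 4 / k * (Rpower v (- k) - Rpower (v + 1) (- k)).
Proof.
intros Hv Hk.
destruct (MVT_gen (fun x => Rpower x (- k)) v (v + 1) (fun x => - k * Rpower x (- (1 + k)))) as [c [Hc E]].
- intros x Hx. rewrite Rmin_left, Rmax_right in Hx by lra.
  unfold Rpower. auto_derive. lra.
  replace (- (1 + k) * ln x) with (- k * ln x + - ln x) by ring.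
  rewrite exp_plus, exp_Ropp, exp_ln by lra. field. lra.
- intros x Hx. rewrite Rmin_left, Rmax_right in Hx by lra.
  apply derivable_continuous_pt. apply ex_derive_Reals_0. unfold Rpower. auto_derive. lra.
- rewrite Rmin_left, Rmax_right in Hc by lra.
  replace (Rpower v (- k) - Rpower (v + 1) (- k)) with (k * Rpower c (- (1 + k))) by lra.
  replace (4 / k * (k * Rpower c (- (1 + k)))) with (4 * Rpower c (- (1 + k))) by (field; lra).
  assert (H1 : Rpower (2 * v) (- (1 + k)) <= Rpower c (- (1 + k))) by (apply Rpower_opp_le; lra).
  rewrite <- Rpower_mult_distr in H1 by lra.
  assert (H2 : / 4 <= Rpower 2 (- (1 + k))).
  { replace (/ 4) with (Rpower 2 (- (2))). apply Rle_Rpower; lra.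
    rewrite Rpower_Ropp. f_equal. replace 2 with (INR 2) at 2 by reflexivity. rewrite Rpower_pow by lra. simpl; ring. }
  assert (0 < Rpower v (- (1 + k))) by apply exp_pos. nra.
Qed.

(** * Continuation to Re s > 0 by Euler-Maclaurin approximants *)

Definition hsum (alpha : R) (s : C) (m : nat) : C := Csm (fun k => Rcpow (INR k + 1 + alpha) (- s)) m.

(** 1 - s times the first-order Euler-Maclaurin approximant of the zeta function; the factor removes
    the pole at 1. *)
Definition Gm (alpha : R) (s : C) (m : nat) : C := ((1 - s) * hsum alpha s m - Rcpow (INR m + 1 + alpha) (1 - s))%C.

(** Taylor coefficients in h of [Gm alpha (s + h) m]. *)
Definition cG (alpha : R) (s : C) (m j : nat) : C :=
  let A := fun j => Csm (fun k => Ec (- s) (INR k + 1 + alpha) j) m in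
  ((1 - s) * A j - shift1 A j - Ec (1 - s) (INR m + 1 + alpha) j)%C.

Lemma rps_Csm (a : nat -> nat -> C) (l : nat -> C) (h : R) (m : nat) :
  (forall k, rps (a k) h (l k)) -> rps (fun j => Csm (fun k => a k j) m) h (Csm l m).
Proof.
intros H. induction m as [|m IH]; simpl.
- apply (Clim_ext eventually (fun _ => RtoC 0)); [|apply (Clim_const eventually)].
  exists O. intros n _. unfold psum. induction n as [|n IHn]; simpl. reflexivity. rewrite <- IHn. ring.
- apply (rps_plus (fun j => Csm (fun k => a k j) m) (a m)); auto.
Qed.

Lemma rps_cG (alpha : R) (s : C) (m : nat) (h : R) : rps (cG alpha s m) h (Gm alpha (s + h) m).
Proof.
set (A := fun j => Csm (fun k => Ec (- s) (INR k + 1 + alpha) j) m).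
assert (HA : rps A h (hsum alpha (s + h) m)).
{ apply (rps_Csm (fun k => Ec (- s) (INR k + 1 + alpha))). intros k.
  replace (- (s + h))%C with (- s - h)%C by ring. apply rps_Ec. }
replace (Gm alpha (s + h) m) with ((1 - s) * hsum alpha (s + h) m - h * hsum alpha (s + h) m
  - Rcpow (INR m + 1 + alpha) (1 - s - h))%C.
2:{ unfold Gm. replace (1 - (s + h))%C with (1 - s - h)%C by ring. ring. }
apply rps_minus. apply rps_minus. apply rps_scal, HA. apply rps_shift, HA. apply rps_Ec.
Qed.

Lemma cG_0 (alpha : R) (s : C) (m : nat) : cG alpha s m 0 = Gm alpha s m.
Proof.
assert (E : forall w x, Ec w x 0 = Rcpow x w).
{ intros w x. unfold Ec. simpl. replace (1 / 1) with 1 by field. ring. }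
unfold cG, Gm, hsum. rewrite E. unfold shift1.
replace (Csm (fun k => Ec (- s) (INR k + 1 + alpha) 0) m) with (Csm (fun k => Rcpow (INR k + 1 + alpha) (- s)) m).
ring. apply Csm_ext. intros; symmetry; apply E.
Qed.

(** The constants of [Ec_taylor], with r = Re s - k, and of [Rpower_telescope] multiplied
    together. *)
Definition Kh (s : C) (k : R) : R := (Cmod (1 - s)%C + (Re s - k)) * (Cmod s + (Re s - k)) * (4 / k).

Lemma Kh_nonneg (s : C) (k : R) : 0 < k -> k <= Re s -> 0 <= Kh s k.
Proof.
intros Hk Hs. unfold Kh. assert (H1 := Cmod_ge_0 s). assert (H2 := Cmod_ge_0 (1 - s)%C).
assert (0 < 4 / k) by (apply Rdiv_lt_0_compat; lra).
repeat apply Rmult_le_pos; lra.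
Qed.

(** Consecutive differences are the remainders of [Ec_taylor], of size v^(-1-k), and telescope. The
    case j = 0 gives the rate of convergence of [Gm]; the weighted bound for all j gives analyticity
    of the limit. *)
Lemma cG_cauchy (alpha : R) (Halpha : 0 <= alpha) (s : C) (k : R) (j m n : nat) : 0 < k <= 1 -> k <= Re s -> (m <= n)%nat ->
  Cmod (cG alpha s n j - cG alpha s m j)%C * (Re s - k) ^ j
   <= Kh s k * (Rpower (INR m + 1 + alpha) (- k) - Rpower (INR n + 1 + alpha) (- k)).
Proof.
intros Hk Hs Hmn. set (r := Re s - k). assert (Hr : 0 <= r) by (unfold r; lra).
induction Hmn as [|n Hmn IH].
- replace (cG alpha s m j - cG alpha s m j)%C with (RtoC 0) by ring. rewrite Cmod_0. lra.
- assert (Hn := pos_INR n).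
  set (v := INR n + 1 + alpha) in *.
  assert (Hv : 1 <= v) by (unfold v; lra).
  assert (Ev : INR (S n) + 1 + alpha = v + 1) by (rewrite S_INR; unfold v; ring).
  assert (E : (cG alpha s (S n) j - cG alpha s n j)%C = (((1 - s) * Ec (- s) v j - shift1 (Ec (- s) v) j)
     - (Ec (1 - s) (v + 1) j - Ec (1 - s) v j))%C).
  { unfold cG. rewrite Ev. fold v. destruct j as [|i]; unfold shift1; simpl Csm; fold v; ring. }
  replace (cG alpha s (S n) j - cG alpha s m j)%C with ((cG alpha s n j - cG alpha s m j) + (cG alpha s (S n) j - cG alpha s n j))%C by ring.
  apply Rle_trans with ((Cmod (cG alpha s n j - cG alpha s m j)%C + Cmod (cG alpha s (S n) j - cG alpha s n j)%C) * r ^ j).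
  apply Rmult_le_compat_r. apply pow_le, Hr. apply Cmod_triangle.
  rewrite Rmult_plus_distr_r, Ev.
  assert (H1 := Ec_taylor s v r j Hv Hr ltac:(unfold r; lra)). rewrite <- E in H1.
  replace (Re s + 1 - r) with (1 + k) in H1 by (unfold r; ring).
  assert (H2 := Rpower_telescope v k Hv Hk).
  assert (H3 : (Cmod (1 - s)%C + r) * (Cmod s + r) * Rpower v (- (1 + k)) <=
     Kh s k * (Rpower v (- k) - Rpower (v + 1) (- k))).
  { unfold Kh. fold r. rewrite (Rmult_assoc _ (4 / k)). apply Rmult_le_compat_l; [|exact H2].
    generalize (Cmod_ge_0 s) (Cmod_ge_0 (1 - s)%C). intros. apply Rmult_le_pos; lra. }
  lra.
Qed.

Lemma Rpower_INR_small (alpha : R) (Halpha : 0 <= alpha) (k eps : R) : 0 < k -> 0 < eps ->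
  exists N, forall n, (N <= n)%nat -> Rpower (INR n + 1 + alpha) (- k) < eps.
Proof.
intros Hk He. destruct (Rpower_small k eps Hk He) as [a0 [Ha0 H]].
destruct (nfloor_ex (/ a0) ltac:(left; apply Rinv_0_lt_compat; lra)) as [N [_ HN]].
exists N. intros n Hn. assert (Hn1 : INR N <= INR n) by (apply le_INR, Hn).
set (x := INR n + 1 + alpha). assert (Hx : / a0 < x) by (unfold x; lra).
assert (Hx0 : 0 < x) by (assert (0 < / a0) by (apply Rinv_0_lt_compat; lra); lra).
replace (Rpower x (- k)) with (Rpower (/ x) k).
- apply H. split. apply Rinv_0_lt_compat, Hx0. rewrite <- (Rinv_inv a0). apply Rinv_lt_contravar; [|exact Hx].
  apply Rmult_lt_0_compat; [apply Rinv_0_lt_compat; lra|exact Hx0].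
- unfold Rpower. rewrite ln_Rinv by exact Hx0. f_equal. ring.
Qed.

Lemma cG_lim (alpha : R) (Halpha : 0 <= alpha) (s : C) (k : R) (j : nat) : 0 < k <= 1 -> k < Re s ->
  exists l, Clim eventually (fun m => cG alpha s m j) l.
Proof.
intros Hk Hs. apply (Clim_cauchy eventually). intros eps He.
set (r := (Re s - k) ^ j). assert (Hr : 0 < r) by (apply pow_lt; lra).
assert (HK := Kh_nonneg s k ltac:(lra) ltac:(lra)).
destruct (Rpower_INR_small alpha Halpha k (eps * r / (Kh s k + 1)) ltac:(lra)) as [N HN].
{ apply Rdiv_lt_0_compat; [nra|lra]. }
exists (cG alpha s N j). exists N. intros n Hn.
assert (H1 := cG_cauchy alpha Halpha s k j N n Hk ltac:(lra) Hn). fold r in H1.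
assert (H2 := HN N (Nat.le_refl _)).
assert (H3 : 0 < Rpower (INR n + 1 + alpha) (- k)) by apply exp_pos.
assert (H4 : 0 < Rpower (INR N + 1 + alpha) (- k)) by apply exp_pos.
apply Rmult_lt_reg_r with r. exact Hr.
apply Rle_lt_trans with (Kh s k * Rpower (INR N + 1 + alpha) (- k)). nra.
apply Rle_lt_trans with ((Kh s k + 1) * Rpower (INR N + 1 + alpha) (- k)). nra.
apply Rlt_le_trans with ((Kh s k + 1) * (eps * r / (Kh s k + 1))). apply Rmult_lt_compat_l; lra.
right; field; lra.
Qed.

Lemma Gm_lim (alpha : R) (Halpha : 0 <= alpha) (s : C) : 0 < Re s -> exists l, Clim eventually (Gm alpha s) l.
Proof.
intros Hs. set (k := Rmin (Re s / 2) 1).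
assert (0 < k) by (apply Rmin_glb_lt; lra). assert (k <= Re s / 2) by apply Rmin_l. assert (k <= 1) by apply Rmin_r.
destruct (cG_lim alpha Halpha s k 0 ltac:(lra) ltac:(lra)) as [l Hl]. exists l.
apply (Clim_ext eventually) with (2 := Hl). exists O. intros n _. apply cG_0.
Qed.

Lemma Gm_rate (alpha : R) (Halpha : 0 <= alpha) (s l : C) (k : R) (m : nat) : 0 < k <= 1 -> k <= Re s -> Clim eventually (Gm alpha s) l ->
  Cmod (l - Gm alpha s m)%C <= Kh s k * Rpower (INR m + 1 + alpha) (- k).
Proof.
intros Hk Hs Hl.
apply (Clim_Cmod_le eventually (fun n => Gm alpha s n - Gm alpha s m)%C).
apply (Clim_minus eventually). exact Hl. apply (Clim_const eventually).
exists m. intros n Hn.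
assert (H1 := cG_cauchy alpha Halpha s k 0 m n Hk Hs Hn). rewrite !cG_0 in H1. simpl pow in H1.
assert (HK := Kh_nonneg s k ltac:(lra) ltac:(lra)).
assert (H3 : 0 < Rpower (INR n + 1 + alpha) (- k)) by apply exp_pos. nra.
Qed.

(** By [cG_cauchy] the coefficients at x are bounded uniformly in m with weight (x/2)^j, so the
    limit is again given by a power series, here for |h| < x/4. *)
Lemma ran_Gm (alpha : R) (Halpha : 0 <= alpha) (G : R -> C) (t x : R) : (forall x, 0 < x -> Clim eventually (Gm alpha (x, t)) (G x)) ->
  0 < x <= 1 -> ran G x.
Proof.
intros HG Hx. set (s := (x, t) : C). set (k := x / 2).
assert (Hk : 0 < k <= 1) by (unfold k; lra). assert (Hks : k < Re s) by (unfold k, s; simpl; lra).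
set (r := Re s - k). assert (Hr : r = x / 2) by (unfold r, k, s; simpl; lra).
assert (Ha : exists a, forall j, Clim eventually (fun m => cG alpha s m j) (a j)).
{ exists (fun j => Cseq_lim (fun m => cG alpha s m j)). intros j.
  apply Cseq_lim_correct, (cG_lim alpha Halpha s k j Hk Hks). }
destruct Ha as [a Ha]. exists a, (r / 2). split. lra. intros h Hh.
assert (HK := Kh_nonneg s k ltac:(lra) ltac:(lra)).
assert (HPow0 : forall m, Rpower (INR m + 1 + alpha) (- k) <= 1).
{ intros m. assert (Hm := pos_INR m). apply Rle_trans with (Rpower 1 (- k)).
  apply Rpower_opp_le; lra. unfold Rpower; rewrite ln_1, Rmult_0_r, exp_0; lra. }
apply (rps_limit (cG alpha s) a (fun m => Gm alpha (x + h, t) m) (G (x + h)) h r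
  (Rpower (1 + alpha) (Re (1 - s)%C + r) + Kh s k)).
- lra.
- lra.
- intros m j.
  assert (H1 := cG_cauchy alpha Halpha s k j 0 m Hk ltac:(lra) ltac:(lia)). fold r in H1.
  assert (H2 := Ec_bound (1 - s)%C (1 + alpha) r j ltac:(lra) ltac:(lra)).
  assert (E0 : cG alpha s 0 j = (- Ec (1 - s) (1 + alpha) j)%C).
  { unfold cG. simpl INR. rewrite Rplus_0_l. destruct j; unfold shift1; simpl Csm; ring. }
  assert (Hrj : 0 <= r ^ j) by (apply pow_le; lra).
  assert (H3 : Cmod (cG alpha s m j) <= Cmod (cG alpha s 0 j) + Cmod (cG alpha s m j - cG alpha s 0 j)%C) by apply Cmod_le_sub.
  rewrite E0 in H3 at 1. rewrite Cmod_opp in H3.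
  assert (H4 : 0 < Rpower (INR m + 1 + alpha) (- k)) by apply exp_pos.
  assert (H5 := HPow0 O).
  apply Rle_trans with ((Cmod (Ec (1 - s) (1 + alpha) j) + Cmod (cG alpha s m j - cG alpha s 0 j)%C) * r ^ j).
  apply Rmult_le_compat_r; assumption. rewrite Rmult_plus_distr_r. apply Rplus_le_compat. exact H2.
  eapply Rle_trans. apply H1. nra.
- exact Ha.
- intros m. replace ((x + h)%R, t) with (s + h)%C by (apply Ceq; simpl; ring). apply rps_cG.
- apply HG. apply Rabs_def2 in Hh. lra.
Qed.

Lemma Gm_lim_gt_1 (alpha : R) (Halpha : 0 <= alpha) (f : C -> C) (s : C) : 1 < Re s ->
  @is_series C_AbsRing C_NormedModule (fun k => Rcpow (INR (S k) + alpha) (- s)) (f s) ->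
  Clim eventually (Gm alpha s) ((1 - s) * f s)%C.
Proof.
intros Hs H. apply is_series_Clim in H.
rewrite <- (Cminus_0_r ((1 - s) * f s)). unfold Gm.
apply (Clim_minus eventually). apply (Clim_scal eventually).
- apply (Clim_ext eventually) with (2 := H). exists O. intros n _. apply Csm_ext.
  intros k _. rewrite S_INR. reflexivity.
- intros eps He. destruct (Rpower_INR_small alpha Halpha (Re s - 1) eps ltac:(lra) He) as [N HN].
  exists N. intros n Hn. rewrite Cminus_0_r, Cmod_Rcpow.
  replace (Re (1 - s)%C) with (- (Re s - 1)) by (simpl; unfold Re; ring). apply HN, Hn.
Qed.

(** On the line of height t, (1 - s) f(s) and the limit of [Gm] agree where the real part exceeds 1,
    hence down to real part 0 by the identity theorem; f then inherits the rate of [Gm]. The bound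
    is independent of alpha, as termwise integration over alpha requires. *)
Lemma hurwitz_approx (alpha : R) (Halpha : 0 <= alpha) (f : C -> C) (sigma t : R) (m : nat) :
  is_continuation_of_series (fun k s => Rcpow (INR (S k) + alpha) (- s)) f ->
  0 < sigma <= 1 -> t <> 0 ->
  Cmod (f (sigma, t) - (hsum alpha (sigma, t) m - Rcpow (INR m + 1 + alpha) (1 - (sigma, t)) / (1 - (sigma, t))))%C
   <= Kh (sigma, t) (sigma / 2) / Cmod (1 - (sigma, t))%C * Rpower (INR m + 1) (- (sigma / 2)).
Proof.
intros [Hser Han] Hs Ht.
set (G := fun x => ((1 - (x, t)) * f (x, t))%C).
set (G' := fun x => Cseq_lim (Gm alpha (x, t))).
assert (HG' : forall x, 0 < x -> Clim eventually (Gm alpha (x, t)) (G' x)).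
{ intros x Hx. apply Cseq_lim_correct, (Gm_lim alpha Halpha (x, t) Hx). }
assert (HE : forall x, 0 < x -> G x = G' x).
{ apply ran_identity.
  - intros x Hx. destruct (ran_analytic f x t) as [a [r [Hr Ha]]].
    { apply Han. intros E. apply (f_equal Im) in E. simpl in E. lra. }
    exists (fun j => (1 - (x, t)) * a j - shift1 a j)%C, r. split. exact Hr. intros h Hh.
    replace (G (x + h)) with ((1 - (x, t)) * f ((x + h)%R, t) - h * f ((x + h)%R, t))%C.
    apply rps_minus. apply rps_scal, Ha, Hh. apply rps_shift, Ha, Hh.
    unfold G. replace ((x + h)%R, t) with ((x, t) + h)%C at 3 by (apply Ceq; simpl; ring). ring.
  - intros x Hx. apply (ran_Gm alpha Halpha G' t); assumption.
  - intros x Hx. apply (Clim_unique eventually (Gm alpha (x, t))); [|apply HG'; lra].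
    apply (Gm_lim_gt_1 alpha Halpha); [exact Hx|]. apply Hser. exact Hx. }
assert (Hne : (1 - (sigma, t))%C <> 0).
{ intros E. apply (f_equal Im) in E. simpl in E. lra. }
assert (Hmp : 0 < Cmod (1 - (sigma, t))%C) by (apply Cmod_gt_0, Hne).
assert (HR := Gm_rate alpha Halpha (sigma, t) (G' sigma) (sigma / 2) m ltac:(lra) ltac:(simpl; lra) (HG' sigma ltac:(lra))).
rewrite <- HE in HR by lra. unfold G, Gm in HR.
set (s := (sigma, t) : C) in *.
replace (f s - (hsum alpha s m - Rcpow (INR m + 1 + alpha) (1 - s) / (1 - s)))%C with
  (((1 - s) * f s - ((1 - s) * hsum alpha s m - Rcpow (INR m + 1 + alpha) (1 - s))) / (1 - s))%C
  by (field; exact Hne).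
rewrite Cmod_div by exact Hne.
assert (HK := Kh_nonneg s (sigma / 2) ltac:(lra) ltac:(simpl; lra)).
assert (Hm := pos_INR m).
apply Rmult_le_reg_r with (Cmod (1 - s)). exact Hmp.
unfold Rdiv at 1. rewrite Rmult_assoc, Rinv_l, Rmult_1_r by lra.
eapply Rle_trans. apply HR.
replace (Kh s (sigma / 2) / Cmod (1 - s) * Rpower (INR m + 1) (- (sigma / 2)) * Cmod (1 - s))
  with (Kh s (sigma / 2) * Rpower (INR m + 1) (- (sigma / 2))) by (field; lra).
apply Rmult_le_compat_l. exact HK. apply Rpower_opp_le; lra.
Qed.

(** * Integration against exponentials *)

(** Nothing is assumed on how [zeta1 s alpha] depends on alpha; its integrability is obtained here,
    from uniform approximation. *)
Lemma is_CInt_uniform (f : nat -> R -> C) (g : R -> C) (h : nat -> C) (e : nat -> R) (a b : R) : a <= b ->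
  (forall m, is_CInt (f m) a b (h m)) ->
  (forall m x, a <= x <= b -> Cmod (f m x - g x)%C <= e m) ->
  is_lim_seq e 0 -> exists l, Clim eventually h l /\ is_CInt g a b l.
Proof.
intros Hab Hf He Hlim.
(* Clamping to [a, b] turns uniform convergence on the interval into uniform convergence on the
   whole line. *)
set (c := fun x => Rmax a (Rmin x b)).
assert (Hc : forall x, a <= c x <= b).
{ intros x. unfold c. split. apply Rmax_l. apply Rmax_lub. exact Hab. apply Rmin_r. }
assert (Hc2 : forall x, a < x < b -> c x = x).
{ intros x Hx. unfold c. rewrite Rmin_left, Rmax_right; lra. }
destruct (@filterlim_RInt nat C_R_CompleteNormedModule (fun m x => f m (c x)) a b eventually _
  (fun x => g (c x)) h) as [l [H1 H2]].
- intros m. apply (is_CInt_ext (f m)); auto. intros x Hx. rewrite Hc2; auto.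
- intros P [eps HP].
  assert (HN : eventually (fun m => Rabs (e m - 0) < eps)).
  { apply is_lim_seq_spec in Hlim. apply (Hlim eps). }
  destruct HN as [N HN]. exists N. intros m Hm. apply HP. intros x.
  apply C_NormedModule_mixin_compat1. change (Cmod (f m (c x) - g (c x))%C < eps).
  eapply Rle_lt_trans. apply He, Hc. generalize (HN m Hm) (Rle_abs (e m - 0)). lra.
- exists l. split.
  + apply (Clim_filterlim eventually). exact H1.
  + apply (is_CInt_ext (fun x => g (c x))); auto. intros x Hx. rewrite Hc2; auto.
Qed.

Definition cycle (l : R) (x : R) : C := Cexp (Ci * (l * x)%R).

Lemma cycle_plus (l x y : R) : cycle l (x + y) = (cycle l x * cycle l y)%C.
Proof. unfold cycle. rewrite <- Cexp_plus. f_equal. rewrite Rmult_plus_distr_l, RtoC_plus. ring. Qed.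

Lemma cycle_INR (l : R) (k : nat) : cycle l 1 = 1 -> cycle l (INR k) = 1.
Proof.
intros H. induction k as [|k IH].
- unfold cycle. simpl. rewrite Rmult_0_r, Cmult_0_r. apply Cexp_0.
- rewrite S_INR, cycle_plus, IH, H. ring.
Qed.

Lemma Cmod_cycle (l x : R) : Cmod (cycle l x) = 1.
Proof. apply Cmod_Cexp_Ci. Qed.

Lemma Ccont_cycle (l x : R) : Ccont (cycle l) x.
Proof. eapply Ccont_Cder, Cder_Cexp_Ci. Qed.

Lemma Cder_Rcpow_shift (w : C) (c x : R) : 0 < c + x ->
  Cder (fun y => Rcpow (c + y) w) x (w * Rcpow (c + x) (w - 1))%C.
Proof.
intros H. eapply Cder_eq.
- apply (Cder_comp (fun y => Rcpow y w) (fun y => c + y)). apply Cder_Rcpow, H.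
  auto_derive. exact I. reflexivity.
- ring.
Qed.

(** The condition [cycle l 1 = 1] makes the exponential 1-periodic, so the shifted copies of [0, 1]
    are glued into one interval. *)
Lemma cycle_hsum_int (l : R) (s : C) (m : nat) : cycle l 1 = 1 ->
  is_CInt (fun x => cycle l x * hsum x s m)%C 0 1 (CInt (osc s l) 1 (INR m + 1)).
Proof.
intros Hl. induction m as [|m IH].
- simpl INR. rewrite Rplus_0_l.
  apply (is_CInt_ext (fun x => 0 * osc s l (1 + x)%R)%C); [lra| |].
  + intros x Hx. unfold hsum; simpl. ring.
  + assert (E : CInt (osc s l) 1 1 = 0) by (apply (RInt_point (V := C_R_CompleteNormedModule))).
    rewrite E.
    assert (HI : is_CInt (fun x => 0 * osc s l (1 + x)%R)%C 0 1 (0 * CInt (fun x => osc s l (1 + x)%R) 0 1)%C).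
    { apply is_CInt_scal, is_CInt_cont. lra. intros x Hx. apply Ccont_comp with (f := osc s l).
      apply @ex_derive_continuous. auto_derive. exact I. apply Ccont_osc. lra. }
    rewrite Cmult_0_l in HI. exact HI.
- assert (Hm := pos_INR m).
  rewrite (CInt_Chasles _ 1 (INR m + 1)) by (try rewrite S_INR; try lra; apply Ccont_on_osc; lra).
  apply (is_CInt_ext (fun x => cycle l x * hsum x s m + 1 * osc s l (1 * x + (INR m + 1))%R)%C); [lra| |].
  + intros x Hx. unfold hsum; simpl Csm. unfold osc. fold (cycle l (1 * x + (INR m + 1))).
    rewrite Rmult_1_l, cycle_plus. replace (cycle l (INR m + 1)) with (RtoC 1).
    replace (INR m + 1 + x) with (x + (INR m + 1)) by ring. ring.
    rewrite <- S_INR. symmetry. apply cycle_INR, Hl.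
  + apply is_CInt_plus. exact IH. apply is_CInt_comp_lin. rewrite S_INR.
    replace (1 * 0 + (INR m + 1)) with (INR m + 1) by ring.
    replace (1 * 1 + (INR m + 1)) with (INR m + 1 + 1) by ring.
    apply is_CInt_cont. lra. apply Ccont_on_osc. lra.
Qed.

(** One integration by parts. By periodicity the boundary term carries F(1) - F(0), which is smaller
    than F by one power of m, as F' is. *)
Lemma cycle_tail_int (l : R) (s : C) (m : nat) : cycle l 1 = 1 -> l <> 0 -> 0 <= Re s ->
  Cmod (CInt (fun x => cycle l x * Rcpow (INR m + 1 + x) (1 - s))%C 0 1)
   <= 2 * Cmod (1 - s)%C / Rabs l * Rpower (INR m + 1) (- Re s).
Proof.
intros Hl Hl0 Hs. assert (Hm := pos_INR m). set (c := INR m + 1) in *.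
assert (Hla : 0 < Rabs l) by (apply Rabs_pos_lt, Hl0).
assert (HlC : RtoC l <> 0) by (intros E; apply RtoC_inj in E; lra).
set (F := fun x => Rcpow (c + x) (1 - s)). set (F' := fun x => ((1 - s) * Rcpow (c + x) (- s))%C).
assert (HF : forall x, 0 <= x <= 1 -> Cder F x (F' x)).
{ intros x Hx. eapply Cder_eq. apply Cder_Rcpow_shift. unfold c; lra. unfold F'. do 2 f_equal. ring. }
set (G := fun x => (/ (Ci * l) * cycle l x)%C).
assert (HG : forall x, Cder G x (cycle l x)).
{ intros x. eapply Cder_eq. apply Cder_scal, Cder_Cexp_Ci. fold (cycle l x). field. split. exact HlC. apply Ci_nz. }
assert (HFb : forall x, 0 <= x <= 1 -> Cmod (F' x) <= Cmod (1 - s)%C * Rpower c (- Re s)).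
{ intros x Hx. unfold F'. rewrite Cmod_mult, Cmod_Rcpow, re_opp. apply Rmult_le_compat_l. apply Cmod_ge_0.
  apply Rpower_opp_le. exact Hs. unfold c; lra. }
assert (HcF' : Ccont_on F' 0 1).
{ intros x Hx. apply Ccont_mult. apply Ccont_const. eapply Ccont_Cder, Cder_Rcpow_shift. unfold c; lra. }
assert (HcG : forall x, Ccont G x) by (intros x; eapply Ccont_Cder, HG).
assert (HmG : forall x, Cmod (G x) = / Rabs l).
{ intros x. unfold G. rewrite Cmod_mult, Cmod_cycle, Cmod_inv, Cmod_mult, Cmod_Ci, Cmod_R.
  rewrite Rmult_1_l, Rmult_1_r. reflexivity. apply Cmult_neq_0. apply Ci_nz. exact HlC. }
assert (EG : G 1 = G 0).
{ unfold G. rewrite Hl. f_equal. symmetry. apply (cycle_INR l 0 Hl). }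
replace (CInt (fun x => cycle l x * Rcpow (c + x) (1 - s))%C 0 1) with (CInt (fun x => F x * cycle l x)%C 0 1).
2:{ apply CInt_ext. lra. intros x _. unfold F. ring. }
rewrite (CInt_parts F G F' (cycle l)); auto; try lra.
2:{ intros x _. apply Ccont_cycle. }
rewrite EG. replace (F 1 * G 0 - F 0 * G 0)%C with ((F 1 - F 0) * G 0)%C by ring.
assert (H1 : Cmod (F 1 - F 0)%C <= Cmod (1 - s)%C * Rpower c (- Re s)).
{ eapply Rle_trans. apply (Cder_bound F F' 0 1 (Cmod (1 - s)%C * Rpower c (- Re s))); auto; lra. lra. }
assert (H2 : Cmod (CInt (fun x => F' x * G x)%C 0 1) <= Cmod (1 - s)%C * Rpower c (- Re s) * / Rabs l).
{ eapply Rle_trans. apply (Cmod_CInt_const _ 0 1 (Cmod (1 - s)%C * Rpower c (- Re s) * / Rabs l)). lra.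
  intros x Hx. apply Ccont_mult; auto.
  intros x Hx. rewrite Cmod_mult, HmG. apply Rmult_le_compat_r. left; apply Rinv_0_lt_compat, Hla. auto. lra. }
eapply Rle_trans. apply Cmod_minus_le. rewrite Cmod_mult, HmG.
assert (0 < / Rabs l) by (apply Rinv_0_lt_compat, Hla).
apply Rle_trans with (2 * (Cmod (1 - s)%C * Rpower c (- Re s) * / Rabs l)). nra.
right. unfold Rdiv. ring.
Qed.

Lemma is_lim_seq_Rpower (k : R) : 0 < k -> is_lim_seq (fun m => Rpower (INR m + 1) (- k)) 0.
Proof.
intros Hk. apply is_lim_seq_spec. intros eps.
destruct (Rpower_INR_small 0 (Rle_refl 0) k eps Hk (cond_pos eps)) as [N HN].
exists N. intros n Hn. rewrite Rminus_0_r, Rabs_pos_eq by (left; apply exp_pos).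
generalize (HN n Hn). rewrite Rplus_0_r. auto.
Qed.

(** The approximants integrate to [osc] over [1, m + 1] minus a tail that vanishes by oscillation
    although its integrand grows like m^(1 - sigma). Uniform convergence yields both the improper
    integral and the integrability. *)
Lemma hurwitz_cycle_int (zeta1 : C -> R -> C) (sigma t l : R) :
  is_hurwitz_zeta1 zeta1 -> 0 < sigma < 1 -> t <> 0 -> cycle l 1 = 1 -> l <> 0 ->
  exists A, Clim eventually (fun m => CInt (osc (sigma, t) l) 1 (INR m + 1)) A /\
    is_CInt (fun x => cycle l x * zeta1 (sigma, t) x)%C 0 1 A.
Proof.
intros Hz Hs Ht Hl Hl0. set (s := (sigma, t) : C).
set (T := fun m => CInt (fun x => cycle l x * Rcpow (INR m + 1 + x) (1 - s))%C 0 1).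
assert (Hne : (1 - s)%C <> 0).
{ intros E. apply (f_equal Im) in E. simpl in E. lra. }
assert (Hmp : 0 < Cmod (1 - s)%C) by (apply Cmod_gt_0, Hne).
assert (Hsg : 0 < sigma / 2) by lra.
destruct (is_CInt_uniform
  (fun m x => cycle l x * (hsum x s m - Rcpow (INR m + 1 + x) (1 - s) / (1 - s)))%C
  (fun x => cycle l x * zeta1 s x)%C
  (fun m => CInt (osc s l) 1 (INR m + 1) - / (1 - s) * T m)%C
  (fun m => Kh s (sigma / 2) / Cmod (1 - s)%C * Rpower (INR m + 1) (- (sigma / 2))) 0 1 ltac:(lra))
  as [A [H1 H2]].
- intros m.
  apply (is_CInt_ext (fun x => cycle l x * hsum x s m - / (1 - s) * (cycle l x * Rcpow (INR m + 1 + x) (1 - s)))%C); [lra| |].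
  + intros x Hx. field. exact Hne.
  + apply is_CInt_minus. apply cycle_hsum_int, Hl. apply is_CInt_scal, is_CInt_cont. lra.
    intros x Hx. apply Ccont_mult. apply Ccont_cycle. eapply Ccont_Cder, Cder_Rcpow_shift.
    generalize (pos_INR m); lra.
- intros m x Hx.
  replace (cycle l x * (hsum x s m - Rcpow (INR m + 1 + x) (1 - s) / (1 - s)) - cycle l x * zeta1 s x)%C
    with (- cycle l x * (zeta1 s x - (hsum x s m - Rcpow (INR m + 1 + x) (1 - s) / (1 - s))))%C
    by (field; exact Hne).
  rewrite Cmod_mult, Cmod_opp, Cmod_cycle, Rmult_1_l.
  apply (hurwitz_approx x ltac:(lra) (fun s => zeta1 s x) sigma t m (Hz x ltac:(lra))); lra.
- assert (H := is_lim_seq_scal_l _ (Kh s (sigma / 2) / Cmod (1 - s)%C) _ (is_lim_seq_Rpower _ Hsg)).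
  simpl in H. rewrite Rmult_0_r in H. exact H.
- exists A. split; [|exact H2].
  apply (Clim_ext eventually (fun m => (CInt (osc s l) 1 (INR m + 1) - / (1 - s) * T m) + / (1 - s) * T m)%C).
  exists O; intros m _; ring.
  rewrite <- (Cplus_0_r A). apply (Clim_plus eventually). exact H1.
  rewrite <- (Cmult_0_r (/ (1 - s))). apply (Clim_scal eventually).
  apply (Clim_squeeze eventually) with (fun m => 2 * Cmod (1 - s)%C / Rabs l * Rpower (INR m + 1) (- sigma)).
  + exists O. intros m _. rewrite Cminus_0_r. apply (cycle_tail_int l s m Hl Hl0). simpl; lra.
  + assert (H := is_lim_seq_scal_l _ (2 * Cmod (1 - s)%C / Rabs l) _ (is_lim_seq_Rpower sigma ltac:(lra))).
    simpl in H. rewrite Rmult_0_r in H. exact H.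
Qed.

Lemma is_CInt_Csm (u : nat -> R -> C) (g : R -> C) (l : nat -> C) (a b : R) (n : nat) : a <= b ->
  (forall k, (k < n)%nat -> is_CInt (fun x => u k x * g x)%C a b (l k)) ->
  is_CInt (fun x => Csm (fun k => u k x) n * g x)%C a b (Csm l n).
Proof.
intros Hab H. induction n as [|n IH].
- assert (HI : is_CInt (fun x => 0 * 0)%C a b (0 * CInt (fun _ => RtoC 0) a b)%C).
  { apply is_CInt_scal, is_CInt_cont. exact Hab. intros x _. apply Ccont_const. }
  rewrite (Cmult_0_l (CInt _ _ _)) in HI.
  apply (is_CInt_ext (fun x => 0 * 0)%C); auto. intros; simpl; ring.
- apply (is_CInt_ext (fun x => Csm (fun k => u k x) n * g x + u n x * g x)%C); auto. intros; simpl; ring.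
  simpl. apply is_CInt_plus. apply IH. intros; apply H; lia. apply H; lia.
Qed.

(** * Integrals of the exponential sum against zeta1 and its partial sums *)

Definition freq (k : nat) : R := 2 * PI * (INR k + 1).

Lemma freq_pos (k : nat) : 0 < freq k.
Proof. unfold freq. generalize PI_RGT_0 (pos_INR k). intros. nra. Qed.

Lemma cycle_freq (k : nat) : cycle (freq k) 1 = 1 /\ cycle (- freq k) 1 = 1.
Proof.
assert (H : forall e, Rabs e = 1 -> cycle (e * freq k) 1 = 1).
{ intros e He. unfold cycle, Cexp.
  replace (Re (Ci * RtoC (e * freq k * 1))) with 0 by (simpl; ring).
  replace (Im (Ci * RtoC (e * freq k * 1))) with (e * (2 * INR (S k) * PI)).
  2:{ rewrite S_INR; unfold freq; simpl; ring. }
  assert (Hc : cos (2 * INR (S k) * PI) = 1).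
  { rewrite <- (Rplus_0_l (2 * INR (S k) * PI)), cos_period. apply cos_0. }
  assert (Hsn : sin (2 * INR (S k) * PI) = 0).
  { rewrite <- (Rplus_0_l (2 * INR (S k) * PI)), sin_period. apply sin_0. }
  rewrite exp_0. set (y := 2 * INR (S k) * PI) in *. destruct (Rle_dec 0 e) as [H|H].
  - rewrite Rabs_pos_eq in He by exact H. rewrite He, (Rmult_1_l y), Hc, Hsn. apply Ceq; simpl; ring.
  - rewrite Rabs_left1 in He by lra. replace e with (-1) by lra.
    replace (-1 * y) with (- y) by ring.
    rewrite cos_neg, sin_neg, Hc, Hsn. apply Ceq; simpl; ring. }
split.
- rewrite <- (Rmult_1_l (freq k)). apply H. apply Rabs_R1.
- replace (- freq k) with (-1 * freq k) by ring. apply H. rewrite Rabs_left1; lra.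
Qed.

Definition floor_nat (x : R) : nat := Z.to_nat (Int_part x).

Lemma Csum_upto_Csm (x : R) (a : nat -> C) : Csum_upto x a = Csm (fun k => a (S k)) (floor_nat x).
Proof.
unfold Csum_upto. fold (floor_nat x). induction (floor_nat x) as [|n IH].
- rewrite sum_n_m_zero by lia. reflexivity.
- rewrite sum_n_Sm by lia. rewrite IH. reflexivity.
Qed.

Lemma Bsum_cycle (N x : R) :
  Bsum N x = Csm (fun k => cycle (freq k) x) (floor_nat N) /\
  Bsum N (- x) = Csm (fun k => cycle (- freq k) x) (floor_nat N).
Proof.
unfold Bsum. rewrite !Csum_upto_Csm. split; apply Csm_ext; intros k _; unfold cycle, freq; f_equal;
  rewrite S_INR, ?RtoC_mult, ?RtoC_opp, ?RtoC_mult, !RtoC_plus; ring.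
Qed.

(** The second integral involves 1 - s and negative frequencies; conjugation brings it back to
    positive frequencies at the point 1 - sigma + i t. *)
Lemma osc_conj (s : C) (l x : R) : osc (1 - s) (- l) x = Cconj (osc (1 - Cconj s) l x).
Proof.
unfold osc. rewrite Cmult_conj, <- Rcpow_conj, <- Cexp_conj. f_equal.
- f_equal. rewrite Copp_conj, Cminus_conj, Cconj_conj, RtoC_conj. reflexivity.
- f_equal. apply Ceq; simpl; ring.
Qed.

Lemma CInt_osc_conj (s : C) (l a b : R) : 0 < a <= b ->
  CInt (osc (1 - s) (- l)) a b = Cconj (CInt (osc (1 - Cconj s) l) a b).
Proof.
intros Hab. rewrite <- CInt_conj by (try lra; apply Ccont_on_osc; lra).
apply CInt_ext. lra. intros x _. apply osc_conj.
Qed.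

Definition osc_inf (s : C) (k : nat) : C := Cseq_lim (fun m => CInt (osc s (freq k)) 1 (INR m + 1)).

(** Convergence is taken from the Hurwitz integral, which is why [zeta1] appears. *)
Lemma osc_inf_lim (zeta1 : C -> R -> C) (sigma t : R) (k : nat) :
  is_hurwitz_zeta1 zeta1 -> 0 < sigma < 1 -> t <> 0 ->
  Clim eventually (fun m => CInt (osc (sigma, t) (freq k)) 1 (INR m + 1)) (osc_inf (sigma, t) k).
Proof.
intros Hz Hs Ht. apply Cseq_lim_correct.
assert (Hf := freq_pos k).
destruct (hurwitz_cycle_int zeta1 sigma t (freq k) Hz Hs Ht (proj1 (cycle_freq k)) ltac:(lra)) as [A [HA _]].
exists A. exact HA.
Qed.

Lemma Bsum_zeta1_int (zeta1 : C -> R -> C) (sigma t N : R) :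
  is_hurwitz_zeta1 zeta1 -> 0 < sigma < 1 -> t <> 0 ->
  CInt01 (fun x => Bsum N x * zeta1 (sigma, t) x)%C = Csm (osc_inf (sigma, t)) (floor_nat N).
Proof.
intros Hz Hs Ht. apply is_CInt_unique.
apply (is_CInt_ext (fun x => Csm (fun k => cycle (freq k) x) (floor_nat N) * zeta1 (sigma, t) x)%C); [lra| |].
- intros x _. rewrite (proj1 (Bsum_cycle N x)). reflexivity.
- assert (H : forall k, is_CInt (fun x => cycle (freq k) x * zeta1 (sigma, t) x)%C 0 1 (osc_inf (sigma, t) k)).
  { intros k. assert (Hf := freq_pos k).
    destruct (hurwitz_cycle_int zeta1 sigma t (freq k) Hz Hs Ht (proj1 (cycle_freq k)) ltac:(lra)) as [A [HA HI]].
    replace (osc_inf (sigma, t) k) with A. exact HI.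
    apply (Clim_unique eventually _ _ _ HA). apply (osc_inf_lim zeta1); assumption. }
  apply is_CInt_Csm; auto. lra.
Qed.

Lemma Bsum_opp_zeta1_int (zeta1 : C -> R -> C) (sigma t N : R) :
  is_hurwitz_zeta1 zeta1 -> 0 < sigma < 1 -> t <> 0 ->
  CInt01 (fun x => Bsum N (- x) * zeta1 (1 - (sigma, t))%C x)%C
    = Cconj (Csm (osc_inf ((1 - sigma)%R, t)) (floor_nat N)).
Proof.
intros Hz Hs Ht. rewrite Csm_conj. apply is_CInt_unique.
assert (E1 : (1 - (sigma, t))%C = ((1 - sigma)%R, - t)) by (apply Ceq; simpl; ring).
assert (E2 : (1 - Cconj (sigma, t))%C = ((1 - sigma)%R, t)) by (apply Ceq; simpl; ring).
apply (is_CInt_ext (fun x => Csm (fun k => cycle (- freq k) x) (floor_nat N) * zeta1 (1 - (sigma, t))%C x)%C); [lra| |].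
- intros x _. rewrite (proj2 (Bsum_cycle N x)). reflexivity.
- assert (H : forall k, is_CInt (fun x => cycle (- freq k) x * zeta1 (1 - (sigma, t))%C x)%C 0 1
    (Cconj (osc_inf ((1 - sigma)%R, t) k))).
  { intros k. assert (Hf := freq_pos k). rewrite E1.
    destruct (hurwitz_cycle_int zeta1 (1 - sigma) (- t) (- freq k) Hz ltac:(lra) ltac:(lra) (proj2 (cycle_freq k)) ltac:(lra)) as [A [HA HI]].
    replace (Cconj (osc_inf ((1 - sigma)%R, t) k)) with A. exact HI.
    apply (Clim_unique eventually _ _ _ HA).
    apply (Clim_ext eventually (fun m => Cconj (CInt (osc ((1 - sigma)%R, t) (freq k)) 1 (INR m + 1)))).
    - exists O. intros m _. rewrite <- E1, <- E2. symmetry. apply CInt_osc_conj. generalize (pos_INR m); lra.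
    - apply (Clim_conj eventually). apply (osc_inf_lim zeta1); try assumption; lra. }
  apply is_CInt_Csm; auto. lra.
Qed.

(** The partial sum of [zeta1] with floor(N) terms unfolds exactly to [1, floor(N) + 1], with no
    tail. *)
Lemma Bsum_hsum_int (s : C) (N : R) :
  CInt01 (fun x => Bsum N x * Csum_upto N (fun n => Rcpow (INR n + x) (- s)))%C
    = Csm (fun k => CInt (osc s (freq k)) 1 (INR (floor_nat N) + 1)) (floor_nat N).
Proof.
apply is_CInt_unique.
apply (is_CInt_ext (fun x => Csm (fun k => cycle (freq k) x) (floor_nat N) * hsum x s (floor_nat N))%C); [lra| |].
- intros x _. rewrite (proj1 (Bsum_cycle N x)), Csum_upto_Csm. f_equal. apply Csm_ext.
  intros k _. rewrite S_INR. reflexivity.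
- apply is_CInt_Csm; try lra; intros k _; apply cycle_hsum_int, cycle_freq.
Qed.

Lemma Bsum_opp_hsum_int (sigma t N : R) :
  CInt01 (fun x => Bsum N (- x) * Csum_upto N (fun n => Rcpow (INR n + x) ((sigma, t) - 1)%C))%C
    = Cconj (Csm (fun k => CInt (osc ((1 - sigma)%R, t) (freq k)) 1 (INR (floor_nat N) + 1)) (floor_nat N)).
Proof.
assert (E2 : (1 - Cconj (sigma, t))%C = ((1 - sigma)%R, t)) by (apply Ceq; simpl; ring).
rewrite Csm_conj. apply is_CInt_unique.
apply (is_CInt_ext (fun x => Csm (fun k => cycle (- freq k) x) (floor_nat N) * hsum x (1 - (sigma, t)) (floor_nat N))%C); [lra| |].
- intros x _. rewrite (proj2 (Bsum_cycle N x)), Csum_upto_Csm. f_equal. apply Csm_ext.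
  intros k _. rewrite S_INR. f_equal. ring.
- assert (H : forall k, is_CInt (fun x => cycle (- freq k) x * hsum x (1 - (sigma, t)) (floor_nat N))%C 0 1
    (Cconj (CInt (osc ((1 - sigma)%R, t) (freq k)) 1 (INR (floor_nat N) + 1)))).
  { intros k. rewrite <- E2, <- CInt_osc_conj by (generalize (pos_INR (floor_nat N)); lra).
    apply cycle_hsum_int, cycle_freq. }
  apply is_CInt_Csm; auto. lra.
Qed.

(** * Poisson summation on an interval with half-integer endpoints *)

Fixpoint dirichlet (K : nat) (x : R) : R :=
  match K with O => 1 | S k => dirichlet k x + 2 * cos (freq k * x) end.

Lemma sin_dirichlet (K : nat) (x : R) : sin (PI * x) * dirichlet K x = sin ((2 * INR K + 1) * PI * x).
Proof.
induction K as [|K IH].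
- simpl. rewrite Rmult_1_r. f_equal. ring.
- rewrite S_INR. simpl dirichlet. rewrite Rmult_plus_distr_l, IH. unfold freq.
  replace ((2 * (INR K + 1) + 1) * PI * x) with (2 * PI * (INR K + 1) * x + PI * x) by ring.
  replace ((2 * INR K + 1) * PI * x) with (2 * PI * (INR K + 1) * x - PI * x) by ring.
  rewrite sin_plus, sin_minus. ring.
Qed.

Lemma ex_derive_dirichlet (K : nat) (x : R) : ex_derive (dirichlet K) x.
Proof.
induction K as [|K IH].
- apply (ex_derive_ext (fun _ => 1)). reflexivity. apply ex_derive_const.
- apply (ex_derive_plus (V := R_NormedModule) (dirichlet K) (fun x => 2 * cos (freq K * x))). exact IH. auto_derive. exact I.
Qed.

Lemma Ccont_dirichlet (K : nat) (x : R) : Ccont (fun y => RtoC (dirichlet K y)) x.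
Proof. apply Ccont_RtoC, @ex_derive_continuous, ex_derive_dirichlet. Qed.

Lemma cos_freq_shift (k n : nat) (x : R) : cos (freq k * (x + INR n)) = cos (freq k * x).
Proof.
replace (freq k * (x + INR n)) with (freq k * x + 2 * INR (S k * n) * PI).
apply cos_period. rewrite mult_INR, S_INR. unfold freq. ring.
Qed.

Lemma dirichlet_shift (K n : nat) (x : R) : dirichlet K (x + INR n) = dirichlet K x.
Proof.
induction K as [|K IH]; simpl. reflexivity. rewrite IH, cos_freq_shift. reflexivity.
Qed.

Lemma sin_PI_INR (k : nat) : sin (INR k * PI) = 0.
Proof.
induction k as [|k IH]. simpl. rewrite Rmult_0_l. apply sin_0.
rewrite S_INR, Rmult_plus_distr_r, Rmult_1_l, neg_sin, IH. ring.
Qed.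

Lemma dirichlet_int (K : nat) : is_RInt (dirichlet K) (- (1 / 2)) (1 / 2) 1.
Proof.
induction K as [|K IH].
- apply (is_RInt_ext (fun _ => 1)). intros; reflexivity.
  replace 1 with (scal (1 / 2 - - (1 / 2)) 1) at 3. apply @is_RInt_const.
  unfold scal; simpl; unfold mult; simpl. field.
- replace 1 with (plus 1 0) at 3 by (unfold plus; simpl; ring).
  apply (is_RInt_plus (V := R_NormedModule) (dirichlet K) (fun x => 2 * cos (freq K * x))). exact IH.
  assert (Hf := freq_pos K).
  assert (H : is_RInt (fun x => 2 * cos (freq K * x)) (- (1 / 2)) (1 / 2)
    (minus (2 / freq K * sin (freq K * (1 / 2))) (2 / freq K * sin (freq K * - (1 / 2))))).
  { apply (is_RInt_derive (fun x => 2 / freq K * sin (freq K * x))).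
    intros x _. auto_derive. exact I. field. lra.
    intros x _. apply @ex_derive_continuous. auto_derive. exact I. }
  replace 0 with (minus (2 / freq K * sin (freq K * (1 / 2))) (2 / freq K * sin (freq K * - (1 / 2)))). exact H.
  replace (freq K * - (1 / 2)) with (- (freq K * (1 / 2))) by ring.
  replace (freq K * (1 / 2)) with (INR (S K) * PI) by (rewrite S_INR; unfold freq; field).
  rewrite sin_neg, sin_PI_INR. unfold minus, plus, opp; simpl. ring.
Qed.

Lemma Ccont_bounded (f : R -> C) (a b : R) : a <= b -> Ccont_on f a b ->
  exists B, forall x, a <= x <= b -> Cmod (f x) <= B.
Proof.
intros Hab Hf. destruct (continuity_ab_maj (fun x => Cmod (f x)) a b Hab) as [x0 [H _]].
- intros c Hc. apply continuity_pt_filterlim. intros P [eps HP].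
  generalize (proj1 (Ccont_Clim f c) (Hf c Hc) eps (cond_pos eps)).
  unfold filtermap. apply filter_imp. intros x Hx. apply HP.
  unfold ball; simpl; unfold AbsRing_ball, abs, minus, plus, opp; simpl.
  generalize (Cmod_le_sub (f x) (f c)) (Cmod_le_sub (f c) (f x)). rewrite (Cmod_sym (f c) (f x)).
  intros. apply Rabs_def1; lra.
- exists (Cmod (f x0)). exact H.
Qed.

(** One integration by parts, with decay 1 / (K + 1). *)
Lemma riemann_lebesgue (g g' : R -> C) (a b : R) : a <= b ->
  (forall x, a <= x <= b -> Cder g x (g' x)) -> Ccont_on g' a b ->
  Clim eventually (fun K => CInt (fun x => RtoC (sin ((2 * INR K + 1) * PI * x)) * g x)%C a b) 0.
Proof.
intros Hab Hg Hg'. assert (HP := PI_RGT_0).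
destruct (Ccont_bounded g' a b Hab Hg') as [B HB].
set (W := Cmod (g a) + Cmod (g b) + (b - a) * B).
assert (HW : 0 <= W).
{ unfold W. assert (0 <= B) by (eapply Rle_trans; [apply Cmod_ge_0|apply (HB a); lra]).
  generalize (Cmod_ge_0 (g a)) (Cmod_ge_0 (g b)). nra. }
apply (Clim_squeeze eventually) with (fun K => W * / (INR K + 1)).
- exists O. intros K _. rewrite Cminus_0_r. assert (HK := pos_INR K).
  set (mu := (2 * INR K + 1) * PI). assert (Hmu : INR K + 1 <= mu) by (generalize PI2_3_2; unfold mu; nra).
  set (G := fun x => RtoC (- cos (mu * x) / mu)).
  assert (HG : forall x, Cder G x (RtoC (sin (mu * x)))).
  { intros x. apply Cder_RtoC. auto_derive. lra. field. lra. }
  assert (HGm : forall x, Cmod (G x) <= / mu).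
  { intros x. unfold G. rewrite Cmod_R. unfold Rdiv. rewrite Rabs_mult, Rabs_Ropp, (Rabs_pos_eq (/ mu)).
    rewrite <- (Rmult_1_l (/ mu)) at 2. apply Rmult_le_compat_r. left; apply Rinv_0_lt_compat; lra.
    apply Rabs_le, COS_bound. left; apply Rinv_0_lt_compat; lra. }
  assert (Hcs : Ccont_on (fun x => RtoC (sin (mu * x))) a b).
  { intros x _. apply Ccont_RtoC, @ex_derive_continuous. auto_derive. exact I. }
  rewrite (CInt_ext _ (fun x => g x * RtoC (sin (mu * x)))%C) by (try lra; intros; unfold mu; ring).
  rewrite (CInt_parts g G g') by (try assumption; intros; apply HG).
  assert (H1 : Cmod (CInt (fun x => g' x * G x)%C a b) <= (b - a) * (B * / mu)).
  { apply Cmod_CInt_const. exact Hab. intros x Hx. apply Ccont_mult. apply Hg', Hx. eapply Ccont_Cder, HG.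
    intros x Hx. rewrite Cmod_mult. apply Rmult_le_compat; auto; apply Cmod_ge_0. }
  generalize (Cmod_minus_le (g b * G b - g a * G a) (CInt (fun x => g' x * G x)%C a b)).
  generalize (Cmod_minus_le (g b * G b) (g a * G a)). rewrite !Cmod_mult.
  assert (Hi : / mu <= / (INR K + 1)) by (apply Rinv_le_contravar; lra).
  assert (H2 := HGm a). assert (H3 := HGm b).
  assert (Cmod (g a) * Cmod (G a) <= Cmod (g a) * / mu) by (apply Rmult_le_compat_l; [apply Cmod_ge_0|assumption]).
  assert (Cmod (g b) * Cmod (G b) <= Cmod (g b) * / mu) by (apply Rmult_le_compat_l; [apply Cmod_ge_0|assumption]).
  assert (W * / mu <= W * / (INR K + 1)) by (apply Rmult_le_compat_l; assumption).
  unfold W in *. lra.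
- assert (H0 : is_lim_seq (fun K => W * / (INR K + 1)) (Rbar_mult W 0)).
  { apply is_lim_seq_scal_l. assert (H := is_lim_seq_Rpower 1 ltac:(lra)).
    apply is_lim_seq_ext with (2 := H). intros n. assert (Hn := pos_INR n).
    rewrite Rpower_Ropp, Rpower_1 by lra. reflexivity. }
  simpl in H0. rewrite Rmult_0_r in H0. exact H0.
Qed.

(** Where sin(pi x) does not vanish the kernel is sin((2K + 1) pi x) / sin(pi x), so the
    Riemann-Lebesgue lemma applies to u / sin(pi x). *)
Lemma dirichlet_away (u u' : R -> C) (a b : R) : a <= b ->
  (forall x, a <= x <= b -> sin (PI * x) <> 0) ->
  (forall x, a <= x <= b -> Cder u x (u' x)) -> Ccont_on u' a b ->
  Clim eventually (fun K => CInt (fun x => RtoC (dirichlet K x) * u x)%C a b) 0.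
Proof.
intros Hab Hsin Hu Hu'.
set (i := fun x => / sin (PI * x)). set (i' := fun x => - (PI * cos (PI * x)) / sin (PI * x) ^ 2).
assert (Hi : forall x, a <= x <= b -> Cder (fun y => RtoC (i y)) x (RtoC (i' x))).
{ intros x Hx. apply Cder_RtoC. unfold i, i'. auto_derive. apply Hsin, Hx. field. apply Hsin, Hx. }
assert (Hi' : Ccont_on (fun y => RtoC (i' y)) a b).
{ intros x Hx. apply Ccont_RtoC, @ex_derive_continuous. unfold i'. auto_derive.
  repeat split; auto. intros E. apply (Hsin x Hx). nra. }
assert (Hcu : Ccont_on u a b) by (intros x Hx; eapply Ccont_Cder, Hu, Hx).
assert (Hci : Ccont_on (fun y => RtoC (i y)) a b).
{ intros x Hx. apply Ccont_Cder with (RtoC (i' x)). apply Hi, Hx. }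
assert (H := riemann_lebesgue (fun x => u x * RtoC (i x))%C (fun x => u' x * RtoC (i x) + u x * RtoC (i' x))%C a b Hab
  ltac:(intros x Hx; exact (Cder_mult _ _ _ _ _ (Hu x Hx) (Hi x Hx)))
  ltac:(intros x Hx; apply Ccont_plus; apply Ccont_mult; auto)).
apply (Clim_ext eventually) with (2 := H). exists O. intros K _. apply CInt_ext. exact Hab.
intros x Hx. rewrite <- sin_dirichlet. unfold i.
rewrite RtoC_mult, RtoC_inv by (apply Hsin; lra). field.
intros E. apply RtoC_inj in E. apply (Hsin x ltac:(lra) E).
Qed.

Lemma Rabs_le_sin_PI (x : R) : - (1 / 2) <= x <= 1 / 2 -> Rabs x <= Rabs (sin (PI * x)).
Proof.
intros Hx. assert (HP := PI2_3_2). assert (H := Rabs_le_sin (PI * x) ltac:(split; nra)).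
rewrite Rabs_mult, (Rabs_pos_eq PI) in H by lra. generalize (Rabs_pos x). nra.
Qed.

(** The kernel has integral 1, so u may be replaced by w = u - u(0). On [-d, d] the bounds |w| <= L
    |x| and |x| |[dirichlet K x]| <= 1 give at most 2 d L; the rest is covered by
    [dirichlet_away]. *)
Lemma dirichlet_lim (u u' : R -> C) :
  (forall x, - (1 / 2) <= x <= 1 / 2 -> Cder u x (u' x)) -> Ccont_on u' (- (1 / 2)) (1 / 2) ->
  Clim eventually (fun K => CInt (fun x => RtoC (dirichlet K x) * u x)%C (- (1 / 2)) (1 / 2)) (u 0).
Proof.
intros Hu Hu'.
destruct (Ccont_bounded u' (- (1 / 2)) (1 / 2) ltac:(lra) Hu') as [L0 HL0].
set (L := Rmax L0 0). assert (HLn : 0 <= L) by apply Rmax_r.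
assert (HL : forall x, - (1 / 2) <= x <= 1 / 2 -> Cmod (u' x) <= L).
{ intros x Hx. eapply Rle_trans. apply HL0, Hx. apply Rmax_l. }
set (w := fun x => (u x - u 0)%C).
assert (Hw : forall x, - (1 / 2) <= x <= 1 / 2 -> Cder w x (u' x)).
{ intros x Hx. eapply Cder_eq. apply Cder_minus. apply Hu, Hx. apply Cder_const. ring. }
assert (Hwl : forall x, - (1 / 2) <= x <= 1 / 2 -> Cmod (w x) <= L * Rabs x).
{ intros x Hx. unfold w. destruct (Rle_dec 0 x) as [H0|H0].
  - rewrite Rabs_pos_eq by exact H0. eapply Rle_trans. apply (Cder_bound u u' 0 x L); try lra.
    intros y Hy; apply Hu; lra. intros y Hy; apply Hu'; lra. intros y Hy; apply HL; lra. lra.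
  - rewrite Rabs_left1 by lra. rewrite Cmod_sym. eapply Rle_trans. apply (Cder_bound u u' x 0 L); try lra.
    intros y Hy; apply Hu; lra. intros y Hy; apply Hu'; lra. intros y Hy; apply HL; lra. lra. }
assert (Hcw : Ccont_on w (- (1 / 2)) (1 / 2)) by (intros x Hx; eapply Ccont_Cder, Hw, Hx).
assert (Hcd : forall K, Ccont_on (fun x => RtoC (dirichlet K x) * w x)%C (- (1 / 2)) (1 / 2)).
{ intros K x Hx. apply Ccont_mult. apply Ccont_dirichlet. apply Hcw, Hx. }
intros eps He.
set (d := Rmin (1 / 4) (eps / (8 * (L + 1)))).
assert (Hd : 0 < d) by (apply Rmin_glb_lt; [lra|apply Rdiv_lt_0_compat; lra]).
assert (Hd1 : d <= 1 / 4) by apply Rmin_l. assert (Hd2 : d <= eps / (8 * (L + 1))) by apply Rmin_r.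
assert (HdL : 2 * d * L <= eps / 4).
{ apply Rle_trans with (2 * (eps / (8 * (L + 1))) * (L + 1)). nra. right. field. lra. }
assert (Hsin : forall x, d <= Rabs x -> - (1 / 2) <= x <= 1 / 2 -> sin (PI * x) <> 0).
{ intros x Hx Hx2 E. assert (H := Rabs_le_sin_PI x Hx2). rewrite E, Rabs_R0 in H. lra. }
assert (H1 := dirichlet_away w u' (- (1 / 2)) (- d) ltac:(lra)
  ltac:(intros x Hx; apply Hsin; [rewrite Rabs_left1|]; lra) ltac:(intros x Hx; apply Hw; lra)
  ltac:(intros x Hx; apply Hu'; lra) (eps / 4) ltac:(lra)).
assert (H2 := dirichlet_away w u' d (1 / 2) ltac:(lra)
  ltac:(intros x Hx; apply Hsin; [rewrite Rabs_pos_eq|]; lra) ltac:(intros x Hx; apply Hw; lra)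
  ltac:(intros x Hx; apply Hu'; lra) (eps / 4) ltac:(lra)).
generalize (filter_and _ _ H1 H2). apply filter_imp. clear H1 H2. intros K [H1 H2].
rewrite Cminus_0_r in H1, H2.
assert (E : (CInt (fun x => RtoC (dirichlet K x) * u x)%C (- (1 / 2)) (1 / 2) - u 0)%C
  = CInt (fun x => RtoC (dirichlet K x) * w x)%C (- (1 / 2)) (1 / 2)).
{ symmetry. apply is_CInt_unique.
  apply (is_CInt_ext (fun x => RtoC (dirichlet K x) * u x - u 0 * RtoC (dirichlet K x))%C); [lra| |].
  intros x _. unfold w. ring.
  replace (CInt (fun x => RtoC (dirichlet K x) * u x)%C (- (1 / 2)) (1 / 2) - u 0)%C with
    (CInt (fun x => RtoC (dirichlet K x) * u x)%C (- (1 / 2)) (1 / 2) - u 0 * RtoC 1)%C by ring.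
  apply is_CInt_minus.
  - apply is_CInt_cont. lra. intros x Hx. apply Ccont_mult. apply Ccont_dirichlet. eapply Ccont_Cder, Hu, Hx.
  - apply is_CInt_scal. apply is_CInt_pair; split. apply dirichlet_int.
    apply (is_RInt_ext (fun _ => 0)). intros; reflexivity.
    assert (H0 := is_RInt_const (V := R_NormedModule) (- (1 / 2)) (1 / 2) 0).
    exact (eq_ind _ (fun z => is_RInt (fun _ : R => 0) (- (1 / 2)) (1 / 2) z) H0 _ (Rmult_0_r (1 / 2 - - (1 / 2)))). }
rewrite E.
rewrite (CInt_Chasles _ (- (1 / 2)) (- d) (1 / 2)), (CInt_Chasles _ (- d) d (1 / 2));
  try lra; try (intros x Hx; apply Hcd; lra).
assert (H3 : Cmod (CInt (fun x => RtoC (dirichlet K x) * w x)%C (- d) d) <= (d - - d) * L).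
{ apply Cmod_CInt_const. lra. intros x Hx; apply Hcd; lra.
  intros x Hx. rewrite Cmod_mult, Cmod_R.
  destruct (Req_dec x 0) as [E0|E0].
  - assert (H0 := Hwl x ltac:(lra)). rewrite E0, Rabs_R0, Rmult_0_r in H0. rewrite E0.
    assert (E1 : Cmod (w 0) = 0) by (apply Rle_antisym; [exact H0|apply Cmod_ge_0]). rewrite E1. lra.
  - assert (H0 : Rabs x * Rabs (dirichlet K x) <= 1).
    { eapply Rle_trans. apply Rmult_le_compat_r. apply Rabs_pos. apply Rabs_le_sin_PI; lra.
      rewrite <- Rabs_mult, sin_dirichlet. apply Rabs_le, SIN_bound. }
    eapply Rle_trans. apply Rmult_le_compat_l. apply Rabs_pos. apply Hwl; lra.
    generalize (Rabs_pos (dirichlet K x)). nra. }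
set (I1 := CInt _ (- (1 / 2)) (- d)) in *. set (I2 := CInt _ (- d) d) in *. set (I3 := CInt _ d (1 / 2)) in *.
generalize (Cmod_triangle I1 (I2 + I3)) (Cmod_triangle I2 I3). lra.
Qed.

Lemma Chasles_Csm (f : R -> C) (a : nat -> R) (n : nat) :
  (forall k, (k < n)%nat -> a k <= a (S k)) -> Ccont_on f (a O) (a n) ->
  (forall k, (k <= n)%nat -> a O <= a k <= a n) ->
  Csm (fun k => CInt f (a k) (a (S k))) n = CInt f (a O) (a n).
Proof.
intros Hmono Hf Hin.
assert (H : forall m, (m <= n)%nat -> Csm (fun k => CInt f (a k) (a (S k))) m = CInt f (a O) (a m)).
{ induction m as [|m IH]; intros Hm; simpl.
  - symmetry. apply (RInt_point (V := C_R_CompleteNormedModule)).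
  - rewrite IH by lia. symmetry. apply CInt_Chasles. apply Hin; lia. apply Hmono; lia.
    intros x Hx. apply Hf. generalize (Hin (S m) Hm). lra. }
apply H. lia.
Qed.

(** The interval is cut into unit intervals centred at integers, one peak of the kernel in each;
    half-integer ends give every integer full weight. *)
Lemma dirichlet_sum (f f' : R -> C) (m n : nat) :
  (forall x, INR m + 1 / 2 <= x <= INR m + 1 / 2 + INR n -> Cder f x (f' x)) ->
  Ccont_on f' (INR m + 1 / 2) (INR m + 1 / 2 + INR n) ->
  Clim eventually (fun K => CInt (fun x => RtoC (dirichlet K x) * f x)%C (INR m + 1 / 2) (INR m + 1 / 2 + INR n))
    (Csm (fun k => f (INR (m + S k))) n).
Proof.
intros Hf Hf'.
assert (Hn := pos_INR n).
apply (Clim_ext eventually (fun K => Csm (fun k => CInt (fun x => RtoC (dirichlet K x) * f x)%C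
  (INR m + 1 / 2 + INR k) (INR m + 1 / 2 + INR (S k))) n)).
- exists O. intros K _.
  rewrite (Chasles_Csm _ (fun k => INR m + 1 / 2 + INR k)).
  + simpl INR. rewrite Rplus_0_r. reflexivity.
  + intros k _. rewrite S_INR. lra.
  + simpl INR. rewrite Rplus_0_r. intros x Hx. apply Ccont_mult. apply Ccont_dirichlet. eapply Ccont_Cder, Hf, Hx.
  + intros k Hk. apply le_INR in Hk. generalize (pos_INR k). simpl. lra.
- apply (Csm_Clim eventually). intros k Hk.
  assert (Hkn : INR (S k) <= INR n) by (apply le_INR; lia). rewrite S_INR in Hkn.
  assert (Hk0 := pos_INR k).
  set (c := INR (m + S k)). assert (Ec : c = INR m + 1 + INR k) by (unfold c; rewrite plus_INR, S_INR; ring).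
  assert (H := dirichlet_lim (fun x => f (x + c)) (fun x => f' (x + c))).
  cbv beta in H. rewrite Rplus_0_l in H.
  apply (Clim_ext eventually (fun K => CInt (fun x => RtoC (dirichlet K x) * f (x + c)%R)%C (- (1 / 2)) (1 / 2))).
  + exists O. intros K _. rewrite S_INR.
    assert (HI : is_CInt (fun y => 1 * (RtoC (dirichlet K (1 * y + c)) * f (1 * y + c)%R))%C (- (1 / 2)) (1 / 2)
      (CInt (fun x => RtoC (dirichlet K x) * f x)%C (INR m + 1 / 2 + INR k) (INR m + 1 / 2 + (INR k + 1)))).
    { apply (is_CInt_comp_lin (fun x => RtoC (dirichlet K x) * f x)%C 1 c).
      replace (1 * - (1 / 2) + c) with (INR m + 1 / 2 + INR k) by (rewrite Ec; field).
      replace (1 * (1 / 2) + c) with (INR m + 1 / 2 + (INR k + 1)) by (rewrite Ec; field).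
      apply is_CInt_cont. lra. intros x Hx. apply Ccont_mult. apply Ccont_dirichlet.
      eapply Ccont_Cder, Hf. lra. }
    apply is_CInt_unique in HI. rewrite <- HI. apply CInt_ext. lra.
    intros x _. rewrite Rmult_1_l. unfold c at 2. rewrite dirichlet_shift. fold c. ring.
  + apply H.
    * intros x Hx. eapply Cder_eq. apply (Cder_comp f (fun x => x + c)). apply Hf. rewrite Ec; lra.
      auto_derive. exact I. reflexivity. ring.
    * intros x Hx. apply (Ccont_comp f'). apply @ex_derive_continuous. auto_derive. exact I.
      apply Hf'. rewrite Ec; lra.
Qed.

Definition osc2 (s : C) (k : nat) (a b : R) : C := (CInt (osc s (freq k)) a b + CInt (osc s (- freq k)) a b)%C.

Lemma dirichlet_osc (s : C) (K : nat) (a b : R) : 0 < a <= b ->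
  CInt (fun x => RtoC (dirichlet K x) * Rcpow x (- s))%C a b
   = (CInt (fun x => Rcpow x (- s)) a b + Csm (fun k => osc2 s k a b) K)%C.
Proof.
intros Hab.
assert (Hcr : Ccont_on (fun x => Rcpow x (- s)) a b) by (intros x Hx; apply Ccont_Rcpow; lra).
induction K as [|K IH].
- simpl. rewrite Cplus_0_r. apply CInt_ext. lra. intros; ring.
- simpl Csm. rewrite Cplus_assoc, <- IH. apply is_CInt_unique. unfold osc2.
  apply (is_CInt_ext (fun x => RtoC (dirichlet K x) * Rcpow x (- s) + (osc s (freq K) x + osc s (- freq K) x))%C); [lra| |].
  + intros x _. simpl dirichlet. rewrite RtoC_plus.
    assert (E : (Cexp (Ci * (freq K * x)%R) + Cexp (Ci * (- freq K * x)%R))%C = RtoC (2 * cos (freq K * x))).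
    { replace (Ci * (freq K * x)%R)%C with ((0, freq K * x)) by (apply Ceq; simpl; ring).
      replace (Ci * (- freq K * x)%R)%C with ((0, - (freq K * x))) by (apply Ceq; simpl; ring).
      unfold Cexp; simpl. rewrite exp_0, cos_neg, sin_neg. apply Ceq; simpl; ring. }
    rewrite <- E. unfold osc. ring.
  + apply is_CInt_plus; [|apply is_CInt_plus]; apply is_CInt_cont; try lra.
    * intros x Hx. apply Ccont_mult. apply Ccont_dirichlet. apply Hcr, Hx.
    * apply Ccont_on_osc; lra.
    * apply Ccont_on_osc; lra.
Qed.

(** Both sides are the sign (-1)^(k+1). *)
Lemma cycle_half (k n : nat) : cycle (freq k) (INR n + 1 / 2) = cycle (- freq k) (INR n + 1 / 2).
Proof.
destruct (cycle_freq k) as [H1 H2].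
rewrite (Rplus_comm (INR n)), !cycle_plus, !cycle_INR by assumption.
assert (E : (cycle (freq k) (1 / 2) * cycle (freq k) (1 / 2) = 1)%C).
{ rewrite <- cycle_plus. replace (1 / 2 + 1 / 2) with 1 by field. exact H1. }
assert (E2 : (cycle (freq k) (1 / 2) * cycle (- freq k) (1 / 2) = 1)%C).
{ unfold cycle. rewrite <- Cexp_plus. replace (_ + _)%C with (RtoC 0). apply Cexp_0.
  apply Ceq; simpl; ring. }
rewrite !Cmult_1_r. set (u := cycle (freq k) (1 / 2)) in *. set (v := cycle (- freq k) (1 / 2)) in *.
replace v with (u * u * v)%C by (rewrite E; ring).
replace (u * u * v)%C with (u * (u * v))%C by ring. rewrite E2. ring.
Qed.

(* At half-integers [sin (2 pi k x) = 0], so the integrated terms vanish. *)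
Lemma osc2_parts (s : C) (k m n : nat) : (m <= n)%nat ->
  osc2 s k (INR m + 1 / 2) (INR n + 1 / 2) =
   (s / (Ci * freq k) * (CInt (osc (s + 1) (freq k)) (INR m + 1 / 2) (INR n + 1 / 2)
      - CInt (osc (s + 1) (- freq k)) (INR m + 1 / 2) (INR n + 1 / 2)))%C.
Proof.
intros Hmn. apply le_INR in Hmn. assert (Hm := pos_INR m). assert (Hf := freq_pos k).
set (l := freq k) in *. set (a := INR m + 1 / 2). set (b := INR n + 1 / 2).
assert (Hab : 0 < a <= b) by (unfold a, b; lra).
assert (HlC : RtoC l <> 0) by (intros E; apply RtoC_inj in E; lra).
set (c := (s / (Ci * l))%C).
assert (Hd : forall x, a <= x <= b ->
  Cder (fun y => / (Ci * l) * (osc s l y - osc s (- l) y))%C x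
    ((osc s l x + osc s (- l) x) - c * (osc (s + 1) l x - osc (s + 1) (- l) x))%C).
{ intros x Hx. eapply Cder_eq. apply Cder_scal, Cder_minus; apply Cder_osc; lra.
  assert (E : forall mu, osc (s + 1) mu x = (RtoC (/ x) * osc s mu x)%C).
  { intros mu. unfold osc. replace (- (s + 1))%C with (- s + - (1))%C by ring.
    rewrite Rcpow_plus, (Rcpow_opp x 1), Rcpow_1, RtoC_inv by lra. ring. }
  rewrite !E. unfold c. rewrite RtoC_opp. field. split. exact HlC. apply Ci_nz. }
assert (Hc1 : forall w mu, Ccont_on (osc w mu) a b) by (intros; apply Ccont_on_osc; lra).
assert (H : is_CInt (fun x => (osc s l x + osc s (- l) x) - c * (osc (s + 1) l x - osc (s + 1) (- l) x))%C a b
   (osc2 s k a b - c * (CInt (osc (s + 1) l) a b - CInt (osc (s + 1) (- l)) a b))%C).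
{ unfold osc2. fold l. apply is_CInt_minus. apply is_CInt_plus; apply is_CInt_cont; auto; lra.
  apply is_CInt_scal, is_CInt_minus; apply is_CInt_cont; auto; lra. }
apply is_CInt_unique in H.
rewrite (CInt_Cder _ _ a b (proj2 Hab) Hd) in H.
2:{ intros x Hx. apply Ccont_minus. apply Ccont_plus; apply Hc1, Hx.
    apply Ccont_mult. apply Ccont_const. apply Ccont_minus; apply Hc1, Hx. }
assert (Hz : forall j, osc s l (INR j + 1 / 2) = osc s (- l) (INR j + 1 / 2)).
{ intros j. unfold osc. f_equal. apply (cycle_half k j). }
assert (Ha : osc s l a = osc s (- l) a) by apply Hz.
assert (Hb : osc s l b = osc s (- l) b) by apply Hz.
rewrite Ha, Hb in H.
apply Ceq_minus. rewrite <- H. ring.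
Qed.

(** * The approximate functional equation *)

Fixpoint harm (n : nat) : R := match n with O => 0 | S k => harm k + / (INR k + 1) end.

Lemma harm_le (n : nat) : harm (S n) <= 1 + ln (INR n + 1).
Proof.
induction n as [|n IH].
- simpl. replace (0 + 1) with 1 by ring. rewrite ln_1, Rinv_1. lra.
- change (harm (S (S n))) with (harm (S n) + / (INR (S n) + 1)). rewrite S_INR.
  assert (Hn := pos_INR n).
  assert (H : / (INR n + 1 + 1) <= ln (INR n + 1 + 1) - ln (INR n + 1)).
  { assert (H0 := exp_ineq1_le (ln ((INR n + 1) / (INR n + 1 + 1)))).
    rewrite exp_ln in H0 by (apply Rdiv_lt_0_compat; lra).
    rewrite ln_div in H0 by lra.
    replace ((INR n + 1) / (INR n + 1 + 1)) with (1 - / (INR n + 1 + 1)) in H0 by (field; lra). lra. }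
  lra.
Qed.

Lemma harm_mono (m n : nat) : (m <= n)%nat -> harm m <= harm n.
Proof.
intros H. induction H as [|n H IH]. lra. simpl.
assert (0 < / (INR n + 1)) by (apply Rinv_0_lt_compat; generalize (pos_INR n); lra). lra.
Qed.

Lemma harm_ge_1 (n : nat) : (1 <= n)%nat -> 1 <= harm n.
Proof. intros H. apply Rle_trans with (harm 1). simpl. replace (0 + 1) with 1 by ring. rewrite Rinv_1; lra. apply harm_mono, H. Qed.

(** M is the integer part of N, large enough for the numerical inequalities that follow. *)
Definition setup (t : R) (M : nat) : Prop :=
  800 <= t /\ 10 <= INR M /\ 2 * PI * (INR M * INR M) <= t < 2 * PI * ((INR M + 1) * (INR M + 1)).

Lemma PI_gt_3 : 3 < PI.
Proof. generalize PI2_3_2; lra. Qed.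

Lemma setup_floor (t : R) : 800 <= t -> setup t (floor_nat (sqrt (t / (2 * PI)))).
Proof.
intros Ht. assert (HP := PI_gt_3). assert (HP4 := PI_4).
set (N := sqrt (t / (2 * PI))).
(* As 2 pi <= 8, the threshold 800 is what guarantees N >= 10. *)
assert (Hq : 100 <= t / (2 * PI)).
{ apply Rmult_le_reg_r with (2 * PI). lra. unfold Rdiv. rewrite Rmult_assoc, Rinv_l by lra. nra. }
assert (HNN : N * N = t / (2 * PI)) by (apply sqrt_sqrt; lra).
assert (HN0 : 0 <= N) by apply sqrt_pos.
assert (HN : 10 <= N) by nra.
assert (Ht2 : t = 2 * PI * (N * N)) by (rewrite HNN; field; lra).
assert (HM : INR (floor_nat N) <= N < INR (floor_nat N) + 1).
{ unfold floor_nat. destruct (base_Int_part N) as [H1 H2].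
  rewrite INR_IZR_INZ, Z2Nat.id. lra.
  apply le_IZR. assert (-1 < IZR (Int_part N)) by lra. apply IZR_le.
  assert ((-1 < Int_part N)%Z) by (apply lt_IZR; exact H). lia. }
set (M := floor_nat N) in *.
assert (HM10 : 10 <= INR M).
{ replace 10 with (INR 10) by (simpl; ring). apply le_INR.
  assert (H9 : INR 9 = 9) by (simpl; ring). assert (H : INR 9 < INR M) by (rewrite H9; destruct HM; lra). apply INR_lt in H. lia. }
assert (HM0 : 0 <= INR M) by lra. destruct HM as [HMa HMb].
assert (INR M * INR M <= N * N) by (apply Rmult_le_compat; lra).
assert (N * N < (INR M + 1) * (INR M + 1)) by (apply Rmult_le_0_lt_compat; lra).
split; [exact Ht|]. split; [exact HM10|]. rewrite Ht2. split.
apply Rmult_le_compat_l; lra. apply Rmult_lt_compat_l; lra.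
Qed.

Lemma Rpower_le_l (p a b : R) : 0 <= p -> 0 < a <= b -> Rpower a p <= Rpower b p.
Proof. intros; apply Rle_Rpower_l; assumption. Qed.

Lemma Rpower_1_sub (x p : R) : 0 < x -> Rpower x (1 - p) = x * Rpower x (- p).
Proof. intros Hx. unfold Rminus. rewrite Rpower_plus, Rpower_1 by exact Hx. reflexivity. Qed.

Lemma Rpower_double_le (x p : R) : 0 < x -> 0 <= p <= 1 -> Rpower (2 * x) p <= 2 * Rpower x p.
Proof.
intros Hx Hp. rewrite <- Rpower_mult_distr by lra. apply Rmult_le_compat_r. left; apply exp_pos.
rewrite <- (Rpower_1 2) at 2 by lra. apply Rle_Rpower; lra.
Qed.

Lemma Rpower_half_le (x p : R) : 0 < x -> 0 <= p <= 1 -> Rpower (x / 2) (- p) <= 2 * Rpower x (- p).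
Proof.
intros Hx Hp. unfold Rdiv. rewrite <- Rpower_mult_distr by lra. rewrite Rmult_comm.
apply Rmult_le_compat_r. left; apply exp_pos.
replace (Rpower (/ 2) (- p)) with (Rpower 2 p) by (unfold Rpower; rewrite ln_Rinv by lra; f_equal; ring).
rewrite <- (Rpower_1 2) at 2 by lra. apply Rle_Rpower; lra.
Qed.

Lemma Rdiv_le_intro (a b c : R) : 0 < b -> a <= c * b -> a / b <= c.
Proof.
intros Hb H. apply Rmult_le_reg_r with b. exact Hb. unfold Rdiv. rewrite Rmult_assoc, Rinv_l; lra.
Qed.

(* The harmonic [k + 1 = M - j] has its stationary point at distance about [j] beyond [M]. *)
Lemma osc_initial (sigma t X : R) (M j k : nat) : setup t M -> 0 < sigma < 1 ->
  INR M + 1 <= X <= INR M + 5 / 2 -> (k + 1 + j = M)%nat ->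
  Cmod (CInt (osc (sigma, t) (freq k)) 1 X) <= 33 * Rpower (INR M) (- sigma) * / (INR j + 1).
Proof.
intros [Ht [HM [HMt _]]] Hs HX Hk. set (m := INR M) in *. assert (HP := PI_gt_3).
assert (Hj := pos_INR j).
assert (Ek : freq k = 2 * PI * (m - INR j)).
{ unfold freq, m. rewrite <- Hk, !plus_INR. simpl INR. ring. }
assert (Hjm : INR j <= m - 1).
{ unfold m. rewrite <- Hk, !plus_INR. simpl INR. generalize (pos_INR k). lra. }
set (P := Rpower m (- sigma)). assert (HPp : 0 < P) by apply exp_pos.
assert (Hij : 0 < / (INR j + 1)) by (apply Rinv_0_lt_compat; lra).
(* X may lie 5/2 beyond M, so a gap of order (j + 1) M is available from j = 3 on. For j <= 2 the
   last 5 units are bounded trivially by 10 P and the rest by P; 11 P = 33 P / 3 is the origin of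
   33. *)
destruct (Nat.le_gt_cases 3 j) as [Hj3|Hj3].
- assert (H3 : 3 <= INR j) by (apply le_INR in Hj3; simpl in Hj3; lra).
  assert (Hgap : 3 / 4 * (INR j + 1) * m <= t - freq k * X).
  { rewrite Ek.
    apply Rle_trans with (2 * PI * (m * m - (m - INR j) * (m + 5 / 2))).
    - assert (H1 : (INR j + 1) * m / 8 <= m * m - (m - INR j) * (m + 5 / 2)) by nra.
      assert (H2 : 0 <= (INR j + 1) * m / 8) by nra.
      apply Rle_trans with (2 * PI * ((INR j + 1) * m / 8)). nra. apply Rmult_le_compat_l; lra.
    - assert (2 * PI * ((m - INR j) * X) <= 2 * PI * ((m - INR j) * (m + 5 / 2))).
      { apply Rmult_le_compat_l. lra. apply Rmult_le_compat_l; lra. }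
      lra. }
  assert (H0 : 0 < 3 / 4 * (INR j + 1) * m) by nra.
  eapply Rle_trans. apply osc_below; try lra. left; apply freq_pos.
  assert (HXp : Rpower X (1 - sigma) <= 2 * (m * P)).
  { unfold P. rewrite <- Rpower_1_sub by lra. eapply Rle_trans; [|apply Rpower_double_le; lra].
    apply Rpower_le_l; lra. }
  apply Rdiv_le_intro. lra.
  apply Rle_trans with (33 * P * / (INR j + 1) * (3 / 4 * (INR j + 1) * m)).
  + replace (33 * P * / (INR j + 1) * (3 / 4 * (INR j + 1) * m)) with (33 * 3 / 4 * (m * P)) by (field; lra).
    assert (0 < m * P) by nra. lra.
  + apply Rmult_le_compat_l. nra. lra.
- assert (H3 : INR j <= 2) by (replace 2 with (INR 2) by reflexivity; apply le_INR; lia).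
  assert (H13 : / 3 <= / (INR j + 1)) by (apply Rinv_le_contravar; lra).
  rewrite (CInt_Chasles _ 1 (X - 5) X); try lra. 2: apply Ccont_on_osc; lra.
  assert (Hgap : 15 * m <= t - freq k * (X - 5)).
  { rewrite Ek.
    assert (2 * PI * ((m - INR j) * (X - 5)) <= 2 * PI * (m * (m - 5 / 2))).
    { apply Rmult_le_compat_l. lra. apply Rmult_le_compat; lra. }
    assert (15 * m <= 2 * PI * (m * (5 / 2))) by nra. nra. }
  assert (H1 : Cmod (CInt (osc (sigma, t) (freq k)) 1 (X - 5)) <= P).
  { eapply Rle_trans. apply osc_below; try lra. left; apply freq_pos.
    assert (HXp : Rpower (X - 5) (1 - sigma) <= m * P).
    { unfold P. rewrite <- Rpower_1_sub by lra. apply Rpower_le_l; lra. }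
    apply Rdiv_le_intro. lra. assert (0 < m * P) by nra.
    apply Rle_trans with (P * (15 * m)). lra. apply Rmult_le_compat_l; lra. }
  assert (H2 : Cmod (CInt (osc (sigma, t) (freq k)) (X - 5) X) <= 10 * P).
  { eapply Rle_trans. apply (Cmod_CInt_const _ _ _ (2 * P)). lra. apply Ccont_on_osc; lra.
    intros x Hx. rewrite Cmod_osc. simpl Re.
    eapply Rle_trans; [|apply Rpower_half_le; lra]. apply Rpower_opp_le; lra. lra. }
  eapply Rle_trans. apply Cmod_triangle.
  assert (33 * P * / 3 <= 33 * P * / (INR j + 1)) by (apply Rmult_le_compat_l; lra). lra.
Qed.

Lemma osc_initial_sum (sigma t X : R) (M : nat) : setup t M -> 0 < sigma < 1 ->
  INR M + 1 <= X <= INR M + 5 / 2 ->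
  Cmod (Csm (fun k => CInt (osc (sigma, t) (freq k)) 1 X) M) <= 33 * Rpower (INR M) (- sigma) * harm M.
Proof.
intros HS Hs HX. set (P := 33 * Rpower (INR M) (- sigma)).
(* The bounds 1 / (j + 1), with j = M - 1 - k, decrease in j and so are summed backwards in k. *)
eapply Rle_trans. apply (Csm_Cmod_le _ (fun k => - (P * harm (M - k)))).
- intros k Hk. eapply Rle_trans. apply (osc_initial sigma t X M (M - S k) k HS Hs HX). lia.
  fold P. replace (M - k)%nat with (S (M - S k)) by lia. simpl harm. lra.
- rewrite Nat.sub_diag, Nat.sub_0_r. simpl harm. lra.
Qed.

Lemma osc_negative_sum (sigma t X Y : R) (M : nat) : setup t M -> 0 < sigma < 1 ->
  INR M <= X <= Y ->
  Cmod (Csm (fun k => CInt (osc (sigma, t) (- freq k)) X Y) M)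
    <= (2 + 3 / sigma) * Rpower (INR M) (- sigma) * harm M.
Proof.
intros [Ht [HM _]] Hs HX. assert (HP := PI_gt_3).
set (P := (2 + 3 / sigma) * Rpower (INR M) (- sigma)).
assert (Hc : 0 < 3 / sigma) by (apply Rdiv_lt_0_compat; lra).
assert (HP0 : 0 < P) by (apply Rmult_lt_0_compat; [lra|apply exp_pos]).
eapply Rle_trans. apply (Csm_Cmod_le _ (fun k => P * harm k)).
- intros k Hk. eapply Rle_trans. apply osc_negative; try lra. apply freq_pos.
  assert (Hk0 := pos_INR k).
  simpl harm. apply Rle_trans with (P * / (INR k + 1)); [|lra].
  unfold Rdiv. apply Rmult_le_compat.
  + apply Rmult_le_pos. lra. left; apply exp_pos.
  + left; apply Rinv_0_lt_compat, freq_pos.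
  + apply Rmult_le_compat_l. lra. apply Rpower_opp_le; lra.
  + apply Rinv_le_contravar. lra. unfold freq. nra.
- simpl harm. lra.
Qed.

(** Put i = k - M + 1. The integration by parts of [osc2_parts] costs |s| / l, of order M^2 / (M +
    i), and lowers the power of x by one; the gap at the left end is at least 2 pi i M. The product
    is of order M / (i (M + i)) = 1/i - 1/(M + i), which telescopes over k. *)
Lemma osc2_far (sigma t : R) (M k n : nat) : setup t M -> 0 < sigma < 1 -> (M <= k)%nat -> (M + 2 <= n)%nat ->
  Cmod (osc2 (sigma, t) k (INR (M + 2) + 1 / 2) (INR n + 1 / 2))
   <= 8 * Rpower (INR M) (- sigma) * (/ (INR (k - M) + 1) - / (INR k + 1)).
Proof.
intros [Ht [HM [HMt HMt2]]] Hs Hk Hn. assert (HP := PI_gt_3).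
rewrite osc2_parts by exact Hn.
set (m := INR M) in *. set (X := INR (M + 2) + 1 / 2). set (Y := INR n + 1 / 2).
assert (EX : X = m + 5 / 2) by (unfold X; rewrite plus_INR; simpl (INR 2); fold m; field).
assert (HXY : X <= Y) by (apply le_INR in Hn; unfold X, Y; lra).
set (i := INR (k - M) + 1). assert (Hi : 1 <= i) by (unfold i; generalize (pos_INR (k - M)); lra).
assert (Ei : INR k + 1 = m + i) by (unfold i, m; rewrite minus_INR by exact Hk; ring).
assert (Ef : freq k = 2 * PI * (m + i)) by (unfold freq; rewrite Ei; ring).
assert (Hf := freq_pos k). set (l := freq k) in *.
set (P := Rpower m (- sigma)). assert (HP0 : 0 < P) by apply exp_pos.
assert (E1 : ((sigma, t) + 1)%C = ((sigma + 1)%R, t)) by (apply Ceq; simpl; ring).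
rewrite E1.
assert (HXs : Rpower X (- sigma) <= P) by (apply Rpower_opp_le; lra).
(* As t < 2 pi (M + 1)^2, the start M + 5/2 leaves (M + i)(M + 5/2) - (M + 1)^2 >= i M for every i
   >= 1. *)
assert (Hgap : 2 * PI * (i * m) <= l * X - t).
{ rewrite Ef, EX. apply Rle_trans with (2 * PI * ((m + i) * (m + 5 / 2) - (m + 1) * (m + 1))); [|lra].
  apply Rmult_le_compat_l. lra. nra. }
assert (Him : 0 < i * m) by nra.
assert (H1 : Cmod (CInt (osc ((sigma + 1)%R, t) l) X Y) <= P / (3 * (i * m))).
{ eapply Rle_trans. apply osc_above; try lra. nra.
  replace (1 - (sigma + 1)) with (- sigma) by ring.
  apply Rdiv_le_intro. nra.
  apply Rle_trans with (P / (3 * (i * m)) * (6 * (i * m))).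
  replace (P / (3 * (i * m)) * (6 * (i * m))) with (2 * P) by (field; split; nra). lra.
  apply Rmult_le_compat_l. left; apply Rdiv_lt_0_compat; nra. nra. }
assert (H2 : Cmod (CInt (osc ((sigma + 1)%R, t) (- l)) X Y) <= P / (i * m)).
{ eapply Rle_trans. apply osc_negative; lra.
  replace (- (sigma + 1)) with (- sigma + - (1)) by ring. rewrite Rpower_plus, (Rpower_Ropp X 1), Rpower_1 by lra.
  assert (H3 : 3 / (sigma + 1) <= 3) by (apply Rdiv_le_intro; lra).
  assert (H30 : 0 < 3 / (sigma + 1)) by (apply Rdiv_lt_0_compat; lra).
  apply Rdiv_le_intro. exact Hf.
  apply Rle_trans with (5 * (P * / m)).
  - apply Rmult_le_compat. lra. apply Rmult_le_pos. left; apply exp_pos. left; apply Rinv_0_lt_compat; lra. lra.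
    apply Rmult_le_compat. left; apply exp_pos. left; apply Rinv_0_lt_compat; lra. exact HXs.
    apply Rinv_le_contravar; lra.
  - apply Rle_trans with (P / (i * m) * (6 * i)).
    replace (P / (i * m) * (6 * i)) with (6 * (P * / m)) by (field; lra).
    assert (0 < P * / m) by (apply Rmult_lt_0_compat; [lra|apply Rinv_0_lt_compat; lra]). lra.
    apply Rmult_le_compat_l. left; apply Rdiv_lt_0_compat; lra. rewrite Ef. nra. }
assert (Hcl : (Ci * l)%C <> 0).
{ apply Cmult_neq_0. apply Ci_nz. intros E; apply RtoC_inj in E; lra. }
assert (Hmc : Cmod (Ci * l)%C = l).
{ rewrite Cmod_mult, Cmod_Ci, Cmod_R, Rabs_pos_eq; lra. }
rewrite Cmod_mult, Cmod_div, Hmc by exact Hcl.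
assert (Hcs : Cmod (sigma, t) / l <= 4 * m * m / (m + i)).
{ apply Rdiv_le_intro. exact Hf. rewrite Ef.
  replace (4 * m * m / (m + i) * (2 * PI * (m + i))) with (2 * PI * (4 * (m * m))) by (field; lra).
  assert (H : Cmod (sigma, t) <= 2 * t).
  { replace (sigma, t) with (RtoC sigma + RtoC t * Ci)%C by (apply Ceq; simpl; ring).
    eapply Rle_trans. apply Cmod_triangle. rewrite Cmod_mult, Cmod_Ci, !Cmod_R, !Rabs_pos_eq; lra. }
  assert ((m + 1) * (m + 1) <= 2 * (m * m)) by nra.
  assert (2 * PI * ((m + 1) * (m + 1)) <= 2 * PI * (2 * (m * m))) by (apply Rmult_le_compat_l; lra). lra. }
apply Rle_trans with (4 * m * m / (m + i) * (2 * (P / (i * m)))).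
- apply Rmult_le_compat; auto. apply Rmult_le_pos. apply Cmod_ge_0. left; apply Rinv_0_lt_compat, Hf.
  apply Cmod_ge_0. eapply Rle_trans. apply Cmod_minus_le.
  assert (P / (3 * (i * m)) = / 3 * (P / (i * m))) by (field; lra).
  assert (0 < P / (i * m)) by (apply Rdiv_lt_0_compat; lra). lra.
- rewrite Ei. right. field. lra.
Qed.

Lemma Csm_split (u : nat -> C) (m n : nat) : Csm u (m + n) = (Csm u m + Csm (fun i => u (m + i)%nat) n)%C.
Proof.
induction n as [|n IH]. rewrite Nat.add_0_r. simpl. ring.
rewrite Nat.add_succ_r. simpl. rewrite IH. ring.
Qed.

(** The negative frequencies below M contribute 2 + 3 / sigma and the pairs from M on contribute 8.
    The bound involves neither K nor n, so both may tend to infinity. *)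
Lemma osc2_sum (sigma t : R) (M K n : nat) : setup t M -> 0 < sigma < 1 -> (M <= K)%nat -> (M + 2 <= n)%nat ->
  Cmod (Csm (fun k => osc2 (sigma, t) k (INR (M + 2) + 1 / 2) (INR n + 1 / 2)) K
    - Csm (fun k => CInt (osc (sigma, t) (freq k)) (INR (M + 2) + 1 / 2) (INR n + 1 / 2)) M)%C
   <= (10 + 3 / sigma) * Rpower (INR M) (- sigma) * harm M.
Proof.
intros HS Hs HK Hn. set (X := INR (M + 2) + 1 / 2). set (Y := INR n + 1 / 2).
assert (HXY : INR M <= X <= Y).
{ apply le_INR in Hn. unfold X, Y. rewrite plus_INR in *. simpl (INR 2) in *. lra. }
replace K with (M + (K - M))%nat by lia. rewrite Csm_split.
replace (Csm (fun k => osc2 (sigma, t) k X Y) M) with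
  (Csm (fun k => CInt (osc (sigma, t) (freq k)) X Y) M + Csm (fun k => CInt (osc (sigma, t) (- freq k)) X Y) M)%C
  by (rewrite <- Csm_plus; reflexivity).
set (P := Rpower (INR M) (- sigma)). assert (HP0 : 0 < P) by apply exp_pos.
assert (H1 := osc_negative_sum sigma t X Y M HS Hs HXY). fold P in H1.
assert (H2 : Cmod (Csm (fun i => osc2 (sigma, t) (M + i) X Y) (K - M)) <= 8 * P * harm M).
{ eapply Rle_trans. apply (Csm_Cmod_le _ (fun i => 8 * P * (harm i - harm (M + i)))).
  - intros i Hi. eapply Rle_trans. apply (osc2_far sigma t M (M + i) n HS Hs); lia.
    fold P. replace (M + i - M)%nat with i by lia. rewrite Nat.add_succ_r. simpl harm. lra.
  - rewrite Nat.add_0_r. simpl harm.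
    (* The telescoped sum is harm (K - M) - harm K + harm M, so at most harm M is left however large
       K is. *)
    assert (harm (K - M) <= harm (M + (K - M))) by (apply harm_mono; lia). nra. }
set (A := Csm (fun k => CInt (osc (sigma, t) (freq k)) X Y) M).
match goal with |- Cmod (A + ?u + ?v - A)%C <= _ => replace (A + u + v - A)%C with (u + v)%C by ring;
  generalize (Cmod_triangle u v) end.
assert (0 <= harm M) by (apply Rle_trans with (harm 0); [simpl; lra|apply harm_mono; lia]). lra.
Qed.

(** * Comparison of zeta(s) with the integrals over [1, oo) *)

Lemma Rcpow_int (s : C) (a b : R) : 0 < a <= b -> (1 - s)%C <> 0 ->
  CInt (fun x => Rcpow x (- s)) a b = ((Rcpow b (1 - s) - Rcpow a (1 - s)) / (1 - s))%C.
Proof.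
intros Hab Hs.
rewrite (CInt_Cder (fun x => / (1 - s) * Rcpow x (1 - s))%C).
- field. exact Hs.
- lra.
- intros x Hx. eapply Cder_eq. apply Cder_scal, Cder_Rcpow; lra.
  replace (1 - s - 1)%C with (- s)%C by ring. field. exact Hs.
- intros x Hx. apply Ccont_Rcpow; lra.
Qed.

(** The main terms come from [hurwitz_approx] at alpha = 0. V is the half step from m + n + 1/2 to m
    + n + 1, where that approximation ends; it tends to 0. *)
Lemma zeta_half_lim (zeta : C -> C) (sigma t : R) (m : nat) :
  is_riemann_zeta zeta -> 0 < sigma < 1 -> t <> 0 ->
  Clim eventually (fun n => Csm (fun k => Rcpow (INR (m + S k)) (- (sigma, t))) n
     - CInt (fun x => Rcpow x (- (sigma, t))) (INR m + 1 / 2) (INR m + 1 / 2 + INR n))%C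
   (zeta (sigma, t) - hsum 0 (sigma, t) m + Rcpow (INR m + 1 / 2) (1 - (sigma, t)) / (1 - (sigma, t)))%C.
Proof.
intros Hz Hs Ht. set (s := (sigma, t) : C). assert (Hm := pos_INR m).
assert (Hne : (1 - s)%C <> 0) by (intros E; apply (f_equal Im) in E; simpl in E; lra).
set (V := fun n => CInt (fun x => Rcpow x (- s)) (INR (m + n) + 1 / 2) (INR (m + n) + 1)).
apply (Clim_ext eventually (fun n => (hsum 0 s (m + n) - Rcpow (INR (m + n) + 1 + 0) (1 - s) / (1 - s))
   - hsum 0 s m + Rcpow (INR m + 1 / 2) (1 - s) / (1 - s) + V n)%C).
- exists O. intros n _. assert (Hn := pos_INR n). unfold V.
  rewrite !Rcpow_int; try assumption; try (rewrite ?plus_INR; lra).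
  unfold hsum. rewrite Csm_split.
  rewrite (Csm_ext (fun i => Rcpow (INR (m + i) + 1 + 0) (- s)) (fun k => Rcpow (INR (m + S k)) (- s))).
  2:{ intros k _. f_equal. rewrite Nat.add_succ_r, S_INR. ring. }
  replace (INR (m + n) + 1 + 0) with (INR (m + n) + 1) by ring.
  replace (INR (m + n) + 1 / 2) with (INR m + 1 / 2 + INR n) by (rewrite plus_INR; ring).
  field. exact Hne.
- rewrite <- (Cplus_0_r (zeta s - _ + _)). apply (Clim_plus eventually).
  apply (Clim_plus eventually); [|apply (Clim_const eventually)].
  apply (Clim_minus eventually); [|apply (Clim_const eventually)].
  + apply (Clim_squeeze eventually) with (fun n => Kh s (sigma / 2) / Cmod (1 - s)%C * Rpower (INR n + 1) (- (sigma / 2))).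
    * exists O. intros n _. rewrite Cmod_sym. eapply Rle_trans.
      apply (hurwitz_approx 0 (Rle_refl 0) zeta sigma t (m + n)); try assumption; try lra.
      { destruct Hz as [H1 H2]. split; [|exact H2]. intros w Hw.
        apply is_series_Clim.
        assert (H := proj1 (is_series_Clim _ _) (H1 w Hw)).
        apply (Clim_ext eventually) with (2 := H). exists O. intros i _. apply Csm_ext.
        intros k _. rewrite Rplus_0_r. reflexivity. }
      apply Rmult_le_compat_l.
      { apply Rmult_le_pos. apply Kh_nonneg; simpl; lra. left; apply Rinv_0_lt_compat, Cmod_gt_0, Hne. }
      assert (Hn := pos_INR n). apply Rpower_opp_le. lra. rewrite plus_INR. lra.
    * assert (H := is_lim_seq_scal_l _ (Kh s (sigma / 2) / Cmod (1 - s)%C) _ (is_lim_seq_Rpower (sigma / 2) ltac:(lra))).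
      simpl in H. rewrite Rmult_0_r in H. exact H.
  + apply (Clim_squeeze eventually) with (fun n => 2 * Rpower (INR n + 1) (- sigma)).
    * exists O. intros n _. rewrite Cminus_0_r. assert (Hn := pos_INR n). unfold V.
      assert (Hp : 0 < Rpower (INR n + 1) (- sigma)) by apply exp_pos.
      assert (Hmn : INR n <= INR (m + n)) by (rewrite plus_INR; lra).
      eapply Rle_trans. apply (Cmod_CInt_const _ _ _ (2 * Rpower (INR n + 1) (- sigma))). lra.
      intros x Hx. apply Ccont_Rcpow; lra.
      intros x Hx. rewrite Cmod_Rcpow. simpl Re. eapply Rle_trans; [|apply Rpower_half_le; lra].
      apply Rpower_opp_le; lra. lra.
    * assert (H := is_lim_seq_scal_l _ 2 _ (is_lim_seq_Rpower sigma ltac:(lra))).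
      simpl in H. rewrite Rmult_0_r in H. exact H.
Qed.

(** Moves the ends from integers to half-integers, again at the price of a vanishing half step V. *)
Lemma osc_half_lim (s A : C) (k m : nat) : 0 < Re s < 1 ->
  Clim eventually (fun n => CInt (osc s (freq k)) 1 (INR n + 1)) A -> (1 <= m)%nat ->
  Clim eventually (fun n => CInt (osc s (freq k)) (INR m + 1 / 2) (INR m + 1 / 2 + INR n))
    (A - CInt (osc s (freq k)) 1 (INR m + 1 / 2))%C.
Proof.
intros Hs HA Hm. apply le_INR in Hm. simpl in Hm.
set (V := fun n => CInt (osc s (freq k)) (INR (m + n) + 1 / 2) (INR (m + n) + 1)).
apply (Clim_ext eventually (fun n => CInt (osc s (freq k)) 1 (INR (m + n) + 1)
   - CInt (osc s (freq k)) 1 (INR m + 1 / 2) - V n)%C).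
- exists O. intros n _. assert (Hn := pos_INR n). unfold V.
  rewrite (CInt_Chasles _ 1 (INR m + 1 / 2) (INR (m + n) + 1)); try (rewrite ?plus_INR; lra).
  2: apply Ccont_on_osc; lra.
  rewrite (CInt_Chasles _ (INR m + 1 / 2) (INR (m + n) + 1 / 2) (INR (m + n) + 1)); try (rewrite ?plus_INR; lra).
  2: apply Ccont_on_osc; lra.
  replace (INR (m + n) + 1 / 2) with (INR m + 1 / 2 + INR n) by (rewrite plus_INR; ring). ring.
- rewrite <- (Cminus_0_r (A - _)). apply (Clim_minus eventually).
  apply (Clim_minus eventually); [|apply (Clim_const eventually)].
  + intros eps He. destruct (HA eps He) as [N HN]. exists N. intros n Hn. apply HN. lia.
  + apply (Clim_squeeze eventually) with (fun n => 2 * Rpower (INR n + 1) (- Re s)).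
    * exists O. intros n _. rewrite Cminus_0_r. assert (Hn := pos_INR n). unfold V.
      assert (Hp : 0 < Rpower (INR n + 1) (- Re s)) by apply exp_pos.
      assert (Hmn : INR n <= INR (m + n)) by (rewrite plus_INR; lra).
      eapply Rle_trans. apply (Cmod_CInt_const _ _ _ (2 * Rpower (INR n + 1) (- Re s))). lra.
      intros x Hx. apply Ccont_osc; lra.
      intros x Hx. rewrite Cmod_osc. eapply Rle_trans; [|apply Rpower_half_le; lra].
      apply Rpower_opp_le; lra. lra.
    * assert (H := is_lim_seq_scal_l _ 2 _ (is_lim_seq_Rpower (Re s) ltac:(lra))).
      simpl in H. rewrite Rmult_0_r in H. exact H.
Qed.

(** Poisson summation starts at X = M + 5/2. The constant is 46 = 10 + 33 + 3: the pairs beyond X,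
    the initial pieces up to X, and one each for (M + 1)^(-s), (M + 2)^(-s) and X^(1-s) / (1 -
    s). *)
Lemma zeta_osc_inf (zeta : C -> C) (zeta1 : C -> R -> C) (sigma t : R) (M : nat) :
  is_riemann_zeta zeta -> is_hurwitz_zeta1 zeta1 -> 0 < sigma < 1 -> setup t M ->
  Cmod (zeta (sigma, t) - hsum 0 (sigma, t) M - Csm (osc_inf (sigma, t)) M)%C
   <= (46 + 3 / sigma) * Rpower (INR M) (- sigma) * harm M.
Proof.
intros Hz Hz1 Hs HS. assert (HS' := HS). destruct HS' as [Ht [HM [HMt HMt2]]]. assert (HP := PI_gt_3).
set (s := (sigma, t) : C). set (m := (M + 2)%nat).
assert (Em : INR m = INR M + 2) by (unfold m; rewrite plus_INR; reflexivity).
assert (Hne : (1 - s)%C <> 0) by (intros E; apply (f_equal Im) in E; simpl in E; lra).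
set (P := Rpower (INR M) (- sigma)). assert (HP0 : 0 < P) by apply exp_pos.
assert (HM1 : (1 <= M)%nat) by (apply INR_le; simpl; lra).
assert (Hh : 1 <= harm M) by (apply harm_ge_1, HM1).
set (X := INR m + 1 / 2).
set (f := fun x => Rcpow x (- s)).
(* Here K tends to infinity with n fixed; n follows in the next assertion. *)
assert (HB : forall n, Cmod ((Csm (fun k => Rcpow (INR (m + S k)) (- s)) n - CInt f X (X + INR n))
   - Csm (fun k => CInt (osc s (freq k)) X (X + INR n)) M)%C <= (10 + 3 / sigma) * P * harm M).
{ intros n. assert (Hn := pos_INR n).
  assert (EY : X + INR n = INR (m + n) + 1 / 2) by (unfold X; rewrite plus_INR; ring).
  apply (Clim_Cmod_le eventually (fun K => (CInt (fun x => RtoC (dirichlet K x) * f x)%C X (X + INR n) - CInt f X (X + INR n))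
   - Csm (fun k => CInt (osc s (freq k)) X (X + INR n)) M)%C).
  - apply (Clim_minus eventually); [|apply (Clim_const eventually)].
    apply (Clim_minus eventually); [|apply (Clim_const eventually)].
    apply (dirichlet_sum f (fun x => - s * Rcpow x (- s - 1))%C m n).
    + intros x Hx. apply Cder_Rcpow. lra.
    + intros x Hx. apply Ccont_mult. apply Ccont_const. apply Ccont_Rcpow. lra.
  - exists M. intros K HK. unfold f. rewrite dirichlet_osc by (unfold X; lra). fold f.
    replace (CInt f X (X + INR n) + Csm (fun k => osc2 s k X (X + INR n)) K - CInt f X (X + INR n))%C
      with (Csm (fun k => osc2 s k X (X + INR n)) K) by ring.
    rewrite EY. apply osc2_sum; try assumption. unfold m; lia. }
assert (HL : Cmod ((zeta s - hsum 0 s m + Rcpow X (1 - s) / (1 - s))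
    - Csm (fun k => osc_inf s k - CInt (osc s (freq k)) 1 X) M)%C <= (10 + 3 / sigma) * P * harm M).
{ apply (Clim_Cmod_le eventually (fun n => (Csm (fun k => Rcpow (INR (m + S k)) (- s)) n - CInt f X (X + INR n))
   - Csm (fun k => CInt (osc s (freq k)) X (X + INR n)) M)%C).
  - apply (Clim_minus eventually). apply zeta_half_lim; try assumption; lra.
    apply (Csm_Clim eventually (fun n k => CInt (osc s (freq k)) X (X + INR n))). intros k _.
    apply osc_half_lim. exact Hs. apply (osc_inf_lim zeta1); try assumption; lra. unfold m; lia.
  - exists O. intros n _. apply HB. }
rewrite Csm_minus in HL.
assert (HI := osc_initial_sum sigma t X M HS Hs ltac:(unfold X; lra)). fold s P in HI.
assert (HX : Cmod (Rcpow X (1 - s) / (1 - s))%C <= P).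
{ rewrite Cmod_div by exact Hne. rewrite Cmod_Rcpow.
  replace (Re (1 - s)%C) with (1 - sigma) by (simpl; ring).
  assert (H1 : t <= Cmod (1 - s)%C).
  { eapply Rle_trans; [|apply Rmax_Cmod]. eapply Rle_trans; [|apply Rmax_r]. simpl.
    replace (- 0 + - t) with (- t) by ring. replace (0 + - t) with (- t) by ring.
    rewrite Rabs_Ropp. apply Rle_abs. }
  apply Rdiv_le_intro. lra.
  assert (HXp : Rpower X (1 - sigma) <= 2 * (INR M * P)).
  { unfold P. rewrite <- Rpower_1_sub by lra. eapply Rle_trans; [|apply Rpower_double_le; lra].
    apply Rpower_le_l; unfold X; lra. }
  assert (2 * INR M <= t) by nra. nra. }
assert (HE : hsum 0 s m = (hsum 0 s M + (Rcpow (INR M + 1 + 0) (- s) + Rcpow (INR (S M) + 1 + 0) (- s)))%C).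
{ unfold m, hsum. replace (M + 2)%nat with (S (S M)) by lia. cbn [Csm]. ring. }
assert (HE1 : forall x, INR M <= x -> Cmod (Rcpow x (- s)) <= P).
{ intros x Hx. rewrite Cmod_Rcpow. simpl Re. apply Rpower_opp_le; lra. }
assert (H1 := HE1 (INR M + 1 + 0) ltac:(lra)). assert (H2 := HE1 (INR (S M) + 1 + 0) ltac:(rewrite S_INR; lra)).
rewrite HE in HL.
set (e1 := Rcpow (INR M + 1 + 0) (- s)) in *. set (e2 := Rcpow (INR (S M) + 1 + 0) (- s)) in *.
set (x1 := (Rcpow X (1 - s) / (1 - s))%C) in *.
set (I1 := Csm (fun k => CInt (osc s (freq k)) 1 X) M) in *.
set (A := Csm (osc_inf s) M) in *.
change (Csm (fun k => osc_inf s k) M) with A in HL.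
set (w := (zeta s - (hsum 0 s M + (e1 + e2)) + x1 - (A - I1))%C) in *.
replace (zeta s - hsum 0 s M - A)%C with (w + (e1 + (e2 - x1 - I1)))%C by (unfold w; ring).
assert (HPh : P <= P * harm M) by nra.
generalize (Cmod_triangle w (e1 + (e2 - x1 - I1))) (Cmod_triangle e1 (e2 - x1 - I1)) (Cmod_minus_le (e2 - x1) I1) (Cmod_minus_le e2 x1).
lra.
Qed.

(** * The contribution multiplied by chi *)

Lemma chi_osc_inf_term (zeta1 : C -> R -> C) (sigma t : R) (k : nat) :
  is_hurwitz_zeta1 zeta1 -> 0 < sigma < 1 -> 4 <= t -> 2 * freq k <= t ->
  Cmod (chi (sigma, t) * Cconj (osc_inf ((1 - sigma)%R, t) k) - Rcpow (INR k + 1 + 0) (- (sigma, t)))%C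
   <= 80 * Rpower t (- (1 / 2) - sigma) + 2 / t.
Proof.
intros Hz1 Hs Ht Hf. assert (HP := PI_gt_3). assert (Hf0 := freq_pos k). assert (Hk := pos_INR k).
set (s := (sigma, t) : C). set (s' := ((1 - sigma)%R, t) : C).
(* The integral over (0, oo). Since the frequency is at most t / 2, [osc_tail_value] places
   [osc_inf] within 4 / t of it. *)
set (J := (Rcpow (freq k) (s' - 1) * (Cexp (Ci * PI / 2 * (1 - s')) * Gamma (1 - s')))%C).
assert (H1 : Cmod (osc_inf s' k - J)%C <= 4 / t).
{ eapply Rle_trans. apply (osc_tail_value (1 - sigma) t (freq k)); try lra.
  apply (osc_inf_lim zeta1); try assumption; lra.
  apply Rle_trans with (2 / (t / 2)). apply Rmult_le_compat_l. lra. apply Rinv_le_contravar; lra.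
  right. field. lra. }
assert (E1 : (1 - s')%C = Cconj s) by (apply Ceq; simpl; ring).
assert (E2 : Cconj (s' - 1) = (- s)%C) by (apply Ceq; simpl; ring).
(* By [chi_reflection] c (1 + e^(i pi s)) = 1, and |e^(i pi s)| = e^(-pi t) makes |c - 1| at most 1
   / t. *)
set (c := (chi s * (Rcpow (2 * PI) (- s) * (Gamma s * Cexp (- (Ci * PI / 2 * s)))))%C).
assert (EJ : (chi s * Cconj J = c * Rcpow (INR k + 1 + 0) (- s))%C).
{ unfold J, c. rewrite !Cmult_conj, <- Rcpow_conj, E2, E1, <- Cexp_conj.
  rewrite Gamma_conj, Cconj_conj by exact Hs.
  unfold freq. rewrite Rplus_0_r, Rcpow_mult by lra.
  replace (Cconj (Ci * PI / 2 * Cconj s))%C with (- (Ci * PI / 2 * s))%C.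
  ring. replace (Ci * PI / 2 * Cconj s)%C with (RtoC (PI / 2) * (Ci * Cconj s))%C by (rewrite RtoC_div by lra; field).
  replace (Ci * PI / 2 * s)%C with (RtoC (PI / 2) * (Ci * s))%C by (rewrite RtoC_div by lra; field).
  apply Ceq; simpl; ring. }
assert (Hc : (c * (1 + Cexp (Ci * PI * s)) = 1)%C) by (apply chi_reflection; simpl; lra).
set (w := Cexp (Ci * PI * s)) in *.
assert (Hw : Cmod w <= / (2 * t)).
{ unfold w. rewrite Cmod_Cexp. replace (Re (Ci * PI * s)%C) with (- (PI * t)) by (simpl; ring).
  rewrite exp_Ropp. apply Rinv_le_contravar. lra. generalize (exp_ineq1_le (PI * t)). nra. }
assert (Hw2 : / (2 * t) <= 1 / 2).
{ replace (1 / 2) with (/ 2) by field. apply Rinv_le_contravar; lra. }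
assert (Hcm : Cmod c <= 2).
{ assert (H : Cmod c <= 1 + Cmod c * Cmod w).
  { rewrite <- Cmod_mult. rewrite <- Cmod_1. replace c with (1 - c * w)%C at 1.
    apply Cmod_minus_le. rewrite <- Hc. ring. }
  generalize (Cmod_ge_0 c). nra. }
assert (Hc1 : Cmod (c - 1)%C <= / t).
{ replace (c - 1)%C with (- (c * w))%C by (rewrite <- Hc; ring). rewrite Cmod_opp, Cmod_mult.
  replace (/ t) with (2 * / (2 * t)) by (field; lra).
  apply Rmult_le_compat; auto; apply Cmod_ge_0. }
assert (Hcp : Cmod (Rcpow (INR k + 1 + 0) (- s)) <= 1).
{ rewrite Cmod_Rcpow. simpl Re. apply Rle_trans with (Rpower 1 (- sigma)).
  apply Rpower_opp_le; lra. unfold Rpower; rewrite ln_1, Rmult_0_r, exp_0; lra. }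
replace (chi s * Cconj (osc_inf s' k) - Rcpow (INR k + 1 + 0) (- s))%C with
  (chi s * Cconj (osc_inf s' k - J) + (c - 1) * Rcpow (INR k + 1 + 0) (- s))%C.
2:{ rewrite Cminus_conj. transitivity (chi s * Cconj (osc_inf s' k) - chi s * Cconj J + (c - 1) * Rcpow (INR k + 1 + 0) (- s))%C.
    ring. rewrite EJ. ring. }
eapply Rle_trans. apply Cmod_triangle. rewrite !Cmod_mult, Cmod_conj. apply Rplus_le_compat.
- assert (H2 := chi_modulus sigma t Hs Ht). fold s in H2.
  apply Rle_trans with (20 * Rpower t (1 / 2 - sigma) * (4 / t)).
  apply Rmult_le_compat; auto; apply Cmod_ge_0.
  replace (- (1 / 2) - sigma) with (1 / 2 - sigma + - (1)) by field.
  rewrite (Rpower_plus _ (- (1))), Rpower_Ropp, Rpower_1 by lra. right. field. lra.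
- assert (0 < / t) by (apply Rinv_0_lt_compat; lra).
  apply Rle_trans with (/ t * 1). apply Rmult_le_compat; auto; apply Cmod_ge_0. unfold Rdiv. lra.
Qed.

(** The second bound makes 2 [freq k] at most t for every k < M, as [chi_osc_inf_term] requires. *)
Lemma setup_M_le (t : R) (M : nat) : setup t M -> INR M <= Rpower t (1 / 2) /\ 4 * PI * INR M <= t.
Proof.
intros [Ht [HM [H1 H2]]]. assert (HP := PI_gt_3). split.
- replace (1 / 2) with (/ 2) by field. rewrite Rpower_sqrt by lra.
  rewrite <- (sqrt_square (INR M)) by lra. apply sqrt_le_1; nra.
- nra.
Qed.

(** From t <= 36 M^2 and 36^(p/2) <= 6 for p <= 1. *)
Lemma setup_pow (t p : R) (M : nat) : setup t M -> 0 <= p <= 1 ->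
  Rpower (INR M) (- p) <= 6 * Rpower t (- (p / 2)).
Proof.
intros [Ht [HM [H1 H2]]] Hp. assert (HP := PI_gt_3). assert (HP4 := PI_4). set (m := INR M) in *.
assert (H3 : t / 36 <= m * m).
{ assert ((m + 1) * (m + 1) <= 4 / 3 * (m * m)) by nra.
  assert (2 * PI * ((m + 1) * (m + 1)) <= 8 * (4 / 3 * (m * m))) by (apply Rmult_le_compat; nra). lra. }
replace (Rpower m (- p)) with (Rpower (m * m) (- (p / 2))).
2:{ rewrite <- Rpower_mult_distr, <- Rpower_plus by lra. f_equal. field. }
eapply Rle_trans. apply (Rpower_opp_le (t / 36)); lra.
unfold Rdiv at 1. rewrite <- Rpower_mult_distr by lra. rewrite Rmult_comm. apply Rmult_le_compat_r. left; apply exp_pos.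
replace (Rpower (/ 36) (- (p / 2))) with (Rpower 36 (p / 2)) by (unfold Rpower; rewrite ln_Rinv by lra; f_equal; ring).
apply Rle_trans with (Rpower 36 (/ 2)). apply Rle_Rpower; lra.
rewrite Rpower_sqrt by lra. replace 36 with (6 * 6) by ring. rewrite sqrt_square; lra.
Qed.

Lemma setup_harm (t : R) (M : nat) : setup t M -> harm M <= 2 * ln t.
Proof.
intros [Ht [HM [H1 H2]]]. assert (HP := PI_gt_3).
assert (Hl : 1 <= ln t).
{ rewrite <- (ln_exp 1). apply ln_le_compat. apply exp_pos. generalize exp_le_3; lra. }
destruct M as [|M]. simpl in HM; lra.
eapply Rle_trans. apply harm_le. rewrite <- S_INR.
assert (ln (INR (S M)) <= ln t) by (apply ln_le_compat; nra). lra.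
Qed.

(** At most t^(1/2) terms of size t^(-1/2 - sigma) and 1 / t add up to t^(-sigma) and t^(-1/2); both
    are below t^(-sigma/2), the second because sigma < 1. *)
Lemma chi_osc_inf_sum (zeta1 : C -> R -> C) (sigma t : R) (M : nat) :
  is_hurwitz_zeta1 zeta1 -> 0 < sigma < 1 -> setup t M ->
  Cmod (chi (sigma, t) * Cconj (Csm (osc_inf ((1 - sigma)%R, t)) M) - hsum 0 (sigma, t) M)%C
   <= 82 * Rpower t (- (sigma / 2)).
Proof.
intros Hz1 Hs HS. assert (HS' := HS). destruct HS' as [Ht [HM _]]. assert (HP := PI_gt_3).
destruct (setup_M_le t M HS) as [HMs HMt].
set (b := 80 * Rpower t (- (1 / 2) - sigma) + 2 / t).
assert (Hb : 0 < b).
{ assert (0 < 2 / t) by (apply Rdiv_lt_0_compat; lra). generalize (exp_pos ((- (1 / 2) - sigma) * ln t)).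
  unfold b, Rpower. lra. }
apply Rle_trans with (INR M * b).
- rewrite Csm_conj, <- Csm_scal. unfold hsum. rewrite <- Csm_minus.
  eapply Rle_trans. apply (Csm_Cmod_le _ (fun k => INR k * b)).
  + intros k Hk. rewrite S_INR. replace ((INR k + 1) * b - INR k * b) with b by ring.
    apply (chi_osc_inf_term zeta1); try assumption. lra.
    assert (H : INR k + 1 <= INR M) by (rewrite <- S_INR; apply le_INR; lia).
    unfold freq. nra.
  + simpl INR. lra.
- apply Rle_trans with (Rpower t (1 / 2) * b). apply Rmult_le_compat_r; lra.
  assert (Ht1 : 1 <= t) by lra.
  unfold b. rewrite Rmult_plus_distr_l.
  replace (Rpower t (1 / 2) * (80 * Rpower t (- (1 / 2) - sigma))) with (80 * Rpower t (- sigma)).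
  2:{ replace (- sigma) with (1 / 2 + (- (1 / 2) - sigma)) by ring. rewrite Rpower_plus. ring. }
  replace (Rpower t (1 / 2) * (2 / t)) with (2 * Rpower t (- (1 / 2))).
  2:{ replace (- (1 / 2)) with (1 / 2 + - (1)) by field. rewrite Rpower_plus, (Rpower_Ropp t 1), Rpower_1 by lra.
      unfold Rdiv. ring. }
  assert (Rpower t (- sigma) <= Rpower t (- (sigma / 2))) by (apply Rle_Rpower; lra).
  assert (Rpower t (- (1 / 2)) <= Rpower t (- (sigma / 2))) by (apply Rle_Rpower; lra). lra.
Qed.

(** * Collecting the error terms *)

Theorem lemma2 (zeta : C -> C) (zeta1 : C -> R -> C)
  (Hzeta : is_riemann_zeta zeta) (Hzeta1 : is_hurwitz_zeta1 zeta1)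
  (sigma : R) (Hsigma : 0 < sigma < 1) :
  is_bigO_infty
    (fun t : R =>
       let s : C := (sigma, t) in
       let N : R := sqrt (t / (2 * PI)) in
       (zeta s
        - (CInt01 (fun alpha => Bsum N alpha * zeta1 s alpha)
           + chi s * CInt01 (fun alpha => Bsum N (- alpha) * zeta1 (1 - s) alpha)
           - CInt01 (fun alpha =>
               Bsum N alpha * Csum_upto N (fun n => Rcpow (INR n + alpha) (- s)))
           - chi s * CInt01 (fun alpha =>
               Bsum N (- alpha)
               * Csum_upto N (fun n => Rcpow (INR n + alpha) (s - 1)))))%C)
    (fun t : R => Rpower t (- sigma / 2) * ln t)
  /\
  is_bigO_infty
    (fun t : R =>
       let s : C := (sigma, t) in
       let N : R := sqrt (t / (2 * PI)) in
       (zeta s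
        - (CInt01 (fun alpha => Bsum N alpha * zeta1 s alpha)
           + chi s
             * CInt01 (fun alpha => Bsum N (- alpha) * zeta1 (1 - s) alpha)))%C)
    (fun t : R => Rpower t (- sigma / 2) * ln t).
Proof.
assert (HP := PI_gt_3).
assert (Hc : 0 < 3 / sigma) by (apply Rdiv_lt_0_compat; lra).
(* 12 is 6 from [setup_pow] times 2 from [setup_harm]; 82 is the constant of [chi_osc_inf_sum]. *)
set (K2 := 12 * (46 + 3 / sigma) + 82).
assert (Hmain : forall t, 800 <= t ->
  let s : C := (sigma, t) in let N := sqrt (t / (2 * PI)) in
  Cmod (zeta s - (CInt01 (fun alpha => Bsum N alpha * zeta1 s alpha)
           + chi s * CInt01 (fun alpha => Bsum N (- alpha) * zeta1 (1 - s) alpha)))%C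
    <= K2 * (Rpower t (- (sigma / 2)) * ln t) /\
  Cmod (CInt01 (fun alpha => Bsum N alpha * Csum_upto N (fun n => Rcpow (INR n + alpha) (- s)))
     + chi s * CInt01 (fun alpha => Bsum N (- alpha) * Csum_upto N (fun n => Rcpow (INR n + alpha) (s - 1))))%C
    <= 10000 * (Rpower t (- (sigma / 2)) * ln t)).
{ intros t Ht s N.
  assert (HS := setup_floor t Ht). fold N in HS. set (M := floor_nat N) in *.
  assert (HM := proj1 (proj2 HS)).
  assert (Hl : 1 <= ln t).
  { rewrite <- (ln_exp 1). apply ln_le_compat. apply exp_pos. generalize exp_le_3; lra. }
  assert (Hh := setup_harm t M HS).
  assert (Hh0 : 0 <= harm M) by (apply Rle_trans with (harm 0); [simpl; lra|apply harm_mono; lia]).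
  set (T := Rpower t (- (sigma / 2))). assert (HT : 0 < T) by apply exp_pos.
  assert (HTl : T <= T * ln t) by nra.
  assert (HMp := setup_pow t sigma M HS ltac:(lra)). fold T in HMp.
  assert (HMp0 : 0 < Rpower (INR M) (- sigma)) by apply exp_pos.
  assert (HMh : Rpower (INR M) (- sigma) * harm M <= 12 * (T * ln t)).
  { replace (12 * (T * ln t)) with (6 * T * (2 * ln t)) by ring. apply Rmult_le_compat; lra. }
  assert (E1 := Bsum_zeta1_int zeta1 sigma t N Hzeta1 Hsigma ltac:(lra)).
  assert (E2 := Bsum_opp_zeta1_int zeta1 sigma t N Hzeta1 Hsigma ltac:(lra)).
  assert (E3 := Bsum_hsum_int s N). assert (E4 := Bsum_opp_hsum_int sigma t N).
  fold s in E1, E2, E4. fold M in E1, E2, E3, E4. rewrite E1, E2, E3, E4. split.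
  - assert (H1 := zeta_osc_inf zeta zeta1 sigma t M Hzeta Hzeta1 Hsigma HS).
    assert (H2 := chi_osc_inf_sum zeta1 sigma t M Hzeta1 Hsigma HS). fold s in H1, H2. fold T in H2.
    set (A := Csm (osc_inf s) M) in *. set (B := (chi s * Cconj (Csm (osc_inf ((1 - sigma)%R, t)) M))%C) in *.
    (* The partial sum of the zeta series up to N cancels between the two comparisons. *)
    replace (zeta s - (A + B))%C with ((zeta s - hsum 0 s M - A) - (B - hsum 0 s M))%C by ring.
    eapply Rle_trans. apply Cmod_minus_le. unfold K2.
    rewrite Rmult_assoc in H1.
    assert ((46 + 3 / sigma) * (Rpower (INR M) (- sigma) * harm M) <= (46 + 3 / sigma) * (12 * (T * ln t)))
      by (apply Rmult_le_compat_l; lra).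
    lra.
  (* Each sum is bounded with 33 times 12 = 396, and |chi| brings a further 20, hence 7920; 10000
     exceeds their total. In the second sum the exponents 1/2 - sigma and -(1 - sigma)/2 add up to
     -sigma/2. *)
  - assert (H1 := osc_initial_sum sigma t (INR M + 1) M HS Hsigma ltac:(lra)). fold s in H1.
    assert (H2 := osc_initial_sum (1 - sigma) t (INR M + 1) M HS ltac:(lra) ltac:(lra)).
    assert (H3 := chi_modulus sigma t Hsigma ltac:(lra)). fold s in H3.
    assert (HMq := setup_pow t (1 - sigma) M HS ltac:(lra)).
    eapply Rle_trans. apply Cmod_triangle. rewrite Cmod_mult, Cmod_conj.
    set (D := Cmod (Csm (fun k => CInt (osc ((1 - sigma)%R, t) (freq k)) 1 (INR M + 1)) M)) in *.
    assert (HD : D <= 396 * (Rpower t (- ((1 - sigma) / 2)) * ln t)).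
    { eapply Rle_trans. apply H2.
      replace (396 * (Rpower t (- ((1 - sigma) / 2)) * ln t)) with
        (33 * (6 * Rpower t (- ((1 - sigma) / 2))) * (2 * ln t)) by ring.
      assert (H4 : 0 < Rpower (INR M) (- (1 - sigma))) by apply exp_pos.
      apply Rmult_le_compat; lra. }
    assert (HcD : Cmod (chi s) * D <= 7920 * (T * ln t)).
    { apply Rle_trans with (20 * Rpower t (1 / 2 - sigma) * (396 * (Rpower t (- ((1 - sigma) / 2)) * ln t))).
      apply Rmult_le_compat; auto; apply Cmod_ge_0.
      right. unfold T. replace (- (sigma / 2)) with ((1 / 2 - sigma) + - ((1 - sigma) / 2)) by field.
      rewrite Rpower_plus. ring. }
    assert (H5 : 0 < T * ln t) by nra.
    rewrite Rmult_assoc in H1. lra. }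
assert (Habs : forall t, 800 <= t -> Rabs (Rpower t (- sigma / 2) * ln t) = Rpower t (- (sigma / 2)) * ln t).
{ intros t Ht. replace (- sigma / 2) with (- (sigma / 2)) by field. apply Rabs_pos_eq.
  apply Rmult_le_pos. left; apply exp_pos. rewrite <- ln_1. apply ln_le_compat; lra. }
split.
- exists (K2 + 10000), 800. intros t Ht. rewrite Habs by lra.
  destruct (Hmain t ltac:(lra)) as [H1 H2]. cbv zeta in *.
  set (s := (sigma, t) : C) in *. set (N := sqrt (t / (2 * PI))) in *.
  set (A := CInt01 (fun alpha => Bsum N alpha * zeta1 s alpha)%C) in *.
  set (B := (chi s * CInt01 (fun alpha => Bsum N (- alpha) * zeta1 (1 - s) alpha))%C) in *.
  set (A' := CInt01 (fun alpha => Bsum N alpha * Csum_upto N (fun n => Rcpow (INR n + alpha) (- s)))%C) in *.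
  set (B' := (chi s * CInt01 (fun alpha => Bsum N (- alpha) * Csum_upto N (fun n => Rcpow (INR n + alpha) (s - 1))))%C) in *.
  replace (zeta s - (A + B - A' - B'))%C with ((zeta s - (A + B)) + (A' + B'))%C by ring.
  eapply Rle_trans. apply Cmod_triangle. lra.
- exists K2, 800. intros t Ht. rewrite Habs by lra. apply (Hmain t ltac:(lra)).
Qed.
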